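(* For every finite-range repulsive pair potential $\phi$ on $\mathbb{R}^d$ and every $\lambda<e/\Delta_\phi$, there exists $L_0>0$ such that for every $L\ge L_0$, every $n$, and every activity function $\boldsymbol{\lambda}$ bounded by $\lambda$ and supported on $\Lambda_n=[-n,n]^d$, the block dynamics with update radius $L$ for the Gibbs point process $\mu_{\Lambda_n,\boldsymbol{\lambda}}$ has mixing time $\tau_{\mathrm{mix}}(\varepsilon)=O(N\log(N/\varepsilon))$, where $N=|\Lambda_n|=(2n)^d$. ($L_0$ depends on $\phi$ and $\lambda$ but not on $n$.)
   Context: $\phi$ symmetric, $\phi\ge0$, $\phi(x)=0$ for $\|x\|>r$; $H(x_1,..,x_k)=\sum_{i<j}\phi(x_i-x_j)$. $\mu_{\Lambda_n,\boldsymbol{\lambda}}$ is the law on finite point sets in $\Lambda_n$ with density $\prod_i\boldsymbol{\lambda}(x_i)e^{-H}/Z$ w.r.t. the Poisson process (with $1/k!$ convention). The potential-weighted connective constant is $\Delta_\phi=\inf_{k\ge1}V_k^{1/k}=\lim_kV_k^{1/k}$, where with $v_0=0$, $V_k=\int_{(\mathbb{R}^d)^k}\prod_{j=1}^k\big(\exp(-\sum_{i=0}^{j-2}\mathbf 1_{|v_j-v_i|<|v_i-v_{i+1}|}\phi(v_j-v_i))(1-e^{-\phi(v_j-v_{j-1})})\big)dv$. Block dynamics with update radius $L$: from configuration $X_t\subset\Lambda_n$, pick $y\in\Lambda_n$ uniformly at random and replace the points in $B_L(y)$ by a sample $Y$ of the point process on $B_L(y)$ with density $e^{-H^{X_t}_{L,y}}$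 against the Poisson process of intensity $\boldsymbol{\lambda}$ on $B_L(y)$, where $H^{X_t}_{L,y}(x_1,\dots,x_k)=\sum_{i<j}\phi(x_i-x_j)+\sum_i\sum_{x\in X_t\setminus B_L(y)}\phi(x_i-x)$; set $X_{t+1}=(X_t\setminus B_L(y))\cup Y$. The mixing time is $\tau_{\mathrm{mix}}(\varepsilon)=\sup_{\mu_0}\min\{j\ge0:\|\mu_j-\mu_{\Lambda_n,\boldsymbol{\lambda}}\|_{TV}<\varepsilon\}$, $\mu_j$ the law after $j$ steps from initial law $\mu_0$. *)

(* Defs.v *)
From HB Require Import structures.
From mathcomp Require Import all_boot all_order all_algebra.
From mathcomp Require Import all_classical all_reals all_analysis measurable_realfun.

Set Implicit Arguments.
Unset Strict Implicit.
Unset Printing Implicit Defensive.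

Import Order.TTheory GRing.Theory Num.Theory.
Import numFieldNormedType.Exports.

Local Open Scope classical_set_scope.
Local Open Scope ring_scope.

Section GibbsBlockDynamics.
Variable R : realType.
Variable d : nat.

Definition pt := 'rV[R]_d.

Definition enorm (x : pt) : R := Num.sqrt (\sum_(i < d) x ord0 i ^+ 2).

Definition borelRd : set (set pt) :=
  g_sigma_preimage (fun (i : 'I_d) (x : pt) => x ord0 i).

Definition borel_fun (f : pt -> R) : Prop :=
  forall B : set R, measurable B -> borelRd (f @^-1` B).

Definition borel_efun (f : pt -> \bar R) : Prop :=
  forall B : set (\bar R), measurable B -> borelRd (f @^-1` B).

Definition Lam (n : nat) : set pt := [set x | forall i : 'I_d, `|x ord0 i| <= n%:R].

Definition ball_L (L : R) (y : pt) : set pt := [set x | enorm (x - y) < L].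

(** Finite point configurations, represented by finite sequences of points.
    The sigma-algebra is the usual point-process one, generated by the
    counting maps X |-> #(X \cap B), B Borel. *)
Definition conf := seq pt.

Definition count_in (B : set pt) (X : conf) : nat := count (fun x => x \in B) X.

Definition count_events : set (set conf) :=
  [set E | exists (B : set pt) (k : nat), borelRd B /\ E = [set X | count_in B X = k]].

HB.instance Definition _ := Choice.on conf.
HB.instance Definition _ := isPointed.Build conf [::].

Definition confT : measurableType _ := @g_sigma_algebraType conf count_events.

Local Open Scope ereal_scope.

(** Lebesgue integration over R^m (iterated one-dimensional Lebesgue
    integrals of a nonnegative integrand; equal to the integral w.r.t.
    Lebesgue measure on R^m by Tonelli), over R^d, and over (R^d)^k. *)
Fixpoint int_seq (m : nat) (G : seq R -> \bar R) : \bar R :=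
  match m with
  | 0%N => G [::]
  | m'.+1 => \int[@lebesgue_measure R]_t int_seq m' (fun s => G (t :: s))
  end.

Definition mk_pt (s : seq R) : pt := \row_(i < d) nth 0%R s i.

Definition int_pt (f : pt -> \bar R) : \bar R := int_seq d (fun s => f (mk_pt s)).

Fixpoint int_conf (k : nat) (F : conf -> \bar R) : \bar R :=
  match k with
  | 0%N => F [::]
  | k'.+1 => int_pt (fun x => int_conf k' (fun s => F (x :: s)))
  end.

Definition pair_energy (phi : pt -> \bar R) (s : conf) : \bar R :=
  \sum_(i < size s) \sum_(j < size s | (i < j)%N) phi (nth 0%R s i - nth 0%R s j)%R.

Definition poisson_sum (W : conf -> \bar R) : \bar R :=
  \sum_(k <oo) (((k`!)%:R)^-1)%:E * int_conf k W.

(** Gibbs point process mu_{Lambda_n, lam} (lam is supported in Lambda_n). *)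
Definition gibbs_weight (phi : pt -> \bar R) (lamf : pt -> R) (s : conf) : \bar R :=
  (\prod_(x <- s) (lamf x)%:E) * expeR (- pair_energy phi s).

Definition gibbs (phi : pt -> \bar R) (lamf : pt -> R) (A : set confT) : \bar R :=
  poisson_sum (fun s => (\1_A (s : confT))%:E * gibbs_weight phi lamf s) *
  ((fine (poisson_sum (gibbs_weight phi lamf)))^-1)%:E.

Definition outside (L : R) (y : pt) (X : conf) : conf :=
  [seq x <- X | x \notin ball_L L y].

Definition local_energy (phi : pt -> \bar R) (L : R) (y : pt) (X : conf)
  (s : conf) : \bar R :=
  pair_energy phi s + \sum_(x <- s) \sum_(z <- outside L y X) phi (x - z)%R.

Definition local_weight (phi : pt -> \bar R) (lamf : pt -> R) (L : R) (y : pt)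
  (X : conf) (s : conf) : \bar R :=
  (\prod_(x <- s) (lamf x * \1_(ball_L L y) x)%R%:E) *
  expeR (- local_energy phi L y X s).

Definition volume (n : nat) : R := (((2 * n)%:R) ^+ d)%R.

(** One step of the chain acting on a nonnegative test function f:
    (P f)(X) = E[ f(X_{t+1}) | X_t = X ]. *)
Definition block_step (phi : pt -> \bar R) (lamf : pt -> R) (n : nat) (L : R)
  (f : conf -> \bar R) (X : conf) : \bar R :=
  ((volume n)^-1)%:E *
  int_pt (fun y => (\1_(Lam n) y)%:E *
    (poisson_sum (fun s => f (outside L y X ++ s) * local_weight phi lamf L y X s) *
     ((fine (poisson_sum (local_weight phi lamf L y X)))^-1)%:E)).

Definition law_after (phi : pt -> \bar R) (lamf : pt -> R) (n : nat) (L : R)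
  (mu0 : probability confT R) (j : nat) (A : set confT) : \bar R :=
  \int[mu0]_X (iter j (block_step phi lamf n L) (fun Y : conf => (\1_A (Y : confT))%:E)) X.

Definition tv_dist (P Q : set confT -> \bar R) : \bar R :=
  ereal_sup [set `| P A - Q A | | A in [set A : set confT | measurable A]].

Definition Vk (phi : pt -> \bar R) (k : nat) : \bar R :=
  int_conf k (fun s =>
    let v := fun i : nat => nth 0%R (0%R :: s) i in
    \prod_(1 <= j < k.+1)
      (expeR (- \sum_(0 <= i < j.-1)
                 ((enorm (v j - v i) < enorm (v i - v i.+1))%R%:R%:E * phi (v j - v i)%R)) *
       (1 - expeR (- phi (v j - v j.-1)%R)))).

Definition Delta_phi (phi : pt -> \bar R) : \bar R :=
  ereal_inf [set poweR (Vk phi k) (k%:R^-1) | k in [set k : nat | (0 < k)%N]].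

End GibbsBlockDynamics.

(* Main.v *)
(* Let N = (2n)^d.  Writing a for an activity and Z(a) for its partition function, the ratios
   Z(a k_v) / Z(a), with k_v(w) = exp (- phi (v - w)), satisfy the recursion
     Z(a k_v) / Z(a) = exp (- \int a(w) (1 - k_v(w)) Z(a_{vw} k_w) / Z(a_{vw}) dw),
   where a_{vw} equals a k_v on the ball of radius |w - v| about v and a outside it.  On the
   scale of square roots one step of it contracts, in mean square, by the factor 1/e times the
   weight appearing in V_k, so lam < e / Delta_phi forces exponential decay of the influence of
   a distant change of the activity (strong spatial mixing).

   Two block updates at y from configurations X, X' that differ only in a unit cube near q
   coincide when B_L(y) contains the cube, and keep the discrepancy when B_L(y) is far from it.
   Otherwise y lies in an annulus of bounded width, and strong spatial mixing, applied shell by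
   shell about q, bounds the new discrepancy by a constant independent of L.  The annulus has
   relative volume O(1/L), so for L large the oscillation of a test function over one unit cube
   shrinks by the factor 1 - 1/(2N) at each step.  Since Lambda_n is covered by N unit cubes and
   the Gibbs law is stationary, the distance after j steps is at most N (1 - 1/(2N))^j. *)

(* The constant e comes from exp(-s^2/2), whose largest slope is exp(-1/2): the square root of Z(a
   k_v)/Z(a) is this function of an L2 norm of the square roots one level down. Interpolating from a
   to a k_v in the order of the distance to v produces the indicators |v_j - v_i| < |v_i - v_{i+1}|
   of V_k. As Delta_phi is an infimum, the recursion is iterated in batches of one k with (lam/e)^k
   V_k < 1. Mixing speaks of one-point ratios only; it reaches expectations because a ratio of
   partition functions is the exponential of an integral of such ratios. A configuration may hold
   arbitrarily many points, so discrepancies are counted in unit cubes rather than points, which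
   makes the bound uniform in the initial law. No coupling is built: the chain acts on test
   functions, and their oscillation over one cube is propagated. In the annulus, the effect on a
   shell decays geometrically in its index while its number of cubes grows polynomially; the sum is
   a constant K fixed before L. Then L is taken so large that the annulus, intersected with
   Lambda_n, is small compared with the inner ball, also intersected with Lambda_n. *)
Require Import Defs.
From HB Require Import structures.
From mathcomp Require Import all_boot all_order all_algebra.
From mathcomp Require Import all_classical all_reals all_analysis measurable_realfun.
From mathcomp Require Import ring lra.
Import Order.TTheory GRing.Theory Num.Theory.
Import numFieldNormedType.Exports.
Set Implicit Arguments.
Unset Strict Implicit.
Unset Printing Implicit Defensive.
Local Open Scope classical_set_scope.
Local Open Scope ring_scope.

(** * Measurable structure on finite sequences *)

(* Lists carry the sigma-algebra generated by the size and the entries, which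
   is finer than the counting one of [confT]: it makes order-dependent
   functions such as [head] and [behead] measurable. *)
Definition lst (T : Type) := seq T.
HB.instance Definition _ (T : choiceType) := Choice.on (lst T).
HB.instance Definition _ (T : choiceType) := isPointed.Build (lst T) [::].

Lemma measurable_fun_nat d (Y : measurableType d) (f : nat -> Y) :
  measurable_fun setT f.
Proof. by []. Qed.

Section lst_measurable.
Context d (T : measurableType d).

Definition lst_gen : set (set (lst T)) :=
  [set A | exists k, A = [set s | size s = k]] `|`
  [set A | exists i B, measurable B /\ A = [set s | B (nth point s i)]].

HB.instance Definition _ := @isMeasurable.Build (sigma_display lst_gen)
  (lst T) (<<s lst_gen >>) (@sigma_algebra0 _ setT lst_gen)
  (@sigma_algebraC _ lst_gen) (@sigma_algebra_bigcup _ setT lst_gen).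

Lemma measurable_size_eq k : measurable ([set s | size s = k] : set (lst T)).
Proof. by apply: sub_sigma_algebra; left; exists k. Qed.

Lemma measurable_size : measurable_fun setT (size : lst T -> nat).
Proof.
move=> _ Y _; rewrite setTI.
rewrite (_ : _ @^-1` _ = \bigcup_(k in Y) [set s : lst T | size s = k]); last first.
  by apply/seteqP; split=> [s Ys|s [k Yk /= sk]]; [exists (size s)|rewrite /preimage/= sk].
by apply: bigcup_measurable => k _; exact: measurable_size_eq.
Qed.

Lemma measurable_nth_point i : measurable_fun setT (fun s : lst T => nth point s i).
Proof. by move=> _ B mB; rewrite setTI; apply: sub_sigma_algebra; right; exists i, B. Qed.

Lemma measurable_nth x0 i : measurable_fun setT (fun s : lst T => nth x0 s i).
Proof.
rewrite (_ : (fun _ => _) = fun s : lst T => if (i < size s)%N then nth point s i else x0).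
  apply: measurable_fun_ifT; [|exact: measurable_nth_point|exact: measurable_cst].
  exact: (measurableT_comp (measurable_fun_nat (fun n => (i < n)%N)) measurable_size).
apply/funext => s; case: ltnP => is_; first exact: set_nth_default.
by rewrite nth_default.
Qed.

Lemma measurable_to_lst d' (X : measurableType d') (f : X -> lst T) :
  measurable_fun setT (fun x => size (f x)) ->
  (forall i, measurable_fun setT (fun x => nth point (f x) i)) ->
  measurable_fun setT f.
Proof.
move=> ms mn; apply: (measurability lst_gen) => // _ [_ [[k ->]|[i [B [mB ->]]]] <-].
- by rewrite setTI; have := ms measurableT [set k] I; rewrite setTI.
- by rewrite setTI; have := mn i measurableT B mB; rewrite setTI.
Qed.

Lemma measurable_lcons d' (X : measurableType d') (f : X -> T) (g : X -> lst T) :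
  measurable_fun setT f -> measurable_fun setT g ->
  measurable_fun setT (fun x => f x :: g x : lst T).
Proof.
move=> mf mg; apply: measurable_to_lst => /=.
  apply: (measurableT_comp (measurable_fun_nat succn)).
  exact: (measurableT_comp measurable_size).
by case=> [//|i]; exact: (measurableT_comp (measurable_nth_point i) mg).
Qed.

Lemma measurable_lbehead : measurable_fun setT (behead : lst T -> lst T).
Proof.
apply: measurable_to_lst => /=.
  rewrite (_ : (fun _ => _) = predn \o (size : lst T -> nat)).
    exact: (measurableT_comp (measurable_fun_nat predn) measurable_size).
  by apply/funext => s /=; rewrite size_behead.
move=> i; rewrite (_ : (fun _ => _) = fun s : lst T => nth point s i.+1).
  exact: measurable_nth_point.
by apply/funext => s; rewrite nth_behead.
Qed.

Lemma measurable_lhead : measurable_fun setT (head point : lst T -> T).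
Proof.
rewrite (_ : head point = fun s : lst T => nth point s 0) ?nth0; first exact: measurable_nth_point.
by apply/funext => s; rewrite nth0.
Qed.

End lst_measurable.

Lemma measurable_fun_pairD d d1 d2 (X : measurableType d) (T1 : measurableType d1)
    (T2 : measurableType d2) (D : set X) (f : X -> T1) (g : X -> T2) :
  measurable D -> measurable_fun D f -> measurable_fun D g ->
  measurable_fun D (fun x => (f x, g x)).
Proof.
move=> mD mf mg.
apply: (@eq_measurable_fun _ _ _ _ _ (fun x => ((f \_ D) x, (g \_ D) x))).
  by move=> x xD; rewrite /patch xD.
apply: measurable_funTS; apply: measurable_fun_pair.
  by move/measurable_restrictT : mf; apply.
by move/measurable_restrictT : mg; apply.
Qed.

Section lst_recursion.
Context d (T : measurableType d) dP (P : measurableType dP) dY (Y : measurableType dY).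

Definition szk (k : nat) : set (P * lst T) := [set q | size q.2 = k].

Lemma measurable_szk k : measurable (szk k).
Proof.
rewrite (_ : szk k = setT `&` snd @^-1` [set s : lst T | size s = k]).
  by apply: measurable_snd => //; exact: measurable_size_eq.
by rewrite setTI.
Qed.

(** Lengths are treated by induction with [lst_rec0] and [lst_recS]. Each step moves the head into
    the parameter space, which becomes [P * T], so recursions that update an accumulator from the
    entries already read are covered. *)
Lemma lst_recursion (f : P * lst T -> Y) :
  (forall k, measurable_fun (szk k) f) -> measurable_fun setT f.
Proof.
move=> mf; rewrite (_ : setT = \bigcup_k szk k).
  by apply/measurable_fun_bigcup => // k; exact: measurable_szk.
by apply/seteqP; split=> // q _; exists (size q.2).
Qed.

Lemma lst_rec0 (f : P * lst T -> Y) :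
  measurable_fun setT (fun p => f (p, [::])) -> measurable_fun (szk 0) f.
Proof.
move=> mf; apply: (@eq_measurable_fun _ _ _ _ _ (fun q => f (q.1, [::]))).
  by move=> [p s]; rewrite inE /szk/= => /size0nil ->.
by apply: measurable_funTS; exact: (measurableT_comp mf).
Qed.

End lst_recursion.

Lemma measurable_fun_szkS d (T : measurableType d) dP (P : measurableType dP)
  dY (Y : measurableType dY) k (g : (P * T) * lst T -> Y) :
  measurable_fun (szk k) g ->
  measurable_fun (szk k.+1) (fun q : P * lst T => g ((q.1, head point q.2), behead q.2)).
Proof.
move=> mg; apply: (@measurable_comp _ _ _ _ _ _ (szk k)) => //.
- exact: measurable_szk.
- by move=> _ [[p s] /= sk <-]; rewrite /szk/= size_behead sk.
- apply: measurable_funTS; apply: measurable_fun_pair.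
    apply: measurable_fun_pair; first exact: measurable_fst.
    by apply: measurableT_comp; [exact: measurable_lhead|exact: measurable_snd].
  by apply: measurableT_comp; [exact: measurable_lbehead|exact: measurable_snd].
Qed.

Lemma lst_recS d (T : measurableType d) dP (P : measurableType dP)
  dY (Y : measurableType dY) k (f : P * lst T -> Y) :
  measurable_fun (szk k) (fun q : (P * T) * lst T => f (q.1.1, q.1.2 :: q.2)) ->
  measurable_fun (szk k.+1) f.
Proof.
move=> /measurable_fun_szkS; apply: eq_measurable_fun => -[p [|x s]].
  by rewrite inE.
by [].
Qed.

Lemma measurable_lcat d (T : measurableType d) d' (X : measurableType d')
    (f g : X -> lst T) : measurable_fun setT f -> measurable_fun setT g ->
  measurable_fun setT (fun x => f x ++ g x : lst T).
Proof.
move=> mf mg.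
suff h : measurable_fun setT (fun q : lst T * lst T => (q.2 ++ q.1 : lst T)).
  exact: (measurableT_comp h (measurable_fun_pair mg mf)).
apply: lst_recursion => k.
(* The parameter space is generalised before the induction because it grows at every step. *)
suff h dP (P : measurableType dP) (t : P -> lst T) : measurable_fun setT t ->
    measurable_fun (szk k) (fun q : P * lst T => (q.2 ++ t q.1 : lst T)).
  exact: (h _ _ id (@measurable_id _ _ setT)).
elim: k dP P t => [|k ih] dP P t mt; first exact: lst_rec0.
apply: lst_recS => /=.
apply: (measurableT_comp (measurable_lcons (f := fun q : T * lst T => q.1)
  (g := fun q => q.2) measurable_fst measurable_snd)
  (g := fun q : (P * T) * lst T => (q.1.2, (q.2 ++ t q.1.1 : lst T)))).
apply: measurable_fun_pairD; first exact: measurable_szk.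
  by apply: measurable_funTS; apply: (measurableT_comp measurable_snd measurable_fst).
exact: (ih _ _ (t \o fst) (measurableT_comp mt measurable_fst)).
Qed.

Lemma measurable_lfilter d (T : measurableType d) dP (P : measurableType dP)
    (b : P -> T -> bool) : measurable_fun setT (fun q : P * T => b q.1 q.2) ->
  measurable_fun setT (fun q : P * lst T => ([seq x <- q.2 | b q.1 x] : lst T)).
Proof.
move=> mb; apply: lst_recursion => k.
elim: k dP P b mb => [|k ih] dP P b mb; first by apply: lst_rec0; exact: measurable_cst.
apply: lst_recS => /=.
have ihk : measurable_fun (szk k) (fun q : (P * T) * lst T => ([seq x <- q.2 | b q.1.1 x] : lst T)).
  apply: (ih _ _ (fun p x => b p.1 x)).
  apply: (measurableT_comp mb (g := fun q : (P * T) * T => (q.1.1, q.2))).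
  apply: measurable_fun_pair; last exact: measurable_snd.
  exact: (measurableT_comp measurable_fst measurable_fst).
apply: measurable_fun_if.
- exact: measurable_szk.
- apply: measurable_funTS.
  exact: (measurableT_comp mb (@measurable_fst _ _ (P * T)%type (lst T))).
- apply: (@measurable_funS _ _ _ _ (szk k)) => //; first exact: measurable_szk.
  apply: (measurableT_comp (measurable_lcons (f := fun q : T * lst T => q.1)
     (g := fun q => q.2) measurable_fst measurable_snd)
     (g := fun q : (P * T) * lst T => (q.1.2, ([seq x <- q.2 | b q.1.1 x] : lst T)))).
  apply: measurable_fun_pairD => //; first exact: measurable_szk.
  by apply: measurable_funTS; apply: (measurableT_comp measurable_snd measurable_fst).
- by apply: (@measurable_funS _ _ _ _ (szk k)) => //; exact: measurable_szk.
Qed.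

Lemma measurable_lcount d (T : measurableType d) dP (P : measurableType dP)
    (b : P -> T -> bool) : measurable_fun setT (fun q : P * T => b q.1 q.2) ->
  measurable_fun setT (fun q : P * lst T => count (b q.1) q.2).
Proof.
move=> mb; rewrite (_ : (fun _ => _) = fun q : P * lst T => size [seq x <- q.2 | b q.1 x]).
  have := measurableT_comp (@measurable_size _ T) (measurable_lfilter mb); exact.
by apply/funext => q; rewrite size_filter.
Qed.

Lemma measurable_lall d (T : measurableType d) dP (P : measurableType dP)
    (b : P -> T -> bool) : measurable_fun setT (fun q : P * T => b q.1 q.2) ->
  measurable_fun setT (fun q : P * lst T => all (b q.1) q.2).
Proof.
move=> mb; rewrite (_ : (fun _ => _) = fun q : P * lst T => (count (b q.1) q.2 == size q.2)).
  apply: measurable_fun_eqn; first exact: measurable_lcount.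
  have := measurableT_comp (@measurable_size _ T) (@measurable_snd _ _ P (lst T)); exact.
by apply/funext => q; rewrite all_count.
Qed.

Lemma measurable_lall1 d (T : measurableType d) (b : T -> bool) :
  measurable_fun setT b -> measurable_fun setT (fun s : lst T => all b s).
Proof.
move=> mb; have /= h := measurable_lall (b := fun _ : unit => b) (measurableT_comp mb measurable_snd).
exact: (measurableT_comp h (measurable_fun_pair (measurable_cst tt) (@measurable_id _ (lst T) setT))).
Qed.

Lemma measurable_lcons1 d (T : measurableType d) (x : T) :
  measurable_fun setT (fun s : lst T => (x :: s : lst T)).
Proof. by apply: measurable_lcons => //; exact: measurable_cst. Qed.

Local Open Scope ereal_scope.

(** * S-finite measures as constant kernels *)

Section kcst.
Context d d' (X : measurableType d) (Y : measurableType d') (R : realType).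

(** Composing kernels that ignore their argument yields products, image measures and series that are
    s-finite by construction, as Tonelli and the measurability of partial integrals require. *)
Definition kcst (m : {measure set Y -> \bar R}) (x : X) : {measure set Y -> \bar R} := m.

Let kcst_measurable m U : measurable U -> measurable_fun [set: X] (kcst m ^~ U).
Proof. by move=> mU; exact: measurable_cst. Qed.

HB.instance Definition _ m := isKernel.Build _ _ X Y R (kcst m) (kcst_measurable m).

Definition kcsts (m : {sfinite_measure set Y -> \bar R}) (x : X) :
  {measure set Y -> \bar R} := m.

HB.instance Definition _ m := Kernel.copy (kcsts m) (kcst m).

Let kcsts_sfinite (m : {sfinite_measure set Y -> \bar R}) :
  exists2 s : (R.-ker X ~> Y)^nat, forall n, measure_fam_uub (s n) &
    forall x U, measurable U -> kcsts m x U = kseries s x U.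
Proof.
exists (fun n => kcst (sfinite_measure_seq m n)).
  move=> n; exists (fine (sfinite_measure_seq m n setT) + 1)%R => x.
  have h : sfinite_measure_seq m n setT \is a fin_num by exact: fin_num_measure.
  by rewrite /= -[ltLHS]fineK// lte_fin ltrDl.
by move=> x U mU /=; rewrite /kcsts sfinite_measure_seqP.
Qed.

HB.instance Definition _ m := isSFiniteKernel_subdef.Build _ _ X Y R (kcsts m) (kcsts_sfinite m).

End kcst.

Section sfinite_constructions.
Context d d' (X : measurableType d) (Y : measurableType d') (R : realType).

Lemma measurable_integral_sfinite (m : {sfinite_measure set Y -> \bar R})
    (f : X * Y -> \bar R) : (forall q, 0 <= f q) -> measurable_fun setT f ->
  measurable_fun setT (fun x => \int[m]_y f (x, y)).
Proof.
move=> f0 mf.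
exact: (measurable_fun_integral_sfinite_kernel f (kcsts (X := X) m)).
Qed.

Definition sfk_measure (k : R.-sfker X ~> Y) (x : X) : set Y -> \bar R := k x.
HB.instance Definition _ k x := Measure.on (sfk_measure k x).
HB.instance Definition _ k x := isSFinite.Build _ _ _ (sfk_measure k x)
  (sfinite_kernel_measure k x).

Definition skcomp dZ (Z : measurableType dZ) (l : R.-sfker Z ~> X)
  (k : R.-sfker (Z * X) ~> Y) : R.-sfker Z ~> Y := (l \; k).

End sfinite_constructions.

Lemma integral_skcomp d d' d'' (X : measurableType d) (Y : measurableType d')
    (Z : measurableType d'') (R : realType) (l : R.-sfker Z ~> X)
    (k : R.-sfker (Z * X) ~> Y) z (f : Y -> \bar R) :
  (forall y, 0 <= f y) -> measurable_fun setT f ->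
  \int[sfk_measure (skcomp l k) z]_y f y = \int[l z]_x \int[k (z, x)]_y f y.
Proof. by move=> f0 mf; rewrite -integral_kcomp. Qed.

(* The measures below are kept opaque: only their integration formulas matter,
   and unfolding the underlying kernels makes unification diverge. *)
Section spush.
Context d d' (X : measurableType d) (Y : measurableType d') (R : realType).
Variables (m : {sfinite_measure set X -> \bar R}) (f : X -> Y).
Hypothesis mf : measurable_fun setT f.

Lemma spush_sig : {m' : {sfinite_measure set Y -> \bar R} |
  forall g, (forall y, 0 <= g y) -> measurable_fun setT g ->
    \int[m']_y g y = \int[m]_x g (f x)}.
Proof.
exists (sfk_measure (skcomp (kcsts (X := unit) m)
    (kdirac (measurableT_comp mf (@measurable_snd _ _ unit X)))) tt).
move=> g g0 mg; rewrite integral_skcomp//; apply: eq_integral => x _.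
by rewrite integral_dirac//= diracT mul1e.
Qed.

Definition spush : {sfinite_measure set Y -> \bar R} := sval spush_sig.

Lemma integral_spush (g : Y -> \bar R) : (forall y, 0 <= g y) ->
  measurable_fun setT g -> \int[spush]_y g y = \int[m]_x g (f x).
Proof. exact: (svalP spush_sig). Qed.

End spush.

(** * Powers of a measure and the Poisson process *)

Section power_measure.
Context d (T : measurableType d) (R : realType) (mu : {sfinite_measure set T -> \bar R}).

Lemma measurable_unit_lcons :
  measurable_fun setT (fun q : (unit * T) * lst T => (q.1.2 :: q.2 : lst T)).
Proof.
apply: measurable_lcons; last exact: measurable_snd.
exact: (measurableT_comp measurable_snd measurable_fst).
Qed.

Lemma lpow_sig : {m : nat -> {sfinite_measure set (lst T) -> \bar R} |
  (forall F, measurable_fun setT F -> \int[m 0%N]_s F s = F [::]) /\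
  (forall k F, (forall s, 0 <= F s) -> measurable_fun setT F ->
    \int[m k.+1]_s F s = \int[mu]_x \int[m k]_s F (x :: s))}.
Proof.
(* Draw [x] from [mu], then [s] from [m], and return [x :: s]; [unit] is a one-point source that
   makes the composite a single measure. *)
pose step (m : {sfinite_measure set (lst T) -> \bar R}) :
    {sfinite_measure set (lst T) -> \bar R} :=
  sfk_measure (skcomp (kcsts (X := unit) mu) (skcomp (kcsts (X := (unit * T)%type) m)
    (kdirac measurable_unit_lcons))) tt.
exists (fun k => iter k step (@dirac _ (lst T) [::] R)); split.
  by move=> F mF; rewrite /= integral_dirac//= diracT mul1e.
move=> k F F0 mF; rewrite iterS /step; move: (iter _ _ _) => m.
rewrite integral_skcomp//; apply: eq_integral => x _.
have := @integral_skcomp _ _ _ _ _ _ R (kcsts (X := (unit * T)%type) m)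
   (kdirac measurable_unit_lcons) (tt, x) F F0 mF.
rewrite {1}/sfk_measure => ->; apply: eq_integral => s _.
by rewrite integral_dirac//= diracT mul1e.
Qed.

Definition lpow : nat -> {sfinite_measure set (lst T) -> \bar R} := sval lpow_sig.

Lemma integral_lpow0 (F : lst T -> \bar R) : measurable_fun setT F ->
  \int[lpow 0]_s F s = F [::].
Proof. by case: (svalP lpow_sig) => h _; exact: h. Qed.

Lemma integral_lpowS k (F : lst T -> \bar R) : (forall s, 0 <= F s) ->
  measurable_fun setT F ->
  \int[lpow k.+1]_s F s = \int[mu]_x \int[lpow k]_s F (x :: s).
Proof. by case: (svalP lpow_sig) => _ h; exact: h. Qed.

Lemma poisson_sig : {m : {sfinite_measure set (lst T) -> \bar R} |
  forall F, (forall s, 0 <= F s) -> measurable_fun setT F ->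
  \int[m]_s F s = \sum_(k <oo) (k`!%:R^-1)%:E * \int[lpow k]_s F s}.
Proof.
(* The factor 1/k! becomes the mass of a Dirac measure on [unit] composed with [lpow k]; the sum
   over k is then a series of s-finite kernels. *)
pose c k : {nonneg R} := NngNum (ltac:(by rewrite invr_ge0) : (0 <= (k`!%:R^-1 : R))%R).
exists (sfk_measure (kseries (fun k => skcomp (kcsts (X := unit) (mscale (c k) (@dirac _ unit tt R)))
     (kcsts (X := (unit * unit)%type) (lpow k)))) tt).
move=> F F0 mF; rewrite integral_kseries//; apply: eq_eseriesr => k _.
rewrite integral_skcomp// ge0_integral_mscale//=; last by move=> *; exact: integral_ge0.
by rewrite integral_dirac//= diracT mul1e.
Qed.

(** Unnormalised: the factor exp(- mu T) is left out, since it would vanish for a measure of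
    infinite mass such as Lebesgue measure. *)
Definition poisson : {sfinite_measure set (lst T) -> \bar R} := sval poisson_sig.

Lemma integral_poisson (F : lst T -> \bar R) : (forall s, 0 <= F s) ->
  measurable_fun setT F ->
  \int[poisson]_s F s = \sum_(k <oo) (k`!%:R^-1)%:E * \int[lpow k]_s F s.
Proof. exact: (svalP poisson_sig). Qed.

End power_measure.

(** * Lebesgue measure on R^d and the Poisson process *)

Section point_space.
Variables (R : realType) (d : nat).

Definition ptT := pt R d.
HB.instance Definition _ := Pointed.on ptT.
HB.instance Definition _ := @isMeasurable.Build (sigma_display (@borelRd R d))
  ptT (@borelRd R d) (@sigma_algebra0 _ setT _)
  (@sigma_algebraC _ _) (@sigma_algebra_bigcup _ setT _).

Lemma measurable_coord (i : 'I_d) : measurable_fun setT (fun x : ptT => x ord0 i).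
Proof.
move=> _ B mB; apply: sub_sigma_algebra.
rewrite -bigcup_seq; exists i; first by rewrite /= mem_index_enum.
by exists B.
Qed.

Lemma measurable_to_pt d' (X : measurableType d') (f : X -> ptT) :
  (forall i, measurable_fun setT (fun x => f x ord0 i)) -> measurable_fun setT f.
Proof.
move=> mf; pose gen := \big[setU/set0]_(i < d)
  preimage_set_system setT (fun x : ptT => x ord0 i) measurable.
apply: (measurability gen) => // _ [A + <-].
rewrite /gen -bigcup_seq => -[i _ [B mB <-]]; rewrite !setTI.
by have := mf i measurableT B mB; rewrite setTI.
Qed.

Lemma measurable_mk_pt : measurable_fun setT (mk_pt d : lst R -> ptT).
Proof.
apply: measurable_to_pt => i; rewrite (_ : (fun _ => _) = fun s : lst R => nth 0%R s i).
  exact: measurable_nth.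
by apply/funext => s; rewrite mxE.
Qed.

Definition leb : {sfinite_measure set (measurableTypeR R) -> \bar R} := @lebesgue_measure R.

Definition lebd : {sfinite_measure set ptT -> \bar R} :=
  spush (lpow leb d) measurable_mk_pt.

Lemma int_seqE m (G : lst R -> \bar R) : (forall s, 0 <= G s) -> measurable_fun setT G ->
  int_seq m G = \int[lpow leb m]_s G s.
Proof.
elim: m G => [|m ih] G G0 mG; first by rewrite integral_lpow0.
rewrite integral_lpowS//=; apply: eq_integral => t _; rewrite ih//.
exact: (measurableT_comp mG (measurable_lcons1 t)).
Qed.

Lemma int_ptE (f : ptT -> \bar R) : (forall s, 0 <= f s) -> measurable_fun setT f ->
  int_pt f = \int[lebd]_x f x.
Proof.
move=> f0 mf; rewrite /int_pt int_seqE//; first by rewrite integral_spush.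
exact: (measurableT_comp mf measurable_mk_pt).
Qed.

Lemma int_confE k (F : lst ptT -> \bar R) : (forall s, 0 <= F s) -> measurable_fun setT F ->
  int_conf k F = \int[lpow lebd k]_x F x.
Proof.
elim: k F => [|k ih] F F0 mF; first by rewrite integral_lpow0.
rewrite integral_lpowS//= int_ptE; last 2 first.
- by move=> x; rewrite ih//; [exact: integral_ge0|exact: (measurableT_comp mF (measurable_lcons1 x))].
- rewrite (_ : (fun x => _) = fun x => \int[lpow lebd k]_s F (x :: s)).
    apply: (measurable_integral_sfinite _ (f := fun q : ptT * lst ptT => F (q.1 :: q.2))) => //.
    by apply: (measurableT_comp mF); apply: measurable_lcons; [exact: measurable_fst|exact: measurable_snd].
  by apply/funext => x; rewrite ih//; exact: (measurableT_comp mF (measurable_lcons1 x)).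
by apply: eq_integral => x _; rewrite ih//; exact: (measurableT_comp mF (measurable_lcons1 x)).
Qed.

Definition Poi : {sfinite_measure set (lst ptT) -> \bar R} := poisson lebd.

Lemma poisson_sumE (F : lst ptT -> \bar R) : (forall s, 0 <= F s) -> measurable_fun setT F ->
  poisson_sum F = \int[Poi]_x F x.
Proof.
move=> F0 mF; rewrite integral_poisson//; apply: eq_eseriesr => k _.
by rewrite int_confE.
Qed.

End point_space.

(** * Affine changes of variables in R and R^d *)

Section affine_line.
Variable R : realType.

Lemma measurable_affine (b c : R) :
  measurable_fun setT (fun t : measurableTypeR R => (b + c * t)%R : measurableTypeR R).
Proof. by apply: measurable_funD => //; exact: measurable_funM. Qed.

(** The image of Lebesgue measure under t |-> b + c t, scaled by c, gives every interval ]a, e] its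
    length, and this characterises Lebesgue measure. *)
Lemma leb_affine (f : measurableTypeR R -> \bar R) (b c : R) : (0 < c)%R -> (forall t, 0 <= f t) ->
  measurable_fun setT f ->
  \int[leb R]_t f t = c%:E * \int[leb R]_t f (b + c * t)%R.
Proof.
move=> c0 f0 mf; pose cn := NngNum (ltW c0).
rewrite -(integral_spush (leb R) (measurable_affine b c))//.
have -> : c%:E = cn%:num%:E by [].
rewrite -ge0_integral_mscale//; apply: eq_measure_integral => A mA _.
apply: (@lebesgue_measure_unique R (mscale cn (spush (leb R) (measurable_affine b c)))) => //.
move=> _ [[a e] _ <-] /=; rewrite /mscale/=.
have mI : measurable (`]a, e]%classic : set (measurableTypeR R)) by exact: measurable_itv.
have -> : spush (leb R) (measurable_affine b c) `]a, e]%classic =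
    \int[spush (leb R) (measurable_affine b c)]_x (\1_(`]a, e]%classic) x)%:E.
  by rewrite integral_indic// setIT.
rewrite integral_spush//; last by apply/measurable_EFinP; exact: measurable_indic.
rewrite (_ : \int[leb R]_x _ = \int[leb R]_x (\1_(`](a - b) / c, (e - b) / c]%classic) x)%:E).
  rewrite integral_indic// setIT lebesgue_measure_itv/= [in RHS]lebesgue_measure_itv/= !lte_fin.
  rewrite ltr_pM2r ?invr_gt0// ltrD2r; case: ifPn => _; last by rewrite mule0.
  by rewrite -EFinB -EFinM; congr EFin; field; rewrite gt_eqF.
apply: eq_integral => x _; congr (_%:R%:E); congr nat_of_bool.
apply/idP/idP; rewrite !inE/= !in_itv/=.
  by rewrite ltr_pdivrMr// ler_pdivlMr// ltrBlDl lerBrDl (mulrC x).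
by rewrite ltr_pdivrMr// ler_pdivlMr// ltrBlDl lerBrDl (mulrC x).
Qed.

Fixpoint laff (o : nat -> R) (c : R) (s : seq R) : seq R :=
  if s is t :: s' then (o 0%N + c * t)%R :: laff (fun i => o i.+1) c s' else [::].

Lemma size_laff o c s : size (laff o c s) = size s.
Proof. by elim: s o => //= t s ih o; rewrite ih. Qed.

Lemma nth_laff o c s i x0 : (i < size s)%N ->
  nth x0 (laff o c s) i = (o i + c * nth x0 s i)%R.
Proof. by elim: s o i => //= t s ih o [//|i] /= is_; rewrite ih. Qed.

Lemma measurable_laff o c : measurable_fun setT (laff o c : lst (measurableTypeR R) -> lst (measurableTypeR R)).
Proof.
apply: measurable_to_lst => [|i].
  rewrite (_ : (fun _ => _) = size); first exact: measurable_size.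
  by apply/funext => s; rewrite size_laff.
rewrite (_ : (fun _ => _) = fun s : lst (measurableTypeR R) =>
   if (i < size s)%N then (o i + c * nth point s i)%R : measurableTypeR R else point).
  apply: measurable_fun_ifT.
  - exact: (measurableT_comp (measurable_fun_nat (fun n => (i < n)%N)) (measurable_size (T := measurableTypeR R))).
  - exact: (measurableT_comp (measurable_affine (o i) c) (@measurable_nth _ (measurableTypeR R) point i)).
  - exact: measurable_cst.
apply/funext => s; case: ltnP => is_; first by rewrite nth_laff.
by rewrite nth_default// size_laff.
Qed.

Lemma lpow_affine m (G : lst (measurableTypeR R) -> \bar R) o (c : R) : (0 < c)%R -> (forall s, 0 <= G s) ->
  measurable_fun setT G ->
  \int[lpow (leb R) m]_s G s = (c ^+ m)%:E * \int[lpow (leb R) m]_s G (laff o c s).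
Proof.
move=> c0; elim: m G o => [|m ih] G o G0 mG.
  by rewrite !integral_lpow0//= ?mul1e//; exact: (measurableT_comp mG (measurable_laff o c)).
rewrite !integral_lpowS//; last exact: (measurableT_comp mG (measurable_laff o c)).
pose o' i := o i.+1.
have mc : measurable_fun setT (fun q : measurableTypeR R * lst (measurableTypeR R) =>
    G (q.1 :: laff o' c q.2)).
  apply: (measurableT_comp mG); apply: measurable_lcons; first exact: measurable_fst.
  exact: (measurableT_comp (measurable_laff o' c) measurable_snd).
have mi := measurable_integral_sfinite (lpow (leb R) m) (fun _ => G0 _) mc.
under eq_integral => t _.
  rewrite (ih _ o')//; last exact: (measurableT_comp mG (measurable_lcons1 t)).
  over.
rewrite (leb_affine (o 0%N) c0); last 2 first.
- by move=> t; apply: mule_ge0; [rewrite lee_fin exprn_ge0 // ltW|exact: integral_ge0].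
- exact: measurable_funeM.
rewrite ge0_integralZl//; last 3 first.
- exact: (measurableT_comp mi (measurable_affine (o 0%N) c)).
- by move=> t _; exact: integral_ge0.
- by rewrite lee_fin exprn_ge0// ltW.
by rewrite muleA -EFinM -exprS.
Qed.

End affine_line.

(** [lpow mu k] is carried by the lists of length k; this serves integrands that read a fixed number
    of coordinates of a list. *)
Lemma eq_integral_lpow d (T : measurableType d) (R : realType)
    (mu : {sfinite_measure set T -> \bar R}) k (F G : lst T -> \bar R) :
  (forall s, 0 <= F s) -> (forall s, 0 <= G s) ->
  measurable_fun setT F -> measurable_fun setT G ->
  (forall s, size s = k -> F s = G s) ->
  \int[lpow mu k]_s F s = \int[lpow mu k]_s G s.
Proof.
elim: k F G => [|k ih] F G F0 G0 mF mG FG; first by rewrite !integral_lpow0// FG.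
rewrite !integral_lpowS//; apply: eq_integral => x _; apply: ih => //.
- exact: (measurableT_comp mF (measurable_lcons1 x)).
- exact: (measurableT_comp mG (measurable_lcons1 x)).
- by move=> s sk; apply: FG => /=; rewrite sk.
Qed.

Section lebd_affine.
Variables (R : realType) (d : nat).

Lemma measurable_pt_affine (b : pt R d) (c : R) :
  measurable_fun setT (fun x : ptT R d => (b + c *: x)%R : ptT R d).
Proof.
apply: measurable_to_pt => i; rewrite (_ : (fun _ => _) = fun x : ptT R d => (b ord0 i + c * x ord0 i)%R).
  by apply: measurable_funD => //; apply: measurable_funM => //; exact: measurable_coord.
by apply/funext => x; rewrite !mxE.
Qed.

Lemma lebd_affine (f : ptT R d -> \bar R) (b : pt R d) (c : R) : (0 < c)%R ->
  (forall x, 0 <= f x) -> measurable_fun setT f ->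
  \int[lebd R d]_x f x = (c ^+ d)%:E * \int[lebd R d]_x f (b + c *: x)%R.
Proof.
move=> c0 f0 mf; have mfa := measurableT_comp mf (measurable_pt_affine b c).
rewrite !integral_spush//.
(* Offsets are indexed by all naturals; the default 0 beyond d is never read, since only lists of
   length d count. *)
pose o i := if insub i is Some j then b ord0 j else 0%R : R.
rewrite (lpow_affine d o c0)//; last exact: (measurableT_comp mf (@measurable_mk_pt R d)).
congr (_ * _); apply: eq_integral_lpow => //.
- apply: (measurableT_comp (measurableT_comp mf (@measurable_mk_pt R d))); exact: measurable_laff.
- exact: (measurableT_comp mfa (@measurable_mk_pt R d)).
- move=> s sd; congr f; apply/rowP => i; rewrite !mxE nth_laff ?sd//.
  by rewrite /o insubT//= => ?; congr (b _ _ + _)%R; apply/val_inj.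
Qed.

Definition cube (l : pt R d) (c : R) : set (ptT R d) :=
  [set x | forall i, l ord0 i <= x ord0 i <= l ord0 i + c]%R.

Lemma measurable_forall_ord dX (X : measurableType dX) n (A : 'I_n -> set X) :
  (forall i, measurable (A i)) -> measurable [set x | forall i, A i x].
Proof.
move=> mA; rewrite (_ : [set _ | _] = \bigcap_(i in [set: 'I_n]) A i).
  by apply: fin_bigcap_measurable.
by apply/seteqP; split=> x /= h i; [move=> _; exact: h|exact: (h i I)].
Qed.

Lemma measurable_cube l c : measurable (cube l c).
Proof.
apply: (@measurable_forall_ord _ (ptT R d) d (fun i x => l ord0 i <= x ord0 i <= l ord0 i + c)%R) => i.
have := measurable_coord i measurableT (measurable_itv `[l ord0 i, l ord0 i + c]%R).
rewrite setTI; congr measurable.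
Qed.

Lemma measurable_unit_cube : measurable_fun setT (fun s : lst (measurableTypeR R) => ((all (fun t => 0 <= t <= 1)%R s)%:R%:E : \bar R)).
Proof.
apply/measurable_EFinP.
have mb : measurable_fun setT (fun t : measurableTypeR R => (0 <= t <= 1)%R).
  by apply: measurable_and; apply: measurable_fun_ler.
apply: (measurableT_comp (f := fun b : bool => b%:R%R : R)) => //.
exact: measurable_lall1.
Qed.

Lemma lpow_unit_cube m : \int[lpow (leb R) m]_s (all (fun t => 0 <= t <= 1)%R s)%:R%:E = 1.
Proof.
have mA := measurable_unit_cube.
elim: m => [|m ih]; first by rewrite integral_lpow0.
rewrite integral_lpowS//.
rewrite (_ : \int[_]_x _ = \int[leb R]_x (\1_(`[0, 1]%classic) x)%:E).
  by rewrite integral_indic//= setIT lebesgue_measure_itv/= lte01 oppr0 adde0.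
apply: eq_integral => x _.
transitivity (\int[lpow (leb R) m]_s ((\1_(`[0, 1]%classic) x)%:E * (all (fun t => 0 <= t <= 1)%R s)%:R%:E)).
  apply: eq_integral => s _ /=; rewrite -EFinM indicE -natrM mulnb; congr (_%:R%:E).
  by congr (nat_of_bool (_ && _)); apply/idP/idP; rewrite inE/= in_itv.
by rewrite ge0_integralZl// ih mule1.
Qed.

Lemma lebd_cube l (c : R) : (0 < c)%R -> lebd R d (cube l c) = (c ^+ d)%:E.
Proof.
move=> c0; rewrite -[LHS]mul1e -[LHS]mule1 mul1e.
have mi : measurable_fun setT (fun x : ptT R d => (\1_(cube l c) x)%:E : \bar R).
  by apply/measurable_EFinP; apply: measurable_indic; exact: measurable_cube.
transitivity (\int[lebd R d]_x (\1_(cube l c) x)%:E).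
  by rewrite mule1 integral_indic ?setIT//; exact: measurable_cube.
rewrite (lebd_affine l c0)//.
have mfa := measurableT_comp mi (measurable_pt_affine l c).
rewrite integral_spush// -[RHS]mule1; congr (_ * _).
rewrite -(lpow_unit_cube d); apply: eq_integral_lpow => //.
- exact: (measurableT_comp mfa (@measurable_mk_pt R d)).
- exact: measurable_unit_cube.
move=> s sd; congr (_%:R%:E); congr nat_of_bool; apply/idP/allP => [|h].
  rewrite inE /cube/= => h t /(nthP 0%R)[i]; rewrite sd => id <-.
  have := h (Ordinal id); rewrite !mxE/= lerDl lerD2l.
  by rewrite pmulr_rge0// ger_pMr.
rewrite inE /cube/= => i; rewrite !mxE/= lerDl lerD2l.
rewrite pmulr_rge0// ger_pMr//.
by apply: h; apply: mem_nth; rewrite sd.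
Qed.

End lebd_affine.

(** * Euclidean norm and nullity of spheres *)

Section euclidean_norm.
Variables (R : realType) (d : nat).
Implicit Types x y : pt R d.

Lemma enorm_ge0 x : (0 <= enorm x)%R. Proof. exact: sqrtr_ge0. Qed.

Lemma sum_sqr_ge0 x : (0 <= \sum_(i < d) x ord0 i ^+ 2)%R.
Proof. by apply: sumr_ge0 => i _; exact: sqr_ge0. Qed.

Lemma sqr_enorm x : (enorm x ^+ 2 = \sum_(i < d) x ord0 i ^+ 2)%R.
Proof. by rewrite sqr_sqrtr// sum_sqr_ge0. Qed.

Lemma enormN x : enorm (- x)%R = enorm x.
Proof. by rewrite /enorm; congr Num.sqrt; apply: eq_bigr => i _; rewrite !mxE sqrrN. Qed.

Lemma enormB x y : enorm (x - y)%R = enorm (y - x)%R.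
Proof. by rewrite -enormN opprB. Qed.

Lemma enormZ (c : R) x : enorm (c *: x)%R = (`|c| * enorm x)%R.
Proof.
rewrite /enorm; under eq_bigr do rewrite mxE exprMn.
by rewrite -mulr_sumr sqrtrM ?sqr_ge0// sqrtr_sqr.
Qed.

Lemma cauchy_schwarz_pt x y :
  (\sum_(i < d) x ord0 i * y ord0 i <= enorm x * enorm y)%R.
Proof.
set C := (\sum_(i < d) _)%R.
have [B0|B0] := eqVneq (enorm y) 0%R.
  have : (\sum_(i < d) y ord0 i ^+ 2)%R == 0%R by rewrite -sqr_enorm B0 expr0n.
  rewrite psumr_eq0; last by move=> i _; exact: sqr_ge0.
  move=> /allP h; rewrite B0 mulr0 /C big1// => i _.
  have := h i (mem_index_enum _); rewrite /= sqrf_eq0 => /eqP ->; exact: mulr0.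
have {}B0 : (0 < enorm y)%R by rewrite lt_neqAle eq_sym B0 enorm_ge0.
apply: le_trans (ler_norm _) _; rewrite -ler_sqr ?nnegrE ?mulr_ge0 ?enorm_ge0//.
rewrite real_normK ?num_real// exprMn.
(* With C the inner product, this sum of squares equals |y|^2 (|x|^2 |y|^2 - C^2). *)
have : (0 <= \sum_(i < d) (enorm y ^+ 2 * x ord0 i - C * y ord0 i) ^+ 2)%R.
  by apply: sumr_ge0 => i _; exact: sqr_ge0.
have expand (b c : R) : (\sum_(i < d) (b * x ord0 i - c * y ord0 i) ^+ 2 =
   b ^+ 2 * (\sum_(i < d) x ord0 i ^+ 2) - 2 * b * c * (\sum_(i < d) x ord0 i * y ord0 i)
   + c ^+ 2 * (\sum_(i < d) y ord0 i ^+ 2))%R.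
  by rewrite !mulr_sumr -sumrB -big_split/=; apply: eq_bigr => i _; ring.
rewrite expand -/C.
rewrite -!sqr_enorm => h.
have {}h : (0 <= enorm y ^+ 2 * (enorm x ^+ 2 * enorm y ^+ 2 - C ^+ 2))%R.
  by move: h; congr (_ <= _)%R; ring.
by move: h; rewrite pmulr_rge0 ?exprn_gt0// subr_ge0.
Qed.

Lemma enormD x y : (enorm (x + y)%R <= enorm x + enorm y)%R.
Proof.
rewrite -ler_sqr ?nnegrE ?addr_ge0 ?enorm_ge0// sqr_enorm sqrrD !sqr_enorm.
have -> : (\sum_(i < d) (x + y)%R ord0 i ^+ 2 = \sum_(i < d) x ord0 i ^+ 2
   + 2 * (\sum_(i < d) x ord0 i * y ord0 i) + \sum_(i < d) y ord0 i ^+ 2)%R.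
  by rewrite mulr_sumr -!big_split/=; apply: eq_bigr => i _; rewrite mxE; ring.
rewrite lerD2r lerD2l -[leRHS]mulr_natl ler_pM2l//; exact: cauchy_schwarz_pt.
Qed.

Lemma enorm_triangle x y z : (enorm (x - z)%R <= enorm (x - y)%R + enorm (y - z)%R)%R.
Proof. by rewrite -(subrKA y x); exact: enormD. Qed.

Lemma le_coord_enorm x i : (`|x ord0 i| <= enorm x)%R.
Proof.
rewrite -ler_sqr ?nnegrE ?enorm_ge0// real_normK ?num_real// sqr_enorm (bigD1 i)//=.
by rewrite lerDl sumr_ge0// => j _; exact: sqr_ge0.
Qed.

Lemma enorm_le_sup x (c : R) : (0 <= c)%R -> (forall i, `|x ord0 i| <= c)%R ->
  (enorm x <= d%:R * c)%R.
Proof.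
move=> c0 h; rewrite -ler_sqr ?nnegrE ?mulr_ge0 ?enorm_ge0// sqr_enorm exprMn.
apply: (@le_trans _ _ (\sum_(i < d) c ^+ 2)%R).
  by apply: ler_sum => i _; rewrite -real_normK ?num_real// lerXn2r ?nnegrE.
rewrite sumr_const card_ord -[leLHS]mulr_natl ler_wpM2r ?sqr_ge0//.
by rewrite -natrX ler_nat; case: (d) => // n; rewrite expnS expn1 leq_pmulr.
Qed.

Lemma measurable_enorm : measurable_fun setT (@enorm R d : ptT R d -> R).
Proof.
rewrite (_ : @enorm R d = (fun t : R => powR t (2^-1)%R) \o (fun x : ptT R d => \sum_(i < d) x ord0 i ^+ 2)%R).
  apply: measurableT_comp; first exact: measurable_powR.
  apply: measurable_sum => i; apply: measurable_funX; exact: measurable_coord.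
by apply/funext => x /=; rewrite powR12_sqrt// sum_sqr_ge0.
Qed.

Lemma measurable_pt_sub dX (X : measurableType dX) (f g : X -> ptT R d) :
  measurable_fun setT f -> measurable_fun setT g ->
  measurable_fun setT (fun w => (f w - g w)%R : ptT R d).
Proof.
move=> mf mg; apply: measurable_to_pt => i.
rewrite (_ : (fun _ => _) = fun w => ((f w : pt R d) ord0 i - (g w : pt R d) ord0 i)%R).
  apply: measurable_funB; [exact: (measurableT_comp (measurable_coord i) mf)|].
  exact: (measurableT_comp (measurable_coord i) mg).
by apply/funext => w; rewrite !mxE.
Qed.

Lemma measurable_dist dX (X : measurableType dX) (f g : X -> ptT R d) :
  measurable_fun setT f -> measurable_fun setT g ->
  measurable_fun setT (fun w => enorm (f w - g w)%R : R).
Proof. by move=> mf mg; exact: (measurableT_comp measurable_enorm (measurable_pt_sub mf mg)). Qed.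

End euclidean_norm.

(** By Tonelli: once the other coordinates are fixed, the first coordinate of a point of the sphere
    solves a quadratic equation and takes at most two values. In dimension 0 the space is a single
    point of mass 1, hence [0 < d]. *)
Lemma lebd_sphere (R : realType) (d : nat) (v : pt R d) (r : R) : (0 < d)%N ->
  lebd R d [set x | enorm (x - v)%R = r] = 0.
Proof.
case: d v => // d v _; set S := [set x | _].
have mS : measurable (S : set (ptT R d.+1)).
  have := measurable_dist (@measurable_id _ (ptT R d.+1) setT) (@measurable_cst _ _ (ptT R d.+1) _ setT (v : ptT R d.+1))
    measurableT (measurable_set1 r).
  by rewrite setTI.
transitivity (\int[lebd R d.+1]_x (\1_S x)%:E).
  by rewrite integral_indic ?setIT.
have mi : measurable_fun setT (fun x : ptT R d.+1 => (\1_S x)%:E : \bar R).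
  by apply/measurable_EFinP; exact: measurable_indic.
rewrite integral_spush//.
have mi2 := measurableT_comp mi (@measurable_mk_pt R d.+1).
rewrite integral_lpowS//.
rewrite (sfinite_Fubini _ _ (fun q : measurableTypeR R * lst (measurableTypeR R) =>
   (\1_S (mk_pt d.+1 (q.1 :: q.2)))%:E))//; last first.
  by apply: (measurableT_comp mi2); apply: measurable_lcons; [exact: measurable_fst|exact: measurable_snd].
rewrite integral0_eq// => s _ /=.
have mc : measurable_fun setT (fun t : measurableTypeR R => (t :: s : lst (measurableTypeR R))).
  by apply: measurable_lcons => //; exact: measurable_cst.
have mA : measurable [set t : measurableTypeR R | S (mk_pt d.+1 (t :: s))].
  have := measurableT_comp (@measurable_mk_pt R d.+1) mc measurableT mS.
  by rewrite setTI.
transitivity (leb R [set t | S (mk_pt d.+1 (t :: s))]).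
  rewrite -[in RHS](setIT [set t | _]) -integral_indic//.
apply/eqP; rewrite -measure_le0.
pose K := (r ^+ 2 - \sum_(i < d) (nth 0 s i - v ord0 (lift ord0 i)) ^+ 2)%R.
pose F := [set (v ord0 ord0 + Num.sqrt K)%R; (v ord0 ord0 - Num.sqrt K)%R].
have F0 : leb R F = 0.
  by apply: countable_lebesgue_measure0; apply: finite_set_countable; exact: finite_set2.
rewrite -F0; apply: le_measure; rewrite ?inE//.
  by apply: countable_measurable; [move=> x; exact: (@measurable_set1 R x)|apply: finite_set_countable; exact: finite_set2].
move=> t /= h.
have tK : ((t - v ord0 ord0) ^+ 2 = K)%R.
  rewrite /K -h sqr_enorm big_ord_recl !mxE/= [X in (_ + X - _)%R](_ : _ =
    \sum_(i < d) (nth 0 s i - v ord0 (lift ord0 i)) ^+ 2)%R ?addrK//.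
  by apply: eq_bigr => i _; rewrite !mxE.
have : (`|t - v ord0 ord0| = Num.sqrt K)%R by rewrite -tK sqrtr_sqr.
rewrite /F/=; case: (ger0P (t - v ord0 ord0)%R) => _ e; [left|right]; rewrite -e; ring.
Qed.

Lemma measurable_comp2 dX (X : measurableType dX) d1 (X1 : measurableType d1)
    d2 (X2 : measurableType d2) dY (Y : measurableType dY)
    (h : X1 * X2 -> Y) (f : X -> X1) (g : X -> X2) :
  measurable_fun setT h -> measurable_fun setT f -> measurable_fun setT g ->
  measurable_fun setT (fun x => h (f x, g x)).
Proof. by move=> mh mf mg; exact: (measurableT_comp mh (measurable_fun_pair mf mg)). Qed.

Lemma measurable_natb (R : realType) dX (X : measurableType dX) (b : X -> bool) :
  measurable_fun setT b -> measurable_fun setT (fun x => (b x)%:R%:E : \bar R).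
Proof.
move=> mb; apply/measurable_EFinP.
by apply: (measurableT_comp (f := fun b : bool => b%:R%R : R)).
Qed.

(** * Cauchy products, Mecke formula and splitting of the Poisson process *)

Section cauchy_product.
Variable R : realType.

Lemma nneseries_shift_indic (f : nat -> \bar R) i : (forall n, 0 <= f n) ->
  \sum_(k <oo) (if (i <= k)%N then f (k - i)%N else 0) = \sum_(j <oo) f j.
Proof.
move=> f0.
have g0 k : 0 <= (if (i <= k)%N then f (k - i)%N else 0) by case: ifP.
rewrite (nneseries_split 0 i)// add0n big_nat big1 ?add0e; last first.
  by move=> k /andP[_ ki]; rewrite leqNgt ki.
rewrite -(nneseries_addn i)//; apply: eq_eseriesr => k _.
by rewrite leq_addl addnK.
Qed.

Lemma nneseries_finite (f : nat -> \bar R) n : (forall n, 0 <= f n) ->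
  \sum_(k <oo) (if (k < n)%N then f k else 0) = \sum_(k < n) f k.
Proof.
move=> f0; rewrite (nneseries_split 0 n)//; last by move=> k _; case: ifP.
rewrite add0n eseries0 ?adde0; last by move=> k /= nk _; rewrite ltnNge nk.
by rewrite big_mkord; apply: eq_bigr => i _; rewrite ltn_ord.
Qed.

Lemma nneseries_cauchy_product (b : nat -> nat -> \bar R) : (forall i j, 0 <= b i j) ->
  \sum_(k <oo) \sum_(i < k.+1) b i (k - i)%N = \sum_(j <oo) \sum_(i <oo) b i j.
Proof.
move=> b0; rewrite (@nneseries_interchange _ (fun j i => b i j) xpredT xpredT)//.
transitivity (\sum_(k <oo) \sum_(i <oo) (if (i <= k)%N then b i (k - i)%N else 0)).
  by apply: eq_eseriesr => k _; rewrite (nneseries_finite (f := fun i => b i (k - i)%N) k.+1).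
rewrite (@nneseries_interchange _ (fun k i => if (i <= k)%N then b i (k - i)%N else 0) xpredT xpredT).
  by apply: eq_eseriesr => i _; rewrite nneseries_shift_indic.
by move=> k i; case: ifP.
Qed.

End cauchy_product.

Section split_mecke.
Context d (T : measurableType d) (R : realType) (mu : {sfinite_measure set T -> \bar R}).

(** The sum of the Mecke formula: each entry x in turn is paired with the list from which that
    occurrence of x is deleted. The entries already passed are put back by prepending them to the
    second argument of [G]. *)
Fixpoint lsum (G : T -> lst T -> R) (s : lst T) : R :=
  if s is x :: s' then (G x s' + lsum (fun y t => G y (x :: t)) s')%R else 0%R.

Lemma lsum_ge0 (G : T -> lst T -> R) s : (forall x t, 0 <= G x t)%R -> (0 <= lsum G s)%R.
Proof. by elim: s G => //= x s ih G G0; rewrite addr_ge0// ih. Qed.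

Lemma eq_lsum (G G' : T -> lst T -> R) s :
  {in s, forall x, G x =1 G' x} -> lsum G s = lsum G' s.
Proof.
elim: s G G' => //= x s ih G G' e; rewrite e ?mem_head//.
by congr (_ + _)%R; apply: ih => y ys t; apply: e; rewrite inE ys orbT.
Qed.

Lemma lsumD (G G' : T -> lst T -> R) s : lsum (fun x t => G x t + G' x t)%R s = (lsum G s + lsum G' s)%R.
Proof. by elim: s G G' => [|x s ih] G G' /=; rewrite ?addr0// ih addrACA. Qed.

Lemma lsumZ (c : R) (G : T -> lst T -> R) s : lsum (fun x t => c * G x t)%R s = (c * lsum G s)%R.
Proof. by elim: s G => [|x s ih] G /=; rewrite ?mulr0// ih mulrDr. Qed.

Lemma measurable_lsum_param dP (P : measurableType dP) (G : P -> T -> lst T -> R) :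
  measurable_fun setT (fun q : (P * T) * lst T => G q.1.1 q.1.2 q.2) ->
  measurable_fun setT (fun q : P * lst T => lsum (G q.1) q.2).
Proof.
move=> mG; apply: lst_recursion => k.
elim: k dP P G mG => [|k ih] dP P G mG; first by apply: lst_rec0; exact: measurable_cst.
apply: lst_recS => /=; apply: measurable_funD; first exact: measurable_funTS.
apply: (ih _ (P * T)%type (fun p y t => G p.1 y (p.2 :: t))).
apply: (measurable_comp2 mG (f := fun q : (P * T) * T * lst T => (q.1.1.1, q.1.2))).
  apply: measurable_fun_pair; last exact: (measurableT_comp measurable_snd measurable_fst).
  by apply: (measurableT_comp measurable_fst); apply: (measurableT_comp measurable_fst measurable_fst).
apply: measurable_lcons; last exact: measurable_snd.
by apply: (measurableT_comp measurable_snd); apply: (measurableT_comp measurable_fst measurable_fst).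
Qed.

Lemma measurable_lsum (G : T -> lst T -> R) :
  measurable_fun setT (fun q : T * lst T => G q.1 q.2) -> measurable_fun setT (lsum G).
Proof.
move=> mG; have h := @measurable_lsum_param _ unit (fun _ => G).
apply: (measurable_comp2 (h _) (measurable_cst tt) (@measurable_id _ (lst T) setT)).
apply: (measurable_comp2 mG); last exact: measurable_snd.
exact: (measurableT_comp measurable_snd measurable_fst).
Qed.

Let swap_lpow (f : T * (T * lst T) -> \bar R) k : (forall q, 0 <= f q) ->
  measurable_fun setT f ->
  \int[mu]_x \int[mu]_y \int[lpow mu k]_t f (x, (y, t)) =
  \int[mu]_y \int[mu]_x \int[lpow mu k]_t f (x, (y, t)).
Proof.
move=> f0 mf; apply: (sfinite_Fubini mu mu (fun q => \int[lpow mu k]_t f (q.1, (q.2, t)))).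
  by move=> q; exact: integral_ge0.
apply: (measurable_integral_sfinite _ (f := fun q : T * T * lst T => f (q.1.1, (q.1.2, q.2)))) => //.
apply: (measurable_comp2 mf (f := fun q : T * T * lst T => q.1.1) (g := fun q => (q.1.2, q.2))); first exact: (measurableT_comp measurable_fst measurable_fst).
apply: measurable_fun_pair; last exact: measurable_snd.
exact: (measurableT_comp measurable_snd measurable_fst).
Qed.

(** By symmetry every position contributes the same integral. In the induction the singled-out entry
    is either the head, giving one term, or lies in the tail, giving the others after the two outer
    integrals are exchanged. *)
Lemma mecke_lpow k (G : T -> lst T -> R) : (forall x t, 0 <= G x t)%R ->
  measurable_fun setT (fun q : T * lst T => G q.1 q.2) ->
  \int[lpow mu k.+1]_s (lsum G s)%:E =
  (k.+1%:R)%:E * \int[mu]_y \int[lpow mu k]_s (G y s)%:E.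
Proof.
elim: k G => [|k ih] G G0 mG.
  have mS : measurable_fun setT (fun s => (lsum G s)%:E).
    by apply/measurable_EFinP; exact: measurable_lsum.
  have l0 s : 0%R <= (lsum G s)%:E by rewrite lee_fin lsum_ge0.
  rewrite mul1e [LHS](integral_lpowS mu 0 l0 mS).
  apply: eq_integral => x _.
  rewrite integral_lpow0; last exact: (measurableT_comp mS (measurable_lcons1 x)).
  rewrite integral_lpow0/= ?addr0//.
  by apply/measurable_EFinP; apply: (measurable_comp2 mG (measurable_cst x)); exact: measurable_id.
rewrite integral_lpowS; last 2 first.
- by move=> s; rewrite lee_fin lsum_ge0.
- by apply/measurable_EFinP; exact: measurable_lsum.
have mGx x : measurable_fun setT (fun q : T * lst T => G q.1 (x :: q.2)).
  apply: (measurable_comp2 mG); first exact: measurable_fst.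
  exact: (measurableT_comp (measurable_lcons1 x) measurable_snd).
have mGc : measurable_fun setT (fun q : T * (T * lst T) => (G q.2.1 (q.1 :: q.2.2))%:E).
  apply/measurable_EFinP; apply: (measurable_comp2 mG).
    exact: (measurableT_comp measurable_fst measurable_snd).
  apply: measurable_lcons; first exact: measurable_fst.
  exact: (measurableT_comp measurable_snd measurable_snd).
have mG1 x : measurable_fun setT (fun s => (G x s)%:E).
  by apply/measurable_EFinP; apply: (measurable_comp2 mG (measurable_cst x)); exact: measurable_id.
have E x : \int[lpow mu k.+1]_s (lsum G (x :: s))%:E = \int[lpow mu k.+1]_s (G x s)%:E +
    (k.+1%:R)%:E * \int[mu]_y \int[lpow mu k]_s (G y (x :: s))%:E.
  rewrite -(ih (fun y t => G y (x :: t)))// -ge0_integralD//.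
  - by move=> s _; rewrite lee_fin.
  - by move=> s _; rewrite lee_fin lsum_ge0.
  - by apply/measurable_EFinP; apply: measurable_lsum; exact: mGx.
under eq_integral => x _ do rewrite E.
have mi1 : measurable_fun setT (fun x => \int[lpow mu k.+1]_s (G x s)%:E).
  apply: (measurable_integral_sfinite _ (f := fun q : T * lst T => (G q.1 q.2)%:E)).
    by move=> q; rewrite lee_fin.
  exact/measurable_EFinP.
have mi2 : measurable_fun setT (fun x => \int[mu]_y \int[lpow mu k]_s (G y (x :: s))%:E).
  apply: (measurable_integral_sfinite _ (f := fun q : T * T => \int[lpow mu k]_s (G q.2 (q.1 :: s))%:E)).
    by move=> q; apply: integral_ge0 => s _; rewrite lee_fin.
  apply: (measurable_integral_sfinite _ (f := fun q : T * T * lst T => (G q.1.2 (q.1.1 :: q.2))%:E)).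
    by move=> q; rewrite lee_fin.
  apply: (measurable_comp2 mGc (f := fun q : T * T * lst T => q.1.1) (g := fun q => (q.1.2, q.2))); first exact: (measurableT_comp measurable_fst measurable_fst).
  apply: measurable_fun_pair; last exact: measurable_snd.
  exact: (measurableT_comp measurable_snd measurable_fst).
have i1 x : 0 <= \int[lpow mu k.+1]_s (G x s)%:E by apply: integral_ge0 => s _; rewrite lee_fin.
have i2 x : 0 <= \int[mu]_y \int[lpow mu k]_s (G y (x :: s))%:E.
  by apply: integral_ge0 => y _; apply: integral_ge0 => s _; rewrite lee_fin.
have i3 x : 0 <= (k.+1%:R)%:E * \int[mu]_y \int[lpow mu k]_s (G y (x :: s))%:E by apply: mule_ge0.
have mi3 := measurable_funeM (k.+1%:R)%:E mi2.
rewrite ge0_integralD//.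
rewrite ge0_integralZl//.
rewrite (swap_lpow (f := fun q => (G q.2.1 (q.1 :: q.2.2))%:E))//=; last by move=> q; rewrite lee_fin.
have Ey y : \int[mu]_x \int[lpow mu k]_s (G y (x :: s))%:E = \int[lpow mu k.+1]_s (G y s)%:E.
  have Gy s : 0%R <= (G y s)%:E by rewrite lee_fin.
  by rewrite [RHS]integral_lpowS.
under [X in _ + _ * X]eq_integral => y _ do rewrite Ey.
by rewrite -[X in X + _]mul1e -ge0_muleDl.
Qed.

(** The factor k + 1 of [mecke_lpow] turns 1/(k+1)! into 1/k!, and the empty list contributes
    nothing. *)
Lemma mecke (G : T -> lst T -> R) : (forall x t, 0 <= G x t)%R ->
  measurable_fun setT (fun q : T * lst T => G q.1 q.2) ->
  \int[poisson mu]_s (lsum G s)%:E = \int[mu]_y \int[poisson mu]_s (G y s)%:E.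
Proof.
move=> G0 mG.
have Gs y : measurable_fun setT (fun s => (G y s)%:E).
  by apply/measurable_EFinP; apply: (measurable_comp2 mG (measurable_cst y)); exact: measurable_id.
have ms : measurable_fun setT (fun s => (lsum G s)%:E).
  by apply/measurable_EFinP; exact: measurable_lsum.
rewrite integral_poisson//; last by move=> s; rewrite lee_fin lsum_ge0.
have Glsum s : 0%R <= (lsum G s)%:E by rewrite lee_fin lsum_ge0.
rewrite nneseries_recl//; last first.
  by move=> k _; apply: mule_ge0; [rewrite lee_fin invr_ge0|exact: integral_ge0].
rewrite integral_lpow0//= mule0 add0e.
rewrite -(nneseries_addn 1)//; last first.
  by move=> k; apply: mule_ge0; [rewrite lee_fin invr_ge0|exact: integral_ge0].
under [RHS]eq_integral => y _.
  rewrite integral_poisson//; last by move=> s; rewrite lee_fin.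
  over.
rewrite /= integral_nneseries//; last 2 first.
- move=> k; apply: measurable_funeM.
  apply: (measurable_integral_sfinite _ (f := fun q : T * lst T => (G q.1 q.2)%:E)).
    by move=> q; rewrite lee_fin.
  exact/measurable_EFinP.
- by move=> k y _; apply: mule_ge0; [rewrite lee_fin invr_ge0|apply: integral_ge0 => s _; rewrite lee_fin].
apply: eq_eseriesr => k _; rewrite addn1 mecke_lpow//.
have i1 y : 0 <= \int[lpow mu k]_s (G y s)%:E by apply: integral_ge0 => s _; rewrite lee_fin.
have mi1 : measurable_fun setT (fun y => \int[lpow mu k]_s (G y s)%:E).
  apply: (measurable_integral_sfinite _ (f := fun q : T * lst T => (G q.1 q.2)%:E)).
    by move=> q; rewrite lee_fin.
  exact/measurable_EFinP.
have k0 : 0%R <= (k`!%:R^-1 : R)%:E by rewrite lee_fin invr_ge0.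
rewrite ge0_integralZl//.
by rewrite muleA -EFinM factS natrM invfM mulrAC mulVf ?mul1r// pnatr_eq0.
Qed.

Variable B : T -> bool.
Hypothesis mB : measurable_fun setT B.

Definition splitw (s t : lst T) : R := (all B s && all (predC B) t)%:R.

Definition symmetric_fun (Y : Type) (F : lst T -> Y) := forall s t, perm_eq s t -> F s = F t.

Definition split_int (F : lst T -> \bar R) i j :=
  \int[lpow mu j]_t \int[lpow mu i]_s (F (s ++ t) * (splitw s t)%:E).

Lemma measurable_splitw dX (X : measurableType dX) (f g : X -> lst T) :
  measurable_fun setT f -> measurable_fun setT g ->
  measurable_fun setT (fun x => (splitw (f x) (g x))%:E).
Proof.
move=> mf mg; apply: (measurable_natb (b := fun x => all B (f x) && all (predC B) (g x))).
apply: measurable_and.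
  exact: (measurableT_comp (measurable_lall1 mB) mf).
by apply: (measurableT_comp (measurable_lall1 _) mg); exact: measurable_neg.
Qed.

Section split_step.
Variable F : lst T -> \bar R.
Hypothesis F0 : forall s, 0 <= F s.
Hypothesis mF : measurable_fun setT F.

Lemma measurable_split_integrand dX (X : measurableType dX) (f g : X -> lst T) :
  measurable_fun setT f -> measurable_fun setT g ->
  measurable_fun setT (fun x => F (f x ++ g x) * (splitw (f x) (g x))%:E).
Proof.
move=> mf mg; apply: emeasurable_funM; last exact: measurable_splitw.
exact: (measurableT_comp mF (measurable_lcat mf mg)).
Qed.

Let integrand_ge0 s t : 0 <= F (s ++ t) * (splitw s t)%:E.
Proof. by rewrite mule_ge0// lee_fin. Qed.

Lemma split_int_ge0 i j : 0 <= split_int F i j.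
Proof. by apply: integral_ge0 => t _; exact: integral_ge0. Qed.

(** The new point joins the first group if it lies in [B] and the second one otherwise; Tonelli
    moves it to the head of its group, and the symmetry of [F] undoes the change of order. *)
Lemma split_intS (i j : nat) : symmetric_fun F ->
  \int[mu]_x split_int (fun s => F (x :: s)) i j = split_int F i.+1 j + split_int F i j.+1.
Proof.
move=> symF.
pose f1 (x : T) (t : lst T) := \int[lpow mu i]_s (F (x :: s ++ t) * (splitw (x :: s) t)%:E).
pose f2 (x : T) (t : lst T) := \int[lpow mu i]_s (F (x :: s ++ t) * (splitw s (x :: t))%:E).
have g1 x s t : 0 <= F (x :: s ++ t) * (splitw (x :: s) t)%:E by rewrite mule_ge0// lee_fin.
have g2 x s t : 0 <= F (x :: s ++ t) * (splitw s (x :: t))%:E by rewrite mule_ge0// lee_fin.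
have f10 x t : 0 <= f1 x t by apply: integral_ge0.
have f20 x t : 0 <= f2 x t by apply: integral_ge0.
have mc dX (X : measurableType dX) (a : X -> T) (b c : X -> lst T) :
    measurable_fun setT a -> measurable_fun setT b -> measurable_fun setT c ->
    measurable_fun setT (fun x => F (a x :: b x ++ c x) * (splitw (a x :: b x) (c x))%:E) /\
    measurable_fun setT (fun x => F (a x :: b x ++ c x) * (splitw (b x) (a x :: c x))%:E).
  move=> ma mb mc; have mFc : measurable_fun setT (fun x => F (a x :: b x ++ c x)).
    by apply: (measurableT_comp mF); apply: measurable_lcons => //; exact: measurable_lcat.
  by split; apply: emeasurable_funM => //; apply: measurable_splitw => //; exact: measurable_lcons.
have p1 : measurable_fun setT (fun q : T * lst T * lst T => q.1.1) by exact: (measurableT_comp measurable_fst measurable_fst).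
have p2 : measurable_fun setT (fun q : T * lst T * lst T => q.1.2) by exact: (measurableT_comp measurable_snd measurable_fst).
have p3 : measurable_fun setT (fun q : T * lst T * lst T => q.2) by exact: measurable_snd.
have [ma1 ma2] := mc _ _ _ _ _ p1 p3 p2.
have mf1 : measurable_fun setT (fun q : T * lst T => f1 q.1 q.2).
  exact: (measurable_integral_sfinite (lpow mu i) (f := fun q : T * lst T * lst T =>
    F (q.1.1 :: q.2 ++ q.1.2) * (splitw (q.1.1 :: q.2) q.1.2)%:E)).
have mf2 : measurable_fun setT (fun q : T * lst T => f2 q.1 q.2).
  exact: (measurable_integral_sfinite (lpow mu i) (f := fun q : T * lst T * lst T =>
    F (q.1.1 :: q.2 ++ q.1.2) * (splitw q.2 (q.1.1 :: q.1.2))%:E)).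
have E1 : split_int F i.+1 j = \int[mu]_x \int[lpow mu j]_t f1 x t.
  rewrite (sfinite_Fubini mu (lpow mu j) (fun q => f1 q.1 q.2))//.
  apply: eq_integral => t _; rewrite integral_lpowS//.
  by apply: measurable_split_integrand => //; exact: measurable_cst.
have E2 : split_int F i j.+1 = \int[mu]_x \int[lpow mu j]_t f2 x t.
  pose H (t : lst T) : \bar R := \int[lpow mu i]_s (F (s ++ t) * (splitw s t)%:E).
  have H0 t : 0 <= H t by exact: integral_ge0.
  have mH : measurable_fun setT H.
    apply: (measurable_integral_sfinite _ (f := fun q : lst T * lst T => F (q.2 ++ q.1) * (splitw q.2 q.1)%:E)) => //.
    by apply: measurable_split_integrand; [exact: measurable_snd|exact: measurable_fst].
  rewrite [LHS](integral_lpowS mu j H0 mH).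
  apply: eq_integral => x _; apply: eq_integral => t _; apply: eq_integral => s _.
  by rewrite (symF (s ++ x :: t) (x :: s ++ t))// -[x :: t]cat1s perm_catCA.
have c (x : T) : measurable_fun setT (fun _ : lst T => x) by exact: measurable_cst.
have i0 := @measurable_id _ (lst T) setT.
have mf1x x : measurable_fun setT (f1 x) by apply: (measurable_comp2 mf1 (c x) i0).
have mf2x x : measurable_fun setT (f2 x) by apply: (measurable_comp2 mf2 (c x) i0).
rewrite [X in _ = X + _]E1 [X in _ = _ + X]E2.
have mI1 : measurable_fun setT (fun x => \int[lpow mu j]_t f1 x t).
  exact: (measurable_integral_sfinite (lpow mu j) (f := fun q : T * lst T => f1 q.1 q.2)).
have mI2 : measurable_fun setT (fun x => \int[lpow mu j]_t f2 x t).
  exact: (measurable_integral_sfinite (lpow mu j) (f := fun q : T * lst T => f2 q.1 q.2)).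
have I1 x : 0 <= \int[lpow mu j]_t f1 x t by exact: integral_ge0.
have I2 x : 0 <= \int[lpow mu j]_t f2 x t by exact: integral_ge0.
rewrite -[RHS](ge0_integralD mu measurableT (fun x _ => I1 x) mI1 (fun x _ => I2 x) mI2).
apply: eq_integral => x _.
rewrite -[RHS](ge0_integralD (lpow mu j) measurableT (fun t _ => f10 x t) (mf1x x) (fun t _ => f20 x t) (mf2x x)).
apply: eq_integral => t _.
have ct : measurable_fun setT (fun _ : lst T => t) by exact: measurable_cst.
have [h1 h2] := mc _ _ _ _ _ (c x) i0 ct.
rewrite -[RHS](ge0_integralD (lpow mu i) measurableT (fun s _ => g1 x s t) h1 (fun s _ => g2 x s t) h2).
apply: eq_integral => s _.
rewrite -ge0_muleDr ?lee_fin// -EFinD; congr (_ * _%:E).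
rewrite /splitw -natrD/=; congr (_%:R).
by case: (all B s); case: (all _ t); case: (B x).
Qed.

End split_step.

Lemma symmetric_fun_cons (Y : Type) (F : lst T -> Y) x : symmetric_fun F ->
  symmetric_fun (fun s => F (x :: s)).
Proof. by move=> sF s t st; apply: sF; rewrite perm_cons. Qed.

(** A binomial theorem, by Pascal's rule: one chooses which of the k points fall in [B]. *)
Lemma integral_lpow_split k (F : lst T -> \bar R) : (forall s, 0 <= F s) ->
  measurable_fun setT F -> symmetric_fun F ->
  \int[lpow mu k]_s F s = \sum_(i < k.+1) ('C(k, i)%:R)%:E * split_int F i (k - i).
Proof.
elim: k F => [|k ih] F F0 mF sF.
  rewrite big_ord_recl big_ord0 adde0 mul1e integral_lpow0// /split_int.
  have h t : \int[lpow mu 0]_s (F (s ++ t) * (splitw s t)%:E) = F t * (splitw [::] t)%:E.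
    rewrite integral_lpow0//; apply: (measurable_split_integrand mF (f := fun s => s) (g := fun _ => t)).
      exact: measurable_id.
    exact: measurable_cst.
  under eq_integral do rewrite h.
  rewrite integral_lpow0 ?mule1//.
  apply: (measurable_split_integrand mF (f := fun=> [::]) (g := fun s => s)).
    exact: measurable_cst.
  exact: measurable_id.
rewrite integral_lpowS//.
have mFx (x : T) : measurable_fun setT (fun s : lst T => F (x :: s)).
  exact: (measurableT_comp mF (measurable_lcons1 x)).
have mspl i j : measurable_fun setT (fun x : T => split_int (fun s => F (x :: s)) i j).
  apply: (measurable_integral_sfinite _ (f := fun q : T * lst T =>
    \int[lpow mu i]_s (F (q.1 :: s ++ q.2) * (splitw s q.2)%:E))).
    by move=> q; apply: integral_ge0 => s _; rewrite mule_ge0// lee_fin.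
  apply: (measurable_integral_sfinite _ (f := fun q : (T * lst T) * lst T =>
    (F (q.1.1 :: q.2 ++ q.1.2) * (splitw q.2 q.1.2)%:E))).
    by move=> q; rewrite mule_ge0// lee_fin.
  have p2 : measurable_fun setT (fun q : T * lst T * lst T => q.1.2) by exact: (measurableT_comp measurable_snd measurable_fst).
  have p3 : measurable_fun setT (fun q : T * lst T * lst T => q.2) by exact: measurable_snd.
  apply: emeasurable_funM; last exact: measurable_splitw.
  apply: (measurableT_comp mF); apply: measurable_lcons; last exact: measurable_lcat.
  exact: (measurableT_comp measurable_fst measurable_fst).
have s0 (x : T) i j : 0 <= split_int (fun s => F (x :: s)) i j by exact: split_int_ge0.
have sF0 i j : 0 <= split_int F i j by exact: split_int_ge0.
have c0 n m : 0%R <= ('C(n, m)%:R : R)%:E by rewrite lee_fin.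
transitivity (\int[mu]_x \sum_(i < k.+1) ('C(k, i)%:R)%:E * split_int (fun s => F (x :: s)) i (k - i)).
  by apply: eq_integral => x _; exact: (ih _ (fun s => F0 (x :: s)) (mFx x) (symmetric_fun_cons x sF)).
rewrite (ge0_integral_sum mu measurableT
  (f := fun (i : 'I_k.+1) (x : T) => ('C(k, i)%:R)%:E * split_int (fun s => F (x :: s)) i (k - i))); last 2 first.
- by move=> i; exact: measurable_funeM.
- by move=> i x _; rewrite mule_ge0.
transitivity (\sum_(i < k.+1) (('C(k, i)%:R)%:E * split_int F i.+1 (k - i)
    + ('C(k, i)%:R)%:E * split_int F i (k - i).+1)).
  apply: eq_bigr => i _.
  rewrite (ge0_integralZl mu measurableT (mspl _ _) (fun x _ => s0 x _ _) (c0 k i)).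
  by rewrite split_intS// ge0_muleDr.
rewrite big_split/= [RHS]big_ord_recl/= bin0 subn0.
rewrite [X in _ = _ + X](_ : _ = \sum_(i < k.+1) (('C(k, i.+1)%:R)%:E * split_int F i.+1 (k - i)
    + ('C(k, i)%:R)%:E * split_int F i.+1 (k - i))); last first.
  apply: eq_bigr => i _; rewrite /bump/= add1n binS natrD EFinD subSS.
  by rewrite ge0_muleDl.
have key : ('C(k, 0)%:R)%:E * split_int F 0 k.+1
     + \sum_(i < k.+1) ('C(k, i.+1)%:R)%:E * split_int F i.+1 (k - i)
   = \sum_(i < k.+1) ('C(k, i)%:R)%:E * split_int F i (k - i).+1.
  transitivity (\sum_(i < k.+2) ('C(k, i)%:R)%:E * split_int F i (k.+1 - i)).
    rewrite [RHS]big_ord_recl subn0; congr (_ + _); apply: eq_bigr => i _.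

  rewrite big_ord_recr/= bin_small// mul0e adde0; apply: eq_bigr => i _.
  by rewrite subSn// -ltnS.
by rewrite [in RHS]big_split/= addeA -key bin0 addeC.
Qed.

(** Independence of a Poisson process on [B] and on its complement: a binomial coefficient over k!
    is 1/i! times 1/(k-i)!, and the double sum is a Cauchy product. Conditioning and stationarity
    both rest on this formula. *)
Lemma integral_poisson_split (F : lst T -> \bar R) : (forall s, 0 <= F s) ->
  measurable_fun setT F -> symmetric_fun F ->
  \int[poisson mu]_s F s =
  \int[poisson mu]_t \int[poisson mu]_s (F (s ++ t) * (splitw s t)%:E).
Proof.
move=> F0 mF sF; have sF0 i j : 0 <= split_int F i j by exact: split_int_ge0.
pose a k := (k`!%:R^-1 : R)%:E.
have a0 k : 0 <= a k by rewrite lee_fin invr_ge0.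
transitivity (\sum_(k <oo) \sum_(i < k.+1) (a i * a (k - i)%N * split_int F i (k - i)%N)).
  rewrite integral_poisson//; apply: eq_eseriesr => k _.
  rewrite integral_lpow_split// ge0_sume_distrr; last by move=> i _; rewrite mule_ge0.
  apply: eq_bigr => i _; rewrite muleA; congr (_ * _).
  have ik : (i <= k)%N by rewrite -ltnS.
  rewrite /a -!EFinM -(bin_fact ik) !natrM; congr EFin.
  have f0 n : (n`!%:R : R) != 0%R by rewrite pnatr_eq0 -lt0n fact_gt0.
  have c0 : ('C(k, i)%:R : R) != 0%R by rewrite pnatr_eq0 -lt0n bin_gt0.
  by field; rewrite !f0 c0.
rewrite (nneseries_cauchy_product (b := fun i j => a i * a j * split_int F i j)); last first.
  by move=> i j; rewrite !mule_ge0.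
have F1 s t : 0 <= F (s ++ t) * (splitw s t)%:E by rewrite mule_ge0// lee_fin.
have m2 : measurable_fun setT (fun q : lst T * lst T => F (q.2 ++ q.1) * (splitw q.2 q.1)%:E).
  by apply: measurable_split_integrand; [|exact: measurable_snd|exact: measurable_fst].
have m1 (t : lst T) : measurable_fun setT (fun s : lst T => F (s ++ t) * (splitw s t)%:E).
  by apply: (measurable_split_integrand mF).
have i1 (t : lst T) i : 0 <= \int[lpow mu i]_s (F (s ++ t) * (splitw s t)%:E) by exact: integral_ge0.
have mi1 i : measurable_fun setT (fun t : lst T => \int[lpow mu i]_s (F (s ++ t) * (splitw s t)%:E)).
  exact: (measurable_integral_sfinite (lpow mu i) (f := fun q : lst T * lst T => F (q.2 ++ q.1) * (splitw q.2 q.1)%:E)).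
pose H (t : lst T) := \int[poisson mu]_s (F (s ++ t) * (splitw s t)%:E).
have H0 (t : lst T) : 0 <= H t by exact: integral_ge0.
have mH : measurable_fun setT H.
  exact: (measurable_integral_sfinite (poisson mu) (f := fun q : lst T * lst T => F (q.2 ++ q.1) * (splitw q.2 q.1)%:E)).
rewrite [RHS](integral_poisson mu H0 mH); apply: eq_eseriesr => j _.
transitivity (a j * \int[lpow mu j]_t (\sum_(i <oo) a i * \int[lpow mu i]_s (F (s ++ t) * (splitw s t)%:E))).
  have mai i : measurable_fun setT (fun t : lst T => a i * \int[lpow mu i]_s (F (s ++ t) * (splitw s t)%:E)).
    exact: measurable_funeM.
  have ai0 i (t : lst T) : 0 <= a i * \int[lpow mu i]_s (F (s ++ t) * (splitw s t)%:E) by rewrite mule_ge0.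
  rewrite (integral_nneseries (lpow mu j) measurableT mai (fun i t _ => ai0 i t)).
  rewrite -nneseriesZl; last by move=> i _; exact: integral_ge0.
  apply: eq_eseriesr => i _.
  rewrite (ge0_integralZl (lpow mu j) measurableT (mi1 i) (fun t _ => i1 t i) (a0 i)).
  by rewrite muleA (muleC (a i)).
congr (_ * _); apply: eq_integral => t _.
by rewrite /H (integral_poisson mu (F1 ^~ t) (m1 t)).
Qed.

End split_mecke.

(** * Gibbs weights and partition functions *)

Section gibbs_weight_theory.
Context d (T : measurableType d) (R : realType).
Implicit Types (kp : T -> T -> R) (a b : T -> R) (s t : lst T).

(** The product of a(x_i) over the points and of kp(x_i, x_j) over the pairs. Reading a point
    multiplies the activity of the remaining ones by its kernel, so conditioning on points becomes a
    change of activity. *)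
Fixpoint bw kp a s : R :=
  if s is x :: s' then (a x * bw kp (fun y => a y * kp x y) s')%R else 1%R.

Definition pairfun kp := [/\ measurable_fun setT (fun q : T * T => kp q.1 q.2),
  (forall x y, 0 <= kp x y <= 1)%R & (forall x y, kp x y = kp y x)].

Definition klist kp t (y : T) : R := (\prod_(x <- t) kp x y)%R.

Lemma eq_bw kp a b s : {in s, a =1 b} -> bw kp a s = bw kp b s.
Proof.
elim: s a b => //= x s ih a b e; rewrite e ?mem_head//; congr (_ * _)%R.
by apply: ih => y ys; rewrite e// inE ys orbT.
Qed.

Lemma measurable_bw_param kp dP (P : measurableType dP) (a : P -> T -> R) :
  measurable_fun setT (fun q : T * T => kp q.1 q.2) ->
  measurable_fun setT (fun q : P * T => a q.1 q.2) ->
  measurable_fun setT (fun q : P * lst T => bw kp (a q.1) q.2).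
Proof.
move=> mk ma; apply: lst_recursion => k.
elim: k dP P a ma => [|k ih] dP P a ma; first by apply: lst_rec0; exact: measurable_cst.
apply: lst_recS => /=; apply: measurable_funM.
  by apply: measurable_funTS; exact: (measurableT_comp ma (@measurable_fst _ _ (P * T)%type (lst T))).
apply: (ih _ (P * T)%type (fun p y => a p.1 y * kp p.2 y)%R).
apply: measurable_funM.
  apply: (measurable_comp2 ma (f := fun q : P * T * T => q.1.1)); last exact: measurable_snd.
  exact: (measurableT_comp measurable_fst measurable_fst).
apply: (measurable_comp2 mk (f := fun q : P * T * T => q.1.2)); last exact: measurable_snd.
exact: (measurableT_comp measurable_snd measurable_fst).
Qed.

Lemma measurable_klist_param kp : measurable_fun setT (fun q : T * T => kp q.1 q.2) ->
  measurable_fun setT (fun q : T * lst T => klist kp q.2 q.1).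
Proof.
move=> mk; apply: lst_recursion => k.
suff h dP (P : measurableType dP) (f : P -> T) : measurable_fun setT f ->
    measurable_fun (szk k) (fun q : P * lst T => klist kp q.2 (f q.1)).
  exact: (h _ _ id (@measurable_id _ _ setT)).
elim: k dP P f => [|k ih] dP P f mf.
  by apply: lst_rec0; rewrite /klist; under eq_fun do rewrite big_nil; exact: measurable_cst.
apply: lst_recS => /=; rewrite /klist; under eq_fun do rewrite big_cons.
apply: measurable_funM.
  apply: measurable_funTS; apply: (measurable_comp2 mk).
    exact: (measurableT_comp measurable_snd measurable_fst).
  by apply: (measurableT_comp mf); exact: (measurableT_comp measurable_fst measurable_fst).
exact: (ih _ _ (f \o fst) (measurableT_comp mf measurable_fst)).
Qed.

Lemma measurable_bw kp a : measurable_fun setT (fun q : T * T => kp q.1 q.2) ->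
  measurable_fun setT a -> measurable_fun setT (bw kp a).
Proof.
move=> mk ma; have h := @measurable_bw_param kp _ unit (fun _ => a) mk (measurableT_comp ma measurable_snd).
by apply: (measurable_comp2 h (measurable_cst tt)); exact: measurable_id.
Qed.

Section fixed_kernel.
Variable kp : T -> T -> R.
Hypothesis pk : pairfun kp.

Let k0 x y : (0 <= kp x y)%R. Proof. by case: pk => _ /(_ x y)/andP[]. Qed.
Let k1 x y : (kp x y <= 1)%R. Proof. by case: pk => _ /(_ x y)/andP[]. Qed.
Let mk : measurable_fun setT (fun q : T * T => kp q.1 q.2). Proof. by case: pk. Qed.

Lemma bw_ge0 a s : (forall x, 0 <= a x)%R -> (0 <= bw kp a s)%R.
Proof.
by elim: s a => //= x s ih a a0; rewrite mulr_ge0// ih// => y; rewrite mulr_ge0.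
Qed.

Lemma le_bw a b s : (forall x, 0 <= a x)%R -> (forall x, a x <= b x)%R ->
  (bw kp a s <= bw kp b s)%R.
Proof.
elim: s a b => //= x s ih a b a0 ab; apply: ler_pM => //.
  by apply: bw_ge0 => y; rewrite mulr_ge0.
by apply: ih => y; [rewrite mulr_ge0|rewrite ler_wpM2r].
Qed.

Lemma le_bw_free a s : (forall x, 0 <= a x)%R -> (bw kp a s <= bw (fun _ _ => 1) a s)%R.
Proof.
elim: s a => //= x s ih a a0; rewrite ler_wpM2l//.
apply: (@le_trans _ _ (bw kp a s)); last first.
  apply: le_trans (ih _ a0) _; rewrite le_eqVlt; apply/orP; left; apply/eqP.
  by apply: eq_bw => y _; rewrite mulr1.
by apply: le_bw => y; [rewrite mulr_ge0|rewrite ler_piMr].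
Qed.

Lemma bw_cat a s t : bw kp a (s ++ t) = (bw kp a s * bw kp (fun y => a y * klist kp s y) t)%R.
Proof.
elim: s a => [|x s ih] a /=.
  by rewrite mul1r; apply: eq_bw => y _; rewrite /klist big_nil mulr1.
rewrite ih mulrA; congr (_ * _)%R; apply: eq_bw => y _.
by rewrite /klist big_cons mulrA.
Qed.

Lemma bw_move a x s t : bw kp a (s ++ x :: t) = bw kp a (x :: s ++ t).
Proof.
case: pk => _ _ ks; elim: s a => //= y s ih a; rewrite ih /= !mulrA.
rewrite (ks y x); congr (_ * _)%R; first ring.
by apply: eq_bw => z _; rewrite -!mulrA; congr (_ * _)%R; exact: mulrC.
Qed.

Lemma bw_perm a : symmetric_fun (bw kp a).
Proof.
move=> s; elim: s a => [|x s ih] a t; first by rewrite perm_sym => /perm_nilP ->.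
move=> st; have xt : x \in t by rewrite -(perm_mem st) mem_head.
have [t1 [t2 tE]] : exists t1 t2, t = t1 ++ x :: t2.
  exists (take (index x t) t), (drop (index x t).+1 t).
  by rewrite -{1}(cat_take_drop (index x t) t) (drop_nth x) ?index_mem// nth_index.
move: st; rewrite tE => st.
have : perm_eq (x :: s) (x :: t1 ++ t2).
  by rewrite (perm_trans st)// -[x :: t2]cat1s perm_catCA.
rewrite perm_cons => st'; rewrite bw_move /=; congr (_ * _)%R; exact: ih.
Qed.

Lemma klist_ge0 t y : (0 <= klist kp t y)%R.
Proof. by apply: prodr_ge0. Qed.

Lemma klist_le1 t y : (klist kp t y <= 1)%R.
Proof. by apply: prodr_ile1 => x _; rewrite k0 k1. Qed.

End fixed_kernel.

Lemma pairfun_free : pairfun (fun _ _ => 1%R).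
Proof. by split => //; move=> *; rewrite ler01 lexx. Qed.

Section partition_function.
Variable mu : {sfinite_measure set T -> \bar R}.

Definition Zp kp a : \bar R := \int[poisson mu]_s (bw kp a s)%:E.

(** Integrability confines the partition functions with kernel values in [0, 1] between 1 and the
    exponential of the integral of a, so their ratios make sense. *)
Definition act a := [/\ measurable_fun setT a, (forall x, 0 <= a x)%R &
  \int[mu]_x (a x)%:E < +oo].

Lemma act_le a b : act a -> measurable_fun setT b -> (forall x, 0 <= b x <= a x)%R -> act b.
Proof.
move=> [ma a0 ia] mb ba; split=> //; first by move=> x; case/andP: (ba x).
apply: le_lt_trans ia; apply: ge0_le_integral => //.
- by move=> x _; rewrite lee_fin; case/andP: (ba x).
- exact/measurable_EFinP.
- exact/measurable_EFinP.
- by move=> x _; rewrite lee_fin; case/andP: (ba x).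
Qed.

Lemma Zp_free a : act a ->
  Zp (fun _ _ => 1%R) a = (expR (fine (\int[mu]_x (a x)%:E)))%:E.
Proof.
move=> [ma a0 ia]; have mk : measurable_fun setT (fun q : T * T => 1%R : R) by exact: measurable_cst.
have mb : measurable_fun setT (fun s => (bw (fun _ _ => 1%R) a s)%:E).
  by apply/measurable_EFinP; exact: measurable_bw.
have b0 s : 0%R <= (bw (fun _ _ => 1%R) a s)%:E by rewrite lee_fin (bw_ge0 pairfun_free).
have i0 : 0 <= \int[mu]_x (a x)%:E by apply: integral_ge0 => x _; rewrite lee_fin.
set A := fine _; have AE : \int[mu]_x (a x)%:E = A%:E by rewrite fineK// ge0_fin_numE.
have A0 : (0 <= A)%R by rewrite -lee_fin -AE.
have E k : \int[lpow mu k]_s (bw (fun _ _ => 1%R) a s)%:E = (A ^+ k)%:E.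
  elim: k => [|k ih]; first by rewrite integral_lpow0.
  rewrite integral_lpowS//.
  transitivity (\int[mu]_x ((a x)%:E * (A ^+ k)%:E)).
    apply: eq_integral => x _; rewrite -ih -ge0_integralZl ?lee_fin//.
    by apply: eq_integral => s _ /=; rewrite -EFinM; congr (_ * _)%:E; apply: eq_bw => y _; rewrite mulr1.
  rewrite ge0_integralZr//; last first.
  - by rewrite lee_fin exprn_ge0.
  - by move=> x _; rewrite lee_fin.
  - exact/measurable_EFinP.
  by rewrite AE exprS.
rewrite /Zp [LHS](integral_poisson mu b0 mb).
transitivity (limn (EFin \o series (exp_coeff A))).
  congr (limn _); apply/funext => n; rewrite /series/= -sumEFin; apply: eq_bigr => k _.
  by rewrite E -EFinM mulrC.
by rewrite EFin_lim//; exact: is_cvg_series_exp_coeff.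
Qed.

Section kernel_Z.
Variable kp : T -> T -> R.
Hypothesis pk : pairfun kp.

Let k0 x y : (0 <= kp x y)%R. Proof. by case: pk => _ /(_ x y)/andP[]. Qed.
Let k1 x y : (kp x y <= 1)%R. Proof. by case: pk => _ /(_ x y)/andP[]. Qed.
Let mk : measurable_fun setT (fun q : T * T => kp q.1 q.2). Proof. by case: pk. Qed.

Lemma measurable_bwE a : act a -> measurable_fun setT (fun s => (bw kp a s)%:E).
Proof. by move=> [ma _ _]; apply/measurable_EFinP; exact: measurable_bw. Qed.

Lemma Zp_ge1 a : act a -> 1 <= Zp kp a.
Proof.
move=> aa; have [ma a0 ia] := aa; have mb := measurable_bwE aa.
have b0 s : 0%R <= (bw kp a s)%:E by rewrite lee_fin bw_ge0.
rewrite /Zp integral_poisson// nneseries_recl//; last first.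
  by move=> k _; rewrite mule_ge0 ?lee_fin ?invr_ge0//; exact: integral_ge0.
rewrite integral_lpow0//= fact0 invr1 mul1e leeDl//; apply: nneseries_ge0 => k _ _.
by rewrite mule_ge0 ?lee_fin ?invr_ge0//; exact: integral_ge0.
Qed.

Lemma Zp_lty a : act a -> Zp kp a < +oo.
Proof.
move=> aa; have [ma a0 ia] := aa.
apply: (@le_lt_trans _ _ (Zp (fun _ _ => 1%R) a)); last by rewrite Zp_free// ltry.
apply: ge0_le_integral => //.
- by move=> s _; rewrite lee_fin bw_ge0.
- exact: measurable_bwE.
- by apply/measurable_EFinP; apply: measurable_bw.
- by move=> s _; rewrite lee_fin le_bw_free.
Qed.

Lemma Zp_fin a : act a -> Zp kp a \is a fin_num.
Proof. by move=> aa; rewrite ge0_fin_numE ?Zp_lty// (le_trans _ (Zp_ge1 aa)). Qed.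

Definition Zr a : R := fine (Zp kp a).

Lemma ZpE a : act a -> Zp kp a = (Zr a)%:E.
Proof. by move=> aa; rewrite fineK// Zp_fin. Qed.

Lemma Zr_ge1 a : act a -> (1 <= Zr a)%R.
Proof. by move=> aa; rewrite -lee_fin -ZpE// Zp_ge1. Qed.

Lemma Zr_gt0 a : act a -> (0 < Zr a)%R.
Proof. by move=> aa; rewrite (lt_le_trans ltr01)// Zr_ge1. Qed.

Lemma le_Zp a b : act a -> act b -> (forall x, a x <= b x)%R -> Zp kp a <= Zp kp b.
Proof.
move=> aa ab h; have [ma a0 ia] := aa; apply: ge0_le_integral => //.
- by move=> s _; rewrite lee_fin bw_ge0.
- exact: measurable_bwE.
- exact: measurable_bwE.
- by move=> s _; rewrite lee_fin le_bw.
Qed.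

Lemma le_Zr a b : act a -> act b -> (forall x, a x <= b x)%R -> (Zr a <= Zr b)%R.
Proof. by move=> aa ab h; rewrite -lee_fin -!ZpE// le_Zp. Qed.

Lemma eq_Zp a b : a =1 b -> Zp kp a = Zp kp b.
Proof. by move=> ab; apply: eq_integral => s _; congr EFin; apply: eq_bw => x _. Qed.

Lemma act_k a x : act a -> act (fun y => a y * kp x y)%R.
Proof.
move=> aa; have [ma a0 ia] := aa; apply: (act_le aa).
  apply: measurable_funM => //; apply: (measurable_comp2 mk (measurable_cst x)); exact: measurable_id.
by move=> y; rewrite mulr_ge0//= ler_piMr.
Qed.

(* The intensity (one-point density) of the Gibbs process at x is a x * insp a x. *)
Definition insp a x : R := (Zr (fun y => a y * kp x y) / Zr a)%R.

Lemma insp_gt0 a x : act a -> (0 < insp a x)%R.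
Proof. by move=> aa; rewrite divr_gt0// Zr_gt0//; exact: act_k. Qed.

Lemma insp_le1 a x : act a -> (insp a x <= 1)%R.
Proof.
move=> aa; have [ma a0 ia] := aa; rewrite ler_pdivrMr ?Zr_gt0// mul1r; apply: le_Zr => //; first exact: act_k.
by move=> y; rewrite ler_piMr.
Qed.

End kernel_Z.
End partition_function.
End gibbs_weight_theory.

(** * Interpolation identity for partition functions *)

Section interpolation.
Context d (T : measurableType d) (R : realType) (mu : {sfinite_measure set T -> \bar R}).
Variable rho : T -> R.
Hypothesis mrho : measurable_fun setT rho.
Hypothesis rho_null : forall c, mu [set x | rho x = c] = 0.

(** Two points on the same level of [rho] would switch activity simultaneously, which breaks the
    telescoping sum of [telescope]. Such lists are negligible because levels are null sets. *)
Definition tied (s : lst T) : bool := ~~ pairwise (fun x y => rho x != rho y) s.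

Let mrho2 : measurable_fun setT (fun q : T * T => rho q.1 != rho q.2).
Proof.
apply: measurable_neg; apply: measurable_fun_eqr.
  exact: (measurableT_comp mrho measurable_fst).
exact: (measurableT_comp mrho measurable_snd).
Qed.

Lemma measurable_tied : measurable_fun setT tied.
Proof.
apply: measurable_neg.
suff h : measurable_fun setT (fun q : unit * lst T => pairwise (fun x y => rho x != rho y) q.2).
  by apply: (measurable_comp2 h (measurable_cst tt)); exact: measurable_id.
apply: lst_recursion => k.
suff h dP (P : measurableType dP) :
  measurable_fun (szk k) (fun q : P * lst T => pairwise (fun x y => rho x != rho y) q.2) by exact: h.
elim: k dP P => [|k ih] dP P; first by apply: lst_rec0; exact: measurable_cst.
apply: lst_recS => /=; apply: measurable_and; last exact: ih.
apply: measurable_funTS.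
have h := measurable_lall (b := fun x y => rho x != rho y) mrho2.
apply: (measurable_comp2 h (f := fun q : P * T * lst T => q.1.2)); last exact: measurable_snd.
exact: (measurableT_comp measurable_snd measurable_fst).
Qed.

Let hasr (x : T) (s : lst T) := has (fun y => rho x == rho y) s.

Let measurable_hasr : measurable_fun setT (fun q : T * lst T => hasr q.1 q.2).
Proof.
rewrite (_ : (fun _ => _) = fun q : T * lst T => ~~ all (fun y => rho q.1 != rho y) q.2).
  by apply: measurable_neg; exact: (measurable_lall (b := fun x y => rho x != rho y) mrho2).
by apply/funext => q; rewrite /hasr -has_predC; apply: eq_has => y /=; rewrite negbK.
Qed.

Let integral_hasr (s : lst T) : \int[mu]_x (hasr x s)%:R%:E = 0.
Proof.
elim: s => [|y s ih]; first by rewrite /hasr/= integral0.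
have mh : measurable_fun setT (fun x : T => (hasr x s)%:R%:E : \bar R).
  apply: measurable_natb; apply: (measurable_comp2 measurable_hasr); first exact: measurable_id.
  exact: measurable_cst.
have h0 (x : T) : 0%R <= (hasr x s)%:R%:E :> \bar R by rewrite lee_fin.
have mS : measurable [set x | rho x = rho y].
  by have := mrho measurableT (measurable_set1 (rho y)); rewrite setTI.
have mi : measurable_fun setT (fun x : T => (\1_[set x | rho x = rho y] x)%:E : \bar R).
  by apply/measurable_EFinP; exact: measurable_indic.
have i0 (x : T) : 0%R <= (\1_[set x | rho x = rho y] x)%:E :> \bar R by rewrite lee_fin.
apply/eqP; rewrite eq_le; apply/andP; split; last first.
  by apply: integral_ge0 => x _; rewrite lee_fin.
have <- : \int[mu]_x ((\1_[set x | rho x = rho y] x)%:E + (hasr x s)%:R%:E) = 0.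
  rewrite (ge0_integralD mu measurableT (fun x _ => i0 x) mi (fun x _ => h0 x) mh) ih adde0.
  rewrite integral_indic// setIT. exact: rho_null.
apply: ge0_le_integral => //.
- apply: measurable_natb; apply: (measurable_comp2 measurable_hasr); first exact: measurable_id.
  exact: measurable_cst.
- exact: emeasurable_funD.
- move=> x _; rewrite -EFinD lee_fin indicE.
  rewrite (_ : (x \in _) = (rho x == rho y)); last by apply/idP/eqP; rewrite inE.
  by rewrite /hasr/= -natrD ler_nat; case: (_ == _); case: (has _ _).
Qed.

Let tied_cons x s : tied (x :: s) = hasr x s || tied s.
Proof.
rewrite /tied/= negb_and; congr (_ || _); rewrite /hasr -has_predC; apply: eq_has => y /=.
by rewrite negbK.
Qed.

Lemma integral_lpow_tied k : \int[lpow mu k]_s (tied s)%:R%:E = 0.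
Proof.
have mt : measurable_fun setT (fun s => (tied s)%:R%:E : \bar R).
  by apply: measurable_natb; exact: measurable_tied.
have t0 (s : lst T) : 0%R <= (tied s)%:R%:E :> \bar R by rewrite lee_fin.
elim: k => [|k ih]; first by rewrite integral_lpow0.
rewrite [LHS](integral_lpowS mu k t0 mt).
have mh : measurable_fun setT (fun q : T * lst T => (hasr q.1 q.2)%:R%:E : \bar R).
  by apply: measurable_natb; exact: measurable_hasr.
have h0 (q : T * lst T) : 0%R <= (hasr q.1 q.2)%:R%:E :> \bar R by rewrite lee_fin.
apply/eqP; rewrite eq_le; apply/andP; split; last first.
  by apply: integral_ge0 => x _; apply: integral_ge0 => s _.
have E : \int[mu]_x \int[lpow mu k]_s ((hasr x s)%:R%:E) = 0.
  rewrite (sfinite_Fubini mu (lpow mu k) (fun q => (hasr q.1 q.2)%:R%:E) h0 mh).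
  by rewrite integral0_eq// => s _; exact: integral_hasr.
rewrite -E; apply: ge0_le_integral => //.
- by move=> x _; exact: integral_ge0.
- apply: (measurable_integral_sfinite (lpow mu k) (f := fun q : T * lst T => (tied (q.1 :: q.2))%:R%:E)).
    by move=> q; rewrite lee_fin.
  by apply: (measurableT_comp mt); apply: measurable_lcons; [exact: measurable_fst|exact: measurable_snd].
- exact: (measurable_integral_sfinite (lpow mu k) h0 mh).
move=> x _.
have mhx : measurable_fun setT (fun s : lst T => (hasr x s)%:R%:E : \bar R).
  by apply: (measurable_comp2 mh (measurable_cst x)); exact: measurable_id.
have hx0 (s : lst T) : 0%R <= (hasr x s)%:R%:E :> \bar R by rewrite lee_fin.
rewrite -[leRHS]adde0 -ih -(ge0_integralD (lpow mu k) measurableT (fun s _ => hx0 s) mhx (fun s _ => t0 s) mt).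
apply: ge0_le_integral => //.
- exact: (measurableT_comp mt (measurable_lcons1 x)).
- exact: emeasurable_funD.
- move=> s _; rewrite -EFinD lee_fin tied_cons -natrD ler_nat.
  by case: (hasr _ _); case: (tied _).
Qed.

Lemma integral_poisson_tied : \int[poisson mu]_s (tied s)%:R%:E = 0.
Proof.
have mt : measurable_fun setT (fun s => (tied s)%:R%:E : \bar R).
  by apply: measurable_natb; exact: measurable_tied.
have t0 (s : lst T) : 0%R <= (tied s)%:R%:E :> \bar R by rewrite lee_fin.
rewrite (integral_poisson mu t0 mt) eseries0// => k _ _.
by rewrite integral_lpow_tied mule0.
Qed.

Lemma eq_integral_poisson_tied (F G : lst T -> \bar R) :
  (forall s, 0 <= F s) -> (forall s, 0 <= G s) ->
  measurable_fun setT F -> measurable_fun setT G ->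
  (forall s, ~~ tied s -> F s = G s) ->
  \int[poisson mu]_s F s = \int[poisson mu]_s G s.
Proof.
move=> F0 G0 mF mG FG.
have mt : measurable_fun setT (fun s => (tied s)%:R%:E : \bar R).
  by apply: measurable_natb; exact: measurable_tied.
have t0 (s : lst T) : 0%R <= (tied s)%:R%:E :> \bar R by rewrite lee_fin.
have mty : measurable_fun setT (fun s => +oo * (tied s)%:R%:E : \bar R) by exact: measurable_funeM.
have ty0 (s : lst T) : 0%R <= +oo * (tied s)%:R%:E :> \bar R by exact: mule_ge0.
(* Adding +oo on the negligible set of tied lists changes neither integral and makes the two
   integrands equal everywhere. *)
have E (H : lst T -> \bar R) : (forall s, 0 <= H s) -> measurable_fun setT H ->
    \int[poisson mu]_s H s = \int[poisson mu]_s (H s + +oo * (tied s)%:R%:E).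
  move=> H0 mH.
  rewrite (ge0_integralD (poisson mu) measurableT (fun s _ => H0 s) mH (fun s _ => ty0 s) mty).
  rewrite (ge0_integralZl (poisson mu) measurableT mt (fun s _ => t0 s) (leey 0)).
  by rewrite integral_poisson_tied mule0 adde0.
rewrite (E F)// (E G)//; apply: eq_integral => s _.
case: (boolP (tied s)) => ts; last by rewrite FG.
have yE (z : \bar R) : 0 <= z -> z + +oo * true%:R%:E = +oo.
  by move=> z0; rewrite mule1 addey// -ltNye (lt_le_trans _ z0).
by rewrite !yE.
Qed.

Definition lamt (a b : T -> R) (t : R) (x : T) : R := if (rho x < t)%R then b x else a x.

Definition telG (kp : T -> T -> R) (a b : T -> R) (t : R) (y : T) (s : lst T) : R :=
  ((t <= rho y)%R%:R * ((a y - b y) * bw kp (fun z => lamt a b (rho y) z * kp y z) s))%R.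

(** As the threshold rises from t, the points at level at least t switch from [a] to [b] one after
    the other, in the order of [rho]. The term of y is the drop of the weight when y switches:
    points below its level already carry [b], those above still carry [a]. *)
Lemma telescope kp a b s t : (forall x y, kp x y = kp y x) -> ~~ tied s ->
  bw kp (lamt a b t) s = (bw kp b s + lsum (telG kp a b t) s)%R.
Proof.
move=> ks; elim: s a b t => [|x s ih] a b t /=; first by rewrite addr0.
rewrite tied_cons negb_or => /andP[nx ns].
pose a' y := (a y * kp x y)%R; pose b' y := (b y * kp x y)%R.
have E t' : bw kp (fun y => lamt a b t' y * kp x y)%R s = bw kp (lamt a' b' t') s.
  by apply: eq_bw => y _; rewrite /lamt/a'/b'; case: ifP.
have tie y : y \in s -> rho x != rho y.
  by move=> ys; move: nx; rewrite /hasr => /hasPn /(_ y ys).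
have L (c : R) y u : lamt a b (rho y) x = c ->
    (bw kp (fun z => lamt a b (rho y) z * kp y z) (x :: u) =
    c * (kp y x * bw kp (fun z => lamt a' b' (rho y) z * kp y z) u))%R.
  move=> <- /=; rewrite mulrA; congr (_ * _)%R; apply: eq_bw => z _.
  by rewrite /lamt /a' /b'; case: ifP => _; ring.
have S0 t' : lsum (telG kp a' b' t') s = (bw kp (lamt a' b' t') s - bw kp b' s)%R.
  by rewrite ih// addrC addKr.
rewrite E; have [xt|tx] := ltP (rho x) t.
  have -> : lsum (fun y u => telG kp a b t y (x :: u)) s = (b x * lsum (telG kp a' b' t) s)%R.
    rewrite -lsumZ; apply: eq_lsum => y ys u; rewrite /telG.
    case: (leP t (rho y)) => ty; last by rewrite !mul0r mulr0.
    rewrite (L (b x)); last by rewrite /lamt (lt_le_trans xt ty).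
    by rewrite /a' /b' (ks y x); ring.
  have -> : telG kp a b t x s = 0%R by rewrite /telG leNgt xt mul0r.
  by rewrite add0r S0 {1}/lamt xt -mulrDr addrC subrK.
(* The head x carries [b x] while a point above its level switches and [a x] while one below does;
   the latter terms are the sum from level t minus the sum from level [rho x]. *)
have -> : lsum (fun y u => telG kp a b t y (x :: u)) s =
   (b x * lsum (telG kp a' b' (rho x)) s +
    a x * (lsum (telG kp a' b' t) s + -1 * lsum (telG kp a' b' (rho x)) s))%R.
  rewrite -!lsumZ -lsumD -lsumZ -lsumD; apply: eq_lsum => y ys u; rewrite /telG.
  have := tie y ys; rewrite neq_lt => /orP[xy|yx].
    rewrite (L (b x)); last by rewrite /lamt xy.
    rewrite (ltW xy) (le_trans tx (ltW xy)).
    by rewrite /a' /b' (ks y x); ring.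
  rewrite (L (a x)); last by rewrite /lamt ltNge (ltW yx).
  rewrite (leNgt (rho x)) yx.
  by case: (leP t (rho y)) => _; rewrite /a' /b' (ks y x); rewrite /= ?mulr0n ?mulr1n; ring.
have -> : telG kp a b t x s = ((a x - b x) * bw kp (lamt a' b' (rho x)) s)%R.
  by rewrite /telG tx mul1r E.
rewrite !S0 {1}/lamt ltNge tx/=; ring.
Qed.

End interpolation.

Lemma ler_of_halving (R : realType) (u v K : R) :
  (forall m : nat, u <= v + K / 2 ^+ m)%R -> (u <= v)%R.
Proof.
move=> h; rewrite leNgt; apply/negP => vu.
have e0 : (0 < u - v)%R by rewrite subr_gt0.
pose m := (Num.trunc (`|K| / (u - v))).+1.
have mK : (`|K| / (u - v) < m%:R)%R by exact: truncnS_gt.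
have m2 : (m%:R <= 2 ^+ m :> R)%R by rewrite -natrX ler_nat ltnW// ltn_expl.
have : (K / 2 ^+ m < u - v)%R.
  rewrite ltr_pdivrMr ?exprn_gt0//; apply: le_lt_trans (ler_norm K) _.
  by move: (lt_le_trans mK m2); rewrite ltr_pdivrMr// mulrC.
by rewrite ltNge lerBlDl h.
Qed.

(** * Uniqueness for linear Volterra equations *)

Section volterra.
Context d (T : measurableType d) (R : realType) (mu : {sfinite_measure set T -> \bar R}).
Variables (rho : T -> R) (beta gamma : T -> R) (E : R -> R) (c : R).
Hypothesis mrho : measurable_fun setT rho.
Hypothesis mbeta : measurable_fun setT beta.
Hypothesis mgamma : measurable_fun setT gamma.
Hypothesis mE : measurable_fun setT (fun w => E (rho w)).
Hypothesis bg : forall w, (0 <= beta w <= gamma w)%R.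
Hypothesis E1 : forall t, (1 <= E t)%R.
Hypothesis eqE : forall t, (E t)%:E = 1 + \int[mu]_w ((t <= rho w)%R%:R * (2 * gamma w * E (rho w)))%:E.

Lemma measurable_after t : measurable_fun setT (fun w => ((t <= rho w)%R%:R : R)).
Proof.
apply: (measurableT_comp (f := fun b : bool => b%:R%R : R)) => //.
by apply: measurable_fun_ler.
Qed.

Definition volterra_sol (y : R -> R) := [/\ measurable_fun setT (fun w => y (rho w)),
  forall t, (0 <= y t)%R &
  forall t, (y t)%:E = c%:E + \int[mu]_w ((t <= rho w)%R%:R * (beta w * y (rho w)))%:E].

(** Measured against the weight [E], the integral operator with density [beta] <= [gamma] has norm
    at most 1/2, because [E] solves the equation with density 2 [gamma]. Iterating from y1 <= M <= M
    E leaves the error 2^-m M E for every m. *)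
Lemma volterra_le (y1 y2 : R -> R) (M : R) : volterra_sol y1 -> volterra_sol y2 ->
  (forall t, (y1 t <= M)%R) -> forall t, (y1 t <= y2 t)%R.
Proof.
move=> [m1 p1 e1] [m2 p2 e2] y1M.
have b0 w : (0 <= beta w)%R by case/andP: (bg w).
have bgw w : (beta w <= gamma w)%R by case/andP: (bg w).
have g0 w : (0 <= gamma w)%R by exact: le_trans (b0 w) (bgw w).
have E0 t : (0 <= E t)%R by exact: le_trans ler01 (E1 t).
have M0 : (0 <= M)%R by exact: le_trans (p1 0%R) (y1M 0%R).
suff h m t : (y1 t <= y2 t + M / 2 ^+ m * E t)%R.
  move=> t; apply: (@ler_of_halving _ _ _ (M * E t)) => m.
  by apply: le_trans (h m t) _; rewrite mulrAC.
elim: m t => [|m ih] t.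
  rewrite expr0 divr1; apply: le_trans (y1M t) _.
  by rewrite -[leLHS]add0r lerD// -[leLHS]mulr1 ler_wpM2l.
pose K := (M / 2 ^+ m)%R; have K0 : (0 <= K)%R by rewrite divr_ge0// exprn_ge0.
have i0 (w : T) : (0 <= (t <= rho w)%R%:R :> R)%R by [].
have mi := measurable_after t.
pose F2 w := ((t <= rho w)%R%:R * (beta w * y2 (rho w)))%:E.
pose F3 w := ((t <= rho w)%R%:R * (2 * gamma w * E (rho w)))%:E.
have F20 w : 0 <= F2 w by rewrite lee_fin mulr_ge0// mulr_ge0.
have F30 w : 0 <= F3 w by rewrite lee_fin mulr_ge0// !mulr_ge0.
have mF2 : measurable_fun setT F2.
  by apply/measurable_EFinP; apply: measurable_funM => //; exact: measurable_funM.
have mF3 : measurable_fun setT F3.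
  apply/measurable_EFinP; apply: measurable_funM => //; apply: measurable_funM => //.
  exact: measurable_funM.
have K20 : 0%R <= (K / 2)%:E by rewrite lee_fin divr_ge0.
rewrite -lee_fin e1.
apply: (@le_trans _ _ (c%:E + (\int[mu]_w F2 w + (K / 2)%:E * \int[mu]_w F3 w))).
  rewrite leeD2l// -(ge0_integralZl mu measurableT mF3 (fun w _ => F30 w) K20).
  have mKF3 : measurable_fun setT (fun w => (K / 2)%:E * F3 w) by exact: measurable_funeM.
  have KF30 w : 0 <= (K / 2)%:E * F3 w by exact: mule_ge0.
  rewrite -(ge0_integralD mu measurableT (fun w _ => F20 w) mF2 (fun w _ => KF30 w) mKF3).
  apply: ge0_le_integral => //.
  - by move=> w _; rewrite lee_fin mulr_ge0// mulr_ge0.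
  - by apply/measurable_EFinP; apply: measurable_funM => //; exact: measurable_funM.
  - exact: emeasurable_funD.
  - move=> w _; rewrite /F2 /F3 -EFinM -EFinD lee_fin.
    rewrite [X in (_ <= _ + X)%R]mulrCA -mulrDr ler_wpM2l//.
    apply: le_trans (ler_wpM2l (b0 w) (ih (rho w))) _.
    rewrite mulrDr lerD2l -/K.
    have -> : (K / 2 * (2 * gamma w * E (rho w)) = gamma w * (K * E (rho w)))%R by field.
    by rewrite ler_wpM2r// mulr_ge0.
rewrite addeA -e2 EFinD leeD2l//.
have -> : (M / 2 ^+ m.+1 * E t)%:E = (K / 2)%:E * (E t)%:E.
  by rewrite -EFinM /K exprS invfM mulrA [(M / 2 / _)%R]mulrAC.
rewrite lee_wpmul2l// eqE; apply: leeDr => //.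
Qed.

Lemma volterra_uniq (y1 y2 : R -> R) (M1 M2 : R) : volterra_sol y1 -> volterra_sol y2 ->
  (forall t, (y1 t <= M1)%R) -> (forall t, (y2 t <= M2)%R) -> y1 =1 y2.
Proof.
move=> s1 s2 h1 h2 t; apply/eqP; rewrite eq_le.
by rewrite (volterra_le s1 s2 h1) (volterra_le s2 s1 h2).
Qed.

End volterra.

(** * Exponential formula for ratios of partition functions *)

Section interpolation_formula.
Context d (T : measurableType d) (R : realType) (mu : {sfinite_measure set T -> \bar R}).
Variable rho : T -> R.
Hypothesis mrho : measurable_fun setT rho.
Hypothesis rho_null : forall c, mu [set x | rho x = c] = 0.

Lemma measurable_lamt_param dP (P : measurableType dP) (a b : T -> R) (t : P -> R) :
  measurable_fun setT a -> measurable_fun setT b -> measurable_fun setT t ->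
  measurable_fun setT (fun q : P * T => lamt rho a b (t q.1) q.2).
Proof.
move=> ma mb mt; apply: measurable_fun_ifT.
- apply: measurable_fun_ltr; first exact: (measurableT_comp mrho measurable_snd).
  exact: (measurableT_comp mt measurable_fst).
- exact: (measurableT_comp mb measurable_snd).
- exact: (measurableT_comp ma measurable_snd).
Qed.

Section two_activities.
Variables (kp : T -> T -> R) (a b : T -> R).
Hypothesis pk : pairfun kp.
Hypothesis aa : act mu a.
Hypothesis ab : act mu b.
Hypothesis ba : forall x, (b x <= a x)%R.

Let mk : measurable_fun setT (fun q : T * T => kp q.1 q.2). Proof. by case: pk. Qed.
Let k01 x y : (0 <= kp x y <= 1)%R. Proof. by case: pk. Qed.
Let ma : measurable_fun setT a. Proof. by case: aa. Qed.
Let mb : measurable_fun setT b. Proof. by case: ab. Qed.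
Let a0 x : (0 <= a x)%R. Proof. by case: aa. Qed.
Let b0 x : (0 <= b x)%R. Proof. by case: ab. Qed.

Lemma lamt_ge0 t x : (0 <= lamt rho a b t x)%R.
Proof. by rewrite /lamt; case: ifP. Qed.

Lemma lamt_le t x : (lamt rho a b t x <= a x)%R.
Proof. by rewrite /lamt; case: ifP. Qed.

Lemma act_lamt t : act mu (lamt rho a b t).
Proof.
apply: (act_le aa); last by move=> x; rewrite lamt_ge0 lamt_le.
apply: measurable_fun_ifT => //.
by apply: measurable_fun_ltr.
Qed.

Let lamk (w z : T) : R := (lamt rho a b (rho w) z * kp w z)%R.

Let mlamk : measurable_fun setT (fun q : T * T => lamk q.1 q.2).
Proof. by apply: measurable_funM => //; exact: measurable_lamt_param. Qed.

Let mbwk : measurable_fun setT (fun q : T * lst T => bw kp (lamk q.1) q.2).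
Proof. exact: measurable_bw_param. Qed.

Let bwk0 w s : (0 <= bw kp (lamk w) s)%R.
Proof.
by apply: bw_ge0 => // z; rewrite mulr_ge0 ?lamt_ge0//; case/andP: (k01 w z).
Qed.

Let mZk : measurable_fun setT (fun w => Zp mu kp (lamk w)).
Proof.
apply: (measurable_integral_sfinite (poisson mu) (f := fun q : T * lst T => (bw kp (lamk q.1) q.2)%:E)).
  by move=> q; rewrite lee_fin.
exact/measurable_EFinP.
Qed.

(** [telescope] integrated over the Poisson process: tied lists are negligible, and the Mecke
    formula turns the sum over points into an integral. *)
Lemma Zp_telescope t : Zp mu kp (lamt rho a b t) = Zp mu kp b +
  \int[mu]_w (((t <= rho w)%R%:R * (a w - b w))%:E * Zp mu kp (fun z => lamt rho a b (rho w) z * kp w z)%R).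
Proof.
have [_ _ ks] := pk.
have mbb := measurable_bwE pk ab.
have bb0 s : 0%R <= (bw kp b s)%:E by rewrite lee_fin bw_ge0.
have G0 w s : (0 <= telG rho kp a b t w s)%R.
  by rewrite /telG mulr_ge0// mulr_ge0// ?subr_ge0//; exact: bwk0.
have mG : measurable_fun setT (fun q : T * lst T => telG rho kp a b t q.1 q.2).
  apply: measurable_funM; first exact: (measurableT_comp (measurable_after mrho t) measurable_fst).
  apply: measurable_funM; last exact: mbwk.
  by apply: measurable_funB; apply: (measurableT_comp _ measurable_fst).
have mS : measurable_fun setT (fun s => (lsum (telG rho kp a b t) s)%:E).
  by apply/measurable_EFinP; exact: measurable_lsum.
have S0 s : 0%R <= (lsum (telG rho kp a b t) s)%:E by rewrite lee_fin lsum_ge0.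
transitivity (\int[poisson mu]_s ((bw kp b s)%:E + (lsum (telG rho kp a b t) s)%:E)).
  apply: (eq_integral_poisson_tied mrho rho_null).
  - by move=> s; rewrite lee_fin bw_ge0//; exact: lamt_ge0.
  - by move=> s; exact: adde_ge0.
  - exact: (measurable_bwE pk (act_lamt t)).
  - exact: emeasurable_funD.
  - by move=> s nt; rewrite -EFinD (telescope a b t ks nt).
rewrite (ge0_integralD (poisson mu) measurableT (fun s _ => bb0 s) mbb (fun s _ => S0 s) mS).
congr (_ + _); rewrite (mecke mu G0 mG); apply: eq_integral => w _.
have mw : measurable_fun setT (fun s : lst T => (bw kp (lamk w) s)%:E).
  by apply/measurable_EFinP; apply: (measurable_comp2 mbwk (measurable_cst w)); exact: measurable_id.
have w0 (s : lst T) : 0%R <= (bw kp (lamk w) s)%:E by rewrite lee_fin.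
have c0 : 0%R <= ((t <= rho w)%R%:R * (a w - b w))%:E by rewrite lee_fin mulr_ge0// subr_ge0.
rewrite -[RHS](ge0_integralZl (poisson mu) measurableT mw (fun s _ => w0 s) c0).
by apply: eq_integral => s _; rewrite /telG -EFinM mulrA.
Qed.

(** Up to sign, the logarithmic derivative of the partition function along the path [lamt], spread
    out in space: the activity at w drops from [a w] to [b w] when the threshold passes the level of
    w. *)
Definition interp_density w : R := ((a w - b w) * insp mu kp (lamt rho a b (rho w)) w)%R.

Let mZlam : measurable_fun setT (fun w => Zr mu kp (lamt rho a b (rho w))).
Proof.
apply: (measurableT_comp (@fine_measurable R setT measurableT)).
apply: (measurable_integral_sfinite (poisson mu) (f := fun q : T * lst T => (bw kp (lamt rho a b (rho q.1)) q.2)%:E)).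
  by move=> q; rewrite lee_fin bw_ge0//; exact: lamt_ge0.
apply/measurable_EFinP; apply: (measurable_bw_param (a := fun w => lamt rho a b (rho w)) mk).
exact: measurable_lamt_param.
Qed.

Lemma measurable_interp_insp : measurable_fun setT (fun w => insp mu kp (lamt rho a b (rho w)) w).
Proof.
apply: measurable_funM.
  exact: (measurableT_comp (@fine_measurable R setT measurableT) mZk).
rewrite (_ : (fun _ => _) = (fun w => powR (Zr mu kp (lamt rho a b (rho w))) (-1))).
  exact: (measurableT_comp (@measurable_powR R (-1)) mZlam).
by apply/funext => w; rewrite powR_inv1// ltW// Zr_gt0//; exact: act_lamt.
Qed.

Lemma measurable_interp_density : measurable_fun setT interp_density.
Proof. by apply: measurable_funM; [exact: measurable_funB|exact: measurable_interp_insp]. Qed.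

Lemma interp_density_ge0 w : (0 <= interp_density w)%R.
Proof. by rewrite mulr_ge0// ?subr_ge0// ltW// insp_gt0//; exact: act_lamt. Qed.

Lemma interp_density_le w : (interp_density w <= a w - b w)%R.
Proof. by rewrite ler_piMr ?subr_ge0// insp_le1//; exact: act_lamt. Qed.

Lemma act_interp_density : act mu interp_density.
Proof.
apply: (act_le aa); first exact: measurable_interp_density.
move=> x; rewrite interp_density_ge0/= (le_trans (interp_density_le x))//.
by rewrite gerBl.
Qed.

(** Writing the partition function with w inserted as [insp] times the one without w makes
    [Zp_telescope] a linear equation for t |-> Z(lamt t). *)
Lemma Zr_volterra : volterra_sol mu rho interp_density (Zr mu kp b)
  (fun t => Zr mu kp (lamt rho a b t)).
Proof.
split => // [t|t]; first by rewrite ltW// Zr_gt0//; exact: act_lamt.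
have al := act_lamt t.
rewrite -ZpE// Zp_telescope -ZpE//; congr (_ + _); apply: eq_integral => w _.
have aw := act_lamt (rho w); have akw := act_k pk w aw.
rewrite (ZpE pk akw) -EFinM; congr EFin.
rewrite -mulrA; congr (_ * _)%R; rewrite /interp_density -mulrA; congr (_ * _)%R.
by rewrite /insp divfK// gt_eqF// Zr_gt0.
Qed.

End two_activities.

Section free_solution.
Variable g : T -> R.
Hypothesis ag : act mu g.
Let z0 : T -> R := fun=> 0%R.
Let fr : T -> T -> R := fun _ _ => 1%R.

Lemma act0 : act mu (fun=> 0%R : R).
Proof. by split => //; rewrite integral0 ltry. Qed.

Let pf : pairfun fr. Proof. exact: pairfun_free. Qed.
Let mg : measurable_fun setT g. Proof. by case: ag. Qed.
Let g0 x : (0 <= g x)%R. Proof. by case: ag. Qed.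

(** The ideal-gas partition function of g restricted to levels at least t, that is the exponential
    of the integral of g over these levels: the explicit solution of the linear equation. For a
    doubled activity it also provides the weight of the uniqueness argument. *)
Definition free_exp (t : R) : R := Zr mu fr (lamt rho g z0 t).

Lemma free_exp_ge1 t : (1 <= free_exp t)%R.
Proof. by apply: Zr_ge1; [exact: pairfun_free|apply: act_lamt => //; exact: act0]. Qed.

Lemma free_exp_le t : (free_exp t <= Zr mu fr g)%R.
Proof.
apply: (le_Zr pf (act_lamt ag act0 g0 t) ag) => x; exact: lamt_le.
Qed.

Lemma measurable_free_exp : measurable_fun setT (fun w => free_exp (rho w)).
Proof.
apply: (measurableT_comp (@fine_measurable R setT measurableT)).
apply: (measurable_integral_sfinite (poisson mu) (f := fun q : T * lst T => (bw fr (lamt rho g z0 (rho q.1)) q.2)%:E)).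
  by move=> q; rewrite lee_fin (bw_ge0 pf)// => x; rewrite /lamt; case: ifP.
have mfr : measurable_fun setT (fun q : T * T => fr q.1 q.2) by exact: measurable_cst.
apply/measurable_EFinP; apply: (measurable_bw_param (a := fun w => lamt rho g z0 (rho w)) mfr).
exact: (measurable_lamt_param mg (measurable_cst (0%R : R)) mrho).
Qed.

Lemma free_expE t : (free_exp t)%:E =
  1 + \int[mu]_w ((t <= rho w)%R%:R * (g w * free_exp (rho w)))%:E.
Proof.
have al t' : act mu (lamt rho g z0 t') by apply: act_lamt => //; exact: act0.
rewrite -(ZpE pf (al t)) (Zp_telescope pf ag act0); last by [].
congr (_ + _).
  by rewrite (Zp_free act0) integral0 /= expR0.
apply: eq_integral => w _; rewrite subr0 mulrA [RHS]EFinM; congr (_ * _).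
rewrite /free_exp -(ZpE pf (al _)); apply: eq_Zp => x; exact: mulr1.
Qed.

End free_solution.

Hypothesis rho_ge0 : forall x, (0 <= rho x)%R.

(** Z(lamt t) and Z(b) times [free_exp] of the density solve the same Volterra equation, hence
    agree; the claim is their equality at t = 0, where no level has been passed. This integrates d
    log Z without differentiating in t. *)
Theorem Zr_interpolation (kp : T -> T -> R) (a b : T -> R) : pairfun kp ->
  act mu a -> act mu b -> (forall x, (b x <= a x)%R) ->
  Zr mu kp a = (Zr mu kp b * expR (fine (\int[mu]_w (interp_density kp a b w)%:E)))%R.
Proof.
move=> pk aa ab ba; pose be := interp_density kp a b.
pose ga := (fun w => a w - b w)%R.
have abe : act mu be by exact: act_interp_density.
have [ma a0 ia] := aa; have [mb b0 ib] := ab.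
have mga : measurable_fun setT ga by exact: measurable_funB.
(* The activity 2 (a - b), whose [free_exp] is the weight [E] of [volterra_uniq]. *)
have a2 : act mu (fun w => 2 * ga w)%R.
  split; first exact: measurable_funM.
    by move=> x; rewrite mulr_ge0// subr_ge0.
  apply: (@le_lt_trans _ _ (\int[mu]_x (2%:E * (a x)%:E))).
    apply: ge0_le_integral => //.
    - by move=> x _; rewrite lee_fin mulr_ge0// subr_ge0.
    - by apply/measurable_EFinP; exact: measurable_funM.
    - by apply: measurable_funeM; exact/measurable_EFinP.
    - by move=> x _; rewrite -EFinM lee_fin ler_wpM2l// gerBl.
  have ma' : measurable_fun setT (fun x => (a x)%:E) by exact/measurable_EFinP.
  have a0' x : 0%R <= (a x)%:E by rewrite lee_fin.
  rewrite (ge0_integralZl mu measurableT ma' (fun x _ => a0' x)) ?lee_fin//.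
  by rewrite lte_mul_pinfty.
have beg w : (0 <= be w <= ga w)%R.
  by rewrite interp_density_ge0// interp_density_le.
have s1 := Zr_volterra pk aa ab ba.
have Zb0 : (0 <= Zr mu kp b)%R by rewrite ltW// Zr_gt0.
have fe0 t : (0 <= free_exp be t)%R by exact: le_trans ler01 (free_exp_ge1 abe t).
have s2 : volterra_sol mu rho be (Zr mu kp b) (fun t => Zr mu kp b * free_exp be t)%R.
  split.
  - by apply: measurable_funM => //; exact: measurable_free_exp.
  - by move=> t; rewrite mulr_ge0.
  - move=> t; have mbe : measurable_fun setT be by case: abe.
    pose F w := ((t <= rho w)%R%:R * (be w * free_exp be (rho w)))%:E.
    have F0 w : 0 <= F w by rewrite lee_fin mulr_ge0// mulr_ge0//; case/andP: (beg w).
    have mF : measurable_fun setT F.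
      apply/measurable_EFinP; apply: measurable_funM; first exact: measurable_after.
      by apply: measurable_funM => //; exact: measurable_free_exp.
    have Zb0' : 0%R <= (Zr mu kp b)%:E by rewrite lee_fin.
    have I0 : 0 <= \int[mu]_w F w by exact: integral_ge0.
    rewrite EFinM (free_expE abe) ge0_muleDr// mule1; congr (_ + _).
    rewrite -(ge0_integralZl mu measurableT mF (fun w _ => F0 w) Zb0').
    apply: eq_integral => w _; rewrite /F -EFinM; congr EFin; ring.
have E := volterra_uniq mrho (proj1 (conj (measurable_interp_density pk aa ab ba) I)) mga (measurable_free_exp a2) beg (free_exp_ge1 a2) (free_expE a2) s1 s2
  (fun t => le_Zr pk (act_lamt aa ab ba t) aa (lamt_le ba t))
  (fun t => ler_wpM2l Zb0 (free_exp_le abe t)).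
have := E 0%R => /=.
have l0 c e : lamt rho c e 0%R =1 c by move=> x; rewrite /lamt ltNge rho_ge0.
rewrite /free_exp /Zr (eq_Zp _ _ (l0 a b)) (eq_Zp _ _ (l0 be _)) => ->.
by rewrite (Zp_free abe).
Qed.

End interpolation_formula.

(* Inequalities behind the contraction factor 1/e *)
Local Close Scope ereal_scope.

(** The squared slope of exp(-y^2/2) is y^2 exp(-y^2), at most exp(-1) because 1 + x <= exp x at x =
    y^2 - 1. This is the origin of e in the threshold e / Delta_phi. *)
Lemma gauss_lipschitz (R : realType) (s t : R) :
  (expR (- (s ^+ 2 / 2)) - expR (- (t ^+ 2 / 2))) ^+ 2 <= expR (-1) * (s - t) ^+ 2.
Proof.
wlog st : s t / s <= t.
  move=> h; have [/h //|/ltW /h] := leP s t.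
  by rewrite -(sqrrN (_ - _)) opprB -(sqrrN (t - s)) opprB.
pose g (y : R) : R := - (2^-1 * y ^+ 2); pose f : R -> R := expR \o g.
have fE x : expR (- (x ^+ 2 / 2)) = f x by rewrite /f/= /g mulrC.
rewrite !fE.
have df (x : R) : is_derive x 1 f (- x * f x).
  have dg : is_derive x 1 g (- x).
    by apply: is_derive_eq; rewrite /GRing.scale/=; field.
  by rewrite mulrC; exact: (is_derive1_comp (is_derive_expR _) dg).
have [c _ fc] : exists2 c, c \in `[s, t] & f t - f s = - c * f c * (t - s).
  apply: (@MVT_segment _ f (fun x => - x * f x)) => //.
  by apply: derivable_within_continuous => x _; case: (df x).
rewrite -(sqrrN (f s - f t)) opprB fc exprMn -(sqrrN (s - t)) opprB.
rewrite ler_wpM2r ?sqr_ge0// exprMn sqrrN.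
have f2 : f c ^+ 2 = expR (- c ^+ 2).
  by rewrite /f/= /g -expRM_natl; congr expR; field.
rewrite f2 expRN -ler_pdivlMr ?invr_gt0 ?expR_gt0// invrK -expRD addrC.
by have := expR_ge1Dx (c ^+ 2 - 1); rewrite addrCA subrr addr0.
Qed.

(** The optimal t is sqrt(F'/F), which turns t F + F'/t into 2 sqrt(F F'). Bounds linear in F and
    F', one for each t, are what the integration of a pointwise inequality provides. *)
Lemma sqrt_diff_sqr_le (R : realType) (F F' D : R) : 0 <= F -> 0 <= F' ->
  (forall t, 0 < t -> F + F' <= D + t * F + F' / t) ->
  (Num.sqrt F - Num.sqrt F') ^+ 2 <= D.
Proof.
move=> F0 F0' h.
(* If F or F' vanishes, the optimal t degenerates to infinity or to 0 and the bound is reached in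
   the limit. *)
have zero (X : R) : 0 <= X -> (forall e, 0 < e -> X <= D + e * X) -> X <= D.
  move=> X0 hX; rewrite leNgt; apply/negP => DX.
  have XD : 0 < X - D by rewrite subr_gt0.
  have [X00|Xn0] := eqVneq X 0.
    by have := hX 1 ltr01; rewrite X00 mulr0 addr0 leNgt -{1}X00 DX.
  have Xp : 0 < X by rewrite lt_neqAle eq_sym Xn0.
  have := hX ((X - D) / (2 * X)); rewrite divr_gt0 ?mulr_gt0// => /(_ isT).
  have -> : (X - D) / (2 * X) * X = (X - D) / 2 by field.
  lra.
have [F00|Fn0] := eqVneq F 0.
  rewrite F00 sqrtr0 sub0r sqrrN sqr_sqrtr//; apply: zero => // e e0.
  have := h e^-1; rewrite invr_gt0 => /(_ e0).
  by rewrite F00 add0r mulr0 addr0 invrK mulrC.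
have [F00'|Fn0'] := eqVneq F' 0.
  rewrite F00' sqrtr0 subr0 sqr_sqrtr//; apply: zero => // e e0.
  by have := h e e0; rewrite F00' addr0 mul0r addr0.
have Fp : 0 < Num.sqrt F by rewrite sqrtr_gt0 lt_neqAle eq_sym Fn0.
have Fp' : 0 < Num.sqrt F' by rewrite sqrtr_gt0 lt_neqAle eq_sym Fn0'.
have := h (Num.sqrt F' / Num.sqrt F); rewrite divr_gt0// => /(_ isT).
have -> : Num.sqrt F' / Num.sqrt F * F = Num.sqrt F' * Num.sqrt F.
  by rewrite -{2}(sqr_sqrtr F0); field; rewrite gt_eqF.
have -> : F' / (Num.sqrt F' / Num.sqrt F) = Num.sqrt F' * Num.sqrt F.
  by rewrite -{1}(sqr_sqrtr F0'); field; rewrite !gt_eqF.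
by rewrite sqrrB !sqr_sqrtr// => h'; lra.
Qed.

Section reverse_minkowski.
Local Open Scope ereal_scope.
Context d (T : measurableType d) (R : realType) (mu : {sfinite_measure set T -> \bar R}).
Variables (kappa f g : T -> R).
Hypothesis mkappa : measurable_fun setT kappa.
Hypothesis mf : measurable_fun setT f.
Hypothesis mg : measurable_fun setT g.
Hypothesis kappa0 : forall x, (0 <= kappa x)%R.
Hypothesis ikappa : \int[mu]_x (kappa x)%:E < +oo.
Hypothesis f01 : forall x, (0 <= f x <= 1)%R.
Hypothesis g01 : forall x, (0 <= g x <= 1)%R.

Lemma weighted_lty (h : T -> R) : measurable_fun setT h -> (forall x, 0 <= h x <= 1)%R ->
  \int[mu]_x (kappa x * h x)%:E \is a fin_num.
Proof.
move=> mh h01; have h0 x : (0 <= h x)%R by case/andP: (h01 x).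
rewrite ge0_fin_numE; last by apply: integral_ge0 => x _; rewrite lee_fin mulr_ge0.
apply: le_lt_trans ikappa; apply: ge0_le_integral => //.
- by move=> x _; rewrite lee_fin mulr_ge0.
- by apply/measurable_EFinP; exact: measurable_funM.
- exact/measurable_EFinP.
- by move=> x _; rewrite lee_fin ler_piMr//; case/andP: (h01 x).
Qed.

(** The reverse triangle inequality of L2(kappa), from the pointwise bound f^2 + g^2 <= (f - g)^2 +
    t f^2 + g^2 / t. *)
Lemma reverse_minkowski2 :
  ((Num.sqrt (fine (\int[mu]_x (kappa x * f x ^+ 2)%:E)) -
    Num.sqrt (fine (\int[mu]_x (kappa x * g x ^+ 2)%:E))) ^+ 2 <=
   fine (\int[mu]_x (kappa x * (f x - g x) ^+ 2)%:E))%R.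
Proof.
have sq01 (h : T -> R) : (forall x, 0 <= h x <= 1)%R -> (forall x, 0 <= h x ^+ 2 <= 1)%R.
  by move=> h01 x; rewrite sqr_ge0 exprn_ile1//; case/andP: (h01 x).
have dif01 x : (0 <= (f x - g x) ^+ 2 <= 1)%R.
  rewrite sqr_ge0/= -[leRHS](expr1n _ 2) -ler_sqrt ?expr1n ?ltr01// sqrtr_sqr sqrtr1.
  by case/andP: (f01 x) => ? ?; case/andP: (g01 x) => ? ?; rewrite ler_norml; lra.
have ms (h : T -> R) : measurable_fun setT h -> measurable_fun setT (fun x => h x ^+ 2)%R.
  by move=> mh; exact: measurable_funX.
have md : measurable_fun setT (fun x => (f x - g x) ^+ 2)%R by apply: ms; exact: measurable_funB.
have Ff := weighted_lty (ms _ mf) (sq01 _ f01).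
have Fg := weighted_lty (ms _ mg) (sq01 _ g01).
have Fd := weighted_lty md dif01.
have nn (h : T -> R) x : 0%R <= (kappa x * h x ^+ 2)%:E.
  by rewrite lee_fin mulr_ge0// sqr_ge0.
have mm (h : T -> R) : measurable_fun setT h -> measurable_fun setT (fun x => (kappa x * h x ^+ 2)%:E).
  by move=> mh; apply/measurable_EFinP; apply: measurable_funM => //; exact: ms.
have Ifn (h : T -> R) : 0 <= \int[mu]_x (kappa x * h x ^+ 2)%:E by exact: integral_ge0.
apply: sqrt_diff_sqr_le; [exact: fine_ge0|exact: fine_ge0|].
move=> t t0; rewrite -lee_fin !EFinD.
rewrite [(_ / t)%R]mulrC !EFinM !fineK//.
have tv0 : (0 <= t^-1)%R by rewrite invr_ge0 ltW.
have t0' := ltW t0.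
have t0e : 0%R <= t%:E by rewrite lee_fin.
have tve : 0%R <= (t^-1)%:E by rewrite lee_fin.
have mfg : measurable_fun setT (fun x => f x - g x)%R by exact: measurable_funB.
have nt (c : R) (h : T -> R) x : (0 <= c)%R -> 0 <= c%:E * (kappa x * h x ^+ 2)%:E.
  by move=> c0; rewrite mule_ge0// lee_fin.
have mt (c : R) (h : T -> R) : measurable_fun setT h -> measurable_fun setT (fun x => c%:E * (kappa x * h x ^+ 2)%:E).
  by move=> mh; apply: measurable_funeM; exact: mm.
rewrite -(ge0_integralZl mu measurableT (mm _ mf) (fun x _ => nn f x) t0e).
rewrite -(ge0_integralZl mu measurableT (mm _ mg) (fun x _ => nn g x) tve).
rewrite -(ge0_integralD mu measurableT (fun x _ => nn f x) (mm _ mf) (fun x _ => nn g x) (mm _ mg)).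
rewrite -(ge0_integralD mu measurableT (fun x _ => nn (fun x => f x - g x)%R x) (mm _ mfg)
   (fun x _ => nt t f x t0') (mt t _ mf)).
rewrite -(ge0_integralD mu measurableT (fun x _ => adde_ge0 (nn (fun x => f x - g x)%R x) (nt t f x t0'))
   (emeasurable_funD (mm _ mfg) (mt t _ mf)) (fun x _ => nt _ g x tv0) (mt _ _ mg)).
apply: ge0_le_integral => //.
- by move=> x _; apply: adde_ge0.
- by apply: emeasurable_funD; apply: mm.
- by apply: emeasurable_funD; [apply: emeasurable_funD; [exact: mm|exact: mt]|exact: mt].
move=> x _; rewrite -!EFinM -!EFinD lee_fin.
have -> : (kappa x * (f x - g x) ^+ 2 + t * (kappa x * f x ^+ 2) + t^-1 * (kappa x * g x ^+ 2) =
  kappa x * f x ^+ 2 + kappa x * g x ^+ 2 + kappa x * (t * (f x - t^-1 * g x) ^+ 2))%R.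
  by field; rewrite gt_eqF.
by rewrite lerDl mulr_ge0// mulr_ge0// sqr_ge0.
Qed.

End reverse_minkowski.

(** * Strong spatial mixing *)

Local Open Scope ereal_scope.

Lemma ler_dist01 (R : realType) (u v : R) : (0 <= u <= 1 -> 0 <= v <= 1 -> `|u - v| <= 1)%R.
Proof. by move=> /andP[? ?] /andP[? ?]; rewrite ler_norml; apply/andP; split; lra. Qed.

Section pair_potential.
Variables (R : realType) (d : nat) (phi : pt R d -> \bar R) (r : R).
Hypothesis d_gt0 : (0 < d)%N.
Hypothesis mphi : borel_efun phi.
Hypothesis phi0 : forall x, 0 <= phi x.
Hypothesis phiN : forall x, phi (- x)%R = phi x.
Hypothesis r0 : (0 <= r)%R.
Hypothesis phir : forall x, (r < enorm x)%R -> phi x = 0.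

Local Notation P := (ptT R d).
Local Notation mu := (lebd R d).

Definition ek (x : pt R d) : R := fine (expeR (- phi x)).
Definition kk (x y : P) : R := ek (x - y)%R.

Lemma ekE x : expeR (- phi x) = (ek x)%:E.
Proof. by rewrite /ek; case: (phi x) (phi0 x). Qed.

Lemma ek01 x : (0 <= ek x <= 1)%R.
Proof.
rewrite -!lee_fin -ekE expeR_ge0/=; case: (phi x) (phi0 x) => //= t; rewrite !lee_fin => t0.
by rewrite -expR0 ler_expR oppr_le0.
Qed.

Lemma ek_far x : (r < enorm x)%R -> ek x = 1%R.
Proof. by move=> /phir h; rewrite /ek h oppe0 /= expR0. Qed.

Lemma measurable_ek : measurable_fun setT (ek : P -> R).
Proof.
have mp : measurable_fun setT (phi : P -> \bar R).
  by move=> _ B mB; rewrite setTI; exact: mphi.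
rewrite (_ : (ek : P -> R) = fun x : P => if phi x == +oo then 0%R else expR (- fine (phi x))).
  apply: measurable_fun_ifT.
  - apply: (measurable_fun_bool true); rewrite setTI.
    have := mp measurableT [set +oo] (emeasurable_set1 +oo); rewrite setTI; congr measurable.
    by apply/seteqP; split=> x /=; [move=> ->; rewrite eqxx|move=> /eqP].
  - exact: measurable_cst.
  - apply: measurableT_comp; first exact: measurable_expR.
    by apply: measurable_funN; apply: measurableT_comp => //; exact: fine_measurable.
by apply/funext => x; rewrite /ek; case: (phi x) (phi0 x).
Qed.

Lemma measurable_kk : measurable_fun setT (fun q : P * P => kk q.1 q.2).
Proof.
apply: (measurableT_comp measurable_ek).
by apply: measurable_pt_sub; [exact: measurable_fst|exact: measurable_snd].
Qed.

Lemma measurable_kk1 v : measurable_fun setT (fun w : P => kk v w).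
Proof.
exact: (measurable_comp2 measurable_kk (@measurable_cst _ _ P P setT v) (@measurable_id _ P setT)).
Qed.

Lemma kk01 x y : (0 <= kk x y <= 1)%R. Proof. exact: ek01. Qed.

Lemma kkC x y : kk x y = kk y x.
Proof. by rewrite /kk /ek -phiN opprB. Qed.

Lemma kk_far x y : (r < enorm (x - y)%R)%R -> kk x y = 1%R.
Proof. exact: ek_far. Qed.

Lemma pairfun_kk : pairfun kk.
Proof. by split; [exact: measurable_kk|exact: kk01|exact: kkC]. Qed.

Let dist (v x : P) : R := enorm (x - v)%R.

Lemma measurable_dist1 v : measurable_fun setT (dist v).
Proof. by apply: measurable_dist; [exact: measurable_id|exact: measurable_cst]. Qed.

Lemma dist_null v c : mu [set x | dist v x = c] = 0.
Proof. exact: lebd_sphere. Qed.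

Lemma dist_ge0 v x : (0 <= dist v x)%R. Proof. exact: enorm_ge0. Qed.

Definition nxt (v w : P) (a : P -> R) (x : P) : R :=
  if (enorm (x - v)%R < enorm (w - v)%R)%R then (a x * kk v x)%R else a x.

Lemma nxtE v w a : nxt v w a = lamt (dist v) a (fun x => a x * kk v x)%R (dist v w).
Proof. by []. Qed.

Lemma measurable_nxt_param dQ (Q : measurableType dQ) (a : Q -> P -> R) (v w : Q -> P) :
  measurable_fun setT (fun q : Q * P => a q.1 q.2) ->
  measurable_fun setT v -> measurable_fun setT w ->
  measurable_fun setT (fun q : Q * P => nxt (v q.1) (w q.1) (a q.1) q.2).
Proof.
move=> ma mv mw.
have mv1 := measurableT_comp mv (@measurable_fst _ _ Q P).
have mw1 := measurableT_comp mw (@measurable_fst _ _ Q P).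
apply: measurable_fun_ifT => //.
  by apply: measurable_fun_ltr; apply: measurable_dist => //; exact: measurable_snd.
apply: measurable_funM => //.
exact: (measurable_comp2 measurable_kk mv1 (@measurable_snd _ _ Q P)).
Qed.

Lemma nxt_ge0 v w a x : (forall x, 0 <= a x)%R -> (0 <= nxt v w a x)%R.
Proof. by move=> a0; rewrite /nxt; case: ifP => _ //; rewrite mulr_ge0//; case/andP: (kk01 v x). Qed.

Lemma nxt_le v w a x : (forall x, 0 <= a x)%R -> (nxt v w a x <= a x)%R.
Proof. by move=> a0; rewrite /nxt; case: ifP => _ //; rewrite ler_piMr//; case/andP: (kk01 v x). Qed.

Let act_a a v : act mu a -> act mu (fun x => a x * kk v x)%R.
Proof. exact: (act_k pairfun_kk). Qed.

Let ak_le a v : act mu a -> forall x, (a x * kk v x <= a x)%R.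
Proof. by move=> [_ a0 _] x; rewrite ler_piMr//; case/andP: (kk01 v x). Qed.

Lemma act_nxt v w a : act mu a -> act mu (nxt v w a).
Proof.
move=> aa; rewrite nxtE; apply: (act_lamt (measurable_dist1 v) aa (act_a v aa)).
exact: ak_le.
Qed.

Definition ins a v : R := insp mu kk a v.

Lemma ins_gt0 a v : act mu a -> (0 < ins a v)%R.
Proof. by move=> aa; exact: (insp_gt0 pairfun_kk). Qed.

Lemma ins_le1 a v : act mu a -> (ins a v <= 1)%R.
Proof. by move=> aa; exact: (insp_le1 pairfun_kk). Qed.

Definition fexp a v := \int[mu]_w (a w * (1 - kk v w) * ins (nxt v w a) w)%:E.

Lemma measurable_ins_nxt v a : act mu a -> measurable_fun setT (fun w : P => ins (nxt v w a) w).
Proof.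
move=> aa; have := measurable_interp_insp (measurable_dist1 v) pairfun_kk aa (act_a v aa) (ak_le v aa).
by [].
Qed.

(** [Zr_interpolation] from a to a k_v with the distance to v as level: the level sets are spheres,
    hence null, and [nxt v w a] is the activity reached at the level of w. *)
Lemma ins_expR a v : act mu a -> ins a v = expR (- fine (fexp a v)).
Proof.
move=> aa; have := Zr_interpolation (measurable_dist1 v) (dist_null v) (dist_ge0 v)
  pairfun_kk aa (act_a v aa) (ak_le v aa).
set E := fine _; have -> : E = fine (fexp a v).
  rewrite /E; congr fine; apply: eq_integral => w _; congr EFin.
  by rewrite /interp_density -nxtE mulrBr mulr1.
have Z0 : (0 < Zr mu kk (fun x => a x * kk v x))%R by exact: (Zr_gt0 pairfun_kk (act_a v aa)).
rewrite /ins /insp => ->; rewrite invfM mulrA divff ?gt_eqF// mul1r expRN//.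
Qed.

Definition sq a v : R := Num.sqrt (ins a v).

Lemma sq01 a v : act mu a -> (0 <= sq a v <= 1)%R.
Proof.
move=> aa; rewrite sqrtr_ge0/= -sqrtr1 ler_sqrt ?ltr01//; exact: ins_le1.
Qed.

Lemma sq2 a v : act mu a -> (sq a v ^+ 2 = ins a v)%R.
Proof. by move=> aa; rewrite sqr_sqrtr// ltW// ins_gt0. Qed.

Lemma measurable_sq_nxt v a : act mu a -> measurable_fun setT (fun w : P => sq (nxt v w a) w).
Proof.
move=> aa; rewrite (_ : (fun _ => _) = fun w : P => powR (ins (nxt v w a) w) (2^-1)%R).
  exact: (measurableT_comp (@measurable_powR R (2^-1)%R) (measurable_ins_nxt v aa)).
by apply/funext => w; rewrite powR12_sqrt// ltW// ins_gt0//; exact: act_nxt.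
Qed.

(* With F the exponent in [ins_expR], sq a v = exp (- sqrt F ^ 2 / 2) is
   e^(-1/2)-Lipschitz in sqrt F, and sqrt F is an L2 norm of the next-level sq. *)
Lemma ssm_step a a' v : act mu a -> act mu a' ->
  (forall x, enorm (x - v)%R <= r -> a x = a' x)%R ->
  ((sq a v - sq a' v) ^+ 2)%:E <=
  (expR (-1))%:E * \int[mu]_w (a w * (1 - kk v w) * (sq (nxt v w a) w - sq (nxt v w a') w) ^+ 2)%:E.
Proof.
move=> aa aa' agree; have [ma a0 ia] := aa; have [ma' a0' ia'] := aa'.
pose ka w := (a w * (1 - kk v w))%R.
(* The factor 1 - k_v vanishes beyond the range r, so both exponents are integrals against one and
   the same weight. *)
have kaE w : ka w = (a' w * (1 - kk v w))%R.
  have [h|h] := leP (enorm (w - v)%R) r; first by rewrite /ka agree.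
  by rewrite /ka kk_far ?subrr ?mulr0// enormB.
have mka : measurable_fun setT ka.
  apply: measurable_funM => //; apply: measurable_funB => //.
  exact: measurable_kk1.
have ka0 w : (0 <= ka w)%R.
  by rewrite mulr_ge0// subr_ge0; case/andP: (kk01 v w).
have ika : \int[mu]_w (ka w)%:E < +oo.
  apply: le_lt_trans ia; apply: ge0_le_integral => //.
  - by move=> w _; rewrite lee_fin.
  - exact/measurable_EFinP.
  - exact/measurable_EFinP.
  - by move=> w _; rewrite lee_fin ler_piMr// gerBl; case/andP: (kk01 v w).
have [X [Y [E1 E2 rm]]] : exists X Y, [/\ X = fine (fexp a v), Y = fine (fexp a' v) &
   ((Num.sqrt X - Num.sqrt Y) ^+ 2 <=
    fine (\int[mu]_w (ka w * (sq (nxt v w a) w - sq (nxt v w a') w) ^+ 2)%:E))%R].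
  exists (fine (\int[mu]_w (ka w * sq (nxt v w a) w ^+ 2)%:E)),
    (fine (\int[mu]_w (ka w * sq (nxt v w a') w ^+ 2)%:E)); split.
  - by congr fine; apply: eq_integral => w _; rewrite sq2//; exact: act_nxt.
  - by congr fine; apply: eq_integral => w _; rewrite sq2 ?kaE//; exact: act_nxt.
  - exact: (reverse_minkowski2 mka (measurable_sq_nxt v aa) (measurable_sq_nxt v aa') ka0 ika
      (fun w => sq01 w (act_nxt v w aa)) (fun w => sq01 w (act_nxt v w aa'))).
have dfin : \int[mu]_w (ka w * (sq (nxt v w a) w - sq (nxt v w a') w) ^+ 2)%:E \is a fin_num.
  apply: (weighted_lty mka ka0 ika).
    apply: measurable_funX; apply: measurable_funB; exact: measurable_sq_nxt.
  move=> w; rewrite sqr_ge0/= -[leRHS](expr1n _ 2) -ler_sqrt ?expr1n ?ltr01// sqrtr_sqr sqrtr1.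
  by apply: ler_dist01; apply: sq01; exact: act_nxt.
rewrite -(fineK dfin) -EFinM lee_fin.
have fexp0 b : act mu b -> (0 <= fine (fexp b v))%R.
  move=> [mb b0 ib]; apply: fine_ge0; apply: integral_ge0 => w _; rewrite lee_fin mulr_ge0//.
    by rewrite mulr_ge0// subr_ge0; case/andP: (kk01 v w).
  by apply: ltW; apply: ins_gt0; exact: act_nxt.
have sqE b : act mu b -> sq b v = expR (- (Num.sqrt (fine (fexp b v)) ^+ 2 / 2)).
  move=> ab; rewrite /sq ins_expR// sqr_sqrtr ?fexp0//.
  rewrite [in LHS](_ : - fine (fexp b v) = 2%:R * (- (fine (fexp b v) / 2)))%R; last by field.
  by rewrite expRM_natl sqrtr_sqr ger0_norm// expR_ge0.
rewrite !sqE//; apply: le_trans (gauss_lipschitz _ _) _.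
rewrite ler_wpM2l ?expR_ge0//.
rewrite -E1 -E2; exact: rm.
Qed.

End pair_potential.

(** * Path expansion of the connective constant *)

Section connective_constant.
Variables (R : realType) (d : nat) (phi : pt R d -> \bar R) (r : R).
Hypothesis d_gt0 : (0 < d)%N.
Hypothesis mphi : borel_efun phi.
Hypothesis phi0 : forall x, 0 <= phi x.
Hypothesis phiN : forall x, phi (- x)%R = phi x.
Hypothesis r0 : (0 <= r)%R.
Hypothesis phir : forall x, (r < enorm x)%R -> phi x = 0.

Local Notation P := (ptT R d).
Local Notation mu := (lebd R d).
Local Notation kp := (kk phi).
Local Notation nxtp := (nxt phi).
Local Notation sqp := (sq phi).

Let mkk := measurable_kk mphi phi0.

(** V_k as a recursion in which the weight u seen by the rest of the path is updated by [nxt].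
    [Vk_Vg] identifies the case u = 1, v = 0; other u arise in the induction over levels. *)
Fixpoint Vg (k : nat) (u : P -> R) (v : P) : \bar R :=
  if k is k'.+1 then \int[mu]_w ((u w * (1 - kp v w))%:E * Vg k' (nxtp v w u) w) else 1.

Lemma Vg_ge0 k (u : P -> R) v : (forall x, 0 <= u x)%R -> 0 <= Vg k u v.
Proof.
elim: k u v => [//|k ih] u v u0 /=; apply: integral_ge0 => w _; rewrite mule_ge0//.
  by rewrite lee_fin mulr_ge0// subr_ge0; case/andP: (kk01 phi0 v w).
by apply: ih => x; exact: nxt_ge0.
Qed.

Lemma measurable_Vg_param k dQ (Q : measurableType dQ) (u : Q -> P -> R) (v : Q -> P) :
  (forall q x, 0 <= u q x)%R ->
  measurable_fun setT (fun q : Q * P => u q.1 q.2) -> measurable_fun setT v ->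
  measurable_fun setT (fun q : Q => Vg k (u q) (v q)).
Proof.
elim: k dQ Q u v => [|k ih] dQ Q u v u0 mu_ mv /=; first exact: measurable_cst.
have mv1 := measurableT_comp mv (@measurable_fst _ _ Q P).
have k1 (x y : P) : (0 <= 1 - kp x y)%R by rewrite subr_ge0; case/andP: (kk01 phi0 x y).
apply: (measurable_integral_sfinite mu (f := fun q : Q * P =>
   (u q.1 q.2 * (1 - kp (v q.1) q.2))%:E * Vg k (nxtp (v q.1) q.2 (u q.1)) q.2)).
  move=> q; apply: mule_ge0; first by rewrite lee_fin mulr_ge0.
  by apply: Vg_ge0 => x; exact: nxt_ge0.
apply: emeasurable_funM.
  apply/measurable_EFinP; apply: measurable_funM => //; apply: measurable_funB => //.
  exact: (measurable_comp2 mkk mv1 (@measurable_snd _ _ Q P)).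
apply: (ih _ (Q * P)%type (fun q => nxtp (v q.1) q.2 (u q.1))).
- by move=> q x; exact: nxt_ge0.
- apply: (measurable_nxt_param mphi phi0 (Q := (Q * P)%type) (a := fun q => u q.1)
    (v := fun q => v q.1) (w := snd)) => //.
  apply: (measurable_comp2 mu_ (f := fun q : Q * P * P => q.1.1)); last exact: measurable_snd.
  exact: (measurableT_comp measurable_fst measurable_fst).
- exact: measurable_snd.
Qed.

Lemma measurable_Vg_next k (u : P -> R) (v : P) : (forall x, 0 <= u x)%R -> measurable_fun setT u ->
  measurable_fun setT (fun w : P => Vg k (nxtp v w u) w).
Proof.
move=> u0 mu_; apply: (measurable_Vg_param k (u := fun w => nxtp v w u)).
- by move=> q x; exact: nxt_ge0.
- apply: (measurable_nxt_param mphi phi0 (Q := P) (a := fun=> u) (v := fun=> v) (w := id)) => //.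
  exact: (measurableT_comp mu_ (@measurable_snd _ _ P P)).
- exact: measurable_id.
Qed.

Lemma nxt_comp_shift (h v w : P) (u : P -> R) :
  (nxtp (v + h) (w + h) u \o (fun x => x + h))%R = nxtp v w (fun x => u (x + h)%R).
Proof.
apply/funext => x; rewrite /= /nxt /kk.
have e (y z : P) : (y + h - (z + h) = y - z)%R by rewrite opprD addrACA subrr addr0.
by rewrite !e.
Qed.

Lemma Vg_shift k (u : P -> R) (v h : P) : (forall x, 0 <= u x)%R -> measurable_fun setT u ->
  Vg k u (v + h)%R = Vg k (fun x => u (x + h)%R) v.
Proof.
elim: k u v => [//|k ih] u v u0 mu_ /=.
have k1 (x y : P) : (0 <= 1 - kp x y)%R by rewrite subr_ge0; case/andP: (kk01 phi0 x y).
pose f (w : P) := (u w * (1 - kp (v + h)%R w))%:E * Vg k (nxtp (v + h)%R w u) w.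
have f0 w : 0 <= f w.
  apply: mule_ge0; first by rewrite lee_fin mulr_ge0.
  by apply: Vg_ge0 => x; exact: nxt_ge0.
have mf : measurable_fun setT f.
  apply: emeasurable_funM; last exact: measurable_Vg_next.
  apply/measurable_EFinP; apply: measurable_funM => //; apply: measurable_funB => //.
  exact: measurable_kk1.
rewrite -/(f _) (lebd_affine h ltr01 f0 mf) expr1n mul1e.
apply: eq_integral => w _; rewrite /f scale1r (addrC h).
have m' : measurable_fun setT (nxtp (v + h)%R (w + h)%R u).
  have := measurable_nxt_param mphi phi0 (Q := unit) (a := fun=> u) (measurableT_comp mu_ (@measurable_snd _ _ unit P))
    (@measurable_cst _ _ unit P setT (v + h)%R) (@measurable_cst _ _ unit P setT (w + h)%R).
  move=> h'; exact: (measurable_comp2 h' (@measurable_cst _ _ P unit setT tt) (@measurable_id _ P setT)).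
rewrite ih//; last by move=> x; exact: nxt_ge0.
rewrite -nxt_comp_shift; congr (_ * _); congr (_ * (1 - _))%:E.
by rewrite /kk; congr ek; rewrite opprD addrACA subrr addr0.
Qed.

Let one : P -> R := fun=> 1%R.

Lemma Vg_one_translate k v : Vg k one v = Vg k one 0%R.
Proof.
have := @Vg_shift k one 0%R v (fun=> ler01) (measurable_cst _).
by rewrite add0r => ->.
Qed.

(* Iterating [ssm_step]: every level contributes a factor 1/e, and the product
   of activities along a path is at most lam^k times the path weight of V_k. *)
Lemma ssm_unroll (lam B rad : R) : (0 <= lam)%R -> (0 <= B)%R -> (0 <= rad)%R ->
  (forall (a a' : P -> R) v, act mu a -> act mu a' -> (forall x, a x <= lam)%R ->
     (forall x, enorm (x - v)%R <= rad -> a x = a' x)%R -> ((sqp a v - sqp a' v) ^+ 2 <= B)%R) ->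
  forall k (u a a' : P -> R) v, (forall x, 0 <= u x <= 1)%R -> measurable_fun setT u ->
  act mu a -> act mu a' -> (forall x, a x <= lam * u x)%R ->
  (forall x, enorm (x - v)%R <= rad + k%:R * r -> a x = a' x)%R ->
  ((sqp a v - sqp a' v) ^+ 2)%:E <= (B * (lam * expR (-1)) ^+ k)%:E * Vg k u v.
Proof.
move=> lam0 B0 rad0 base; elim=> [|k ih] u a a' v u01 mu_ aa aa' au agree.
  rewrite expr0 mulr1 mule1 lee_fin; apply: base => //.
    by move=> x; rewrite (le_trans (au x))// ler_piMr//; case/andP: (u01 x).
  by move=> x h; apply: agree; rewrite mul0r addr0.
have u0 x : (0 <= u x)%R by case/andP: (u01 x).
have k1 (x y : P) : (0 <= 1 - kp x y)%R by rewrite subr_ge0; case/andP: (kk01 phi0 x y).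
have [ma a0 ia] := aa.
have agree' x : (enorm (x - v)%R <= r -> a x = a' x)%R.
  move=> xr; apply: agree; apply: (le_trans xr).
  by rewrite -natr1 mulrDl mul1r addrA lerDr addr_ge0// mulr_ge0.
apply: (le_trans (ssm_step d_gt0 mphi phi0 phiN phir aa aa' agree')).
set c := (B * (lam * expR (-1)) ^+ k)%R.
have c0 : (0 <= c)%R by rewrite mulr_ge0// exprn_ge0// mulr_ge0// expR_ge0.
pose f (w : P) := (u w * (1 - kp v w))%:E * Vg k (nxtp v w u) w.
have f0 w : 0 <= f w.
  apply: mule_ge0; first by rewrite lee_fin mulr_ge0.
  by apply: Vg_ge0 => x; exact: nxt_ge0.
have mu1 : measurable_fun setT (fun w => 1 - kp v w)%R.
  by apply: measurable_funB => //; exact: measurable_kk1.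
have mf : measurable_fun setT f.
  apply: emeasurable_funM; last exact: measurable_Vg_next.
  by apply/measurable_EFinP; exact: measurable_funM.
have lc0 : 0%R <= (lam * c)%:E by rewrite lee_fin mulr_ge0.
apply: (@le_trans _ _ ((expR (-1))%:E * \int[mu]_w ((lam * c)%:E * f w))).
  rewrite lee_pmul2l ?lte_fin ?expR_gt0//.
  apply: ge0_le_integral => //.
  - by move=> w _; rewrite lee_fin mulr_ge0 ?sqr_ge0// mulr_ge0.
  - apply/measurable_EFinP; apply: measurable_funM; first exact: measurable_funM.
    by apply: measurable_funX; apply: measurable_funB; apply: measurable_sq_nxt.
  - exact: measurable_funeM.
  (* Beyond the range both sides vanish. Within it the induction hypothesis applies at w, since the
     ball about v is larger than the one required about w by r. *)
  - move=> w _; have [wr|rw] := leP (enorm (w - v)%R) r; last first.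
      rewrite /f (kk_far phir) ?subrr ?mulr0 ?mul0r ?mul0e ?mule0//.
      by rewrite enormB.
    have nu01 x : (0 <= nxtp v w u x <= 1)%R.
      rewrite nxt_ge0//=; apply: le_trans (nxt_le _ _ _ _ _) _ => //.
      by case/andP: (u01 x).
    have h : ((sqp (nxtp v w a) w - sqp (nxtp v w a') w) ^+ 2)%:E <= c%:E * Vg k (nxtp v w u) w.
      apply: ih => //.
      + apply: (measurable_comp2 (measurable_nxt_param mphi phi0 (Q := unit) (a := fun=> u)
          (v := fun=> v) (w := fun=> w) (measurableT_comp mu_ (@measurable_snd _ _ unit P)) (measurable_cst _) (measurable_cst _))
          (@measurable_cst _ _ P unit setT tt) (@measurable_id _ P setT)).
      + exact: act_nxt.
      + exact: act_nxt.
      + move=> x; rewrite /nxt; case: ifP => _ //; rewrite mulrA ler_wpM2r//.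
        by case/andP: (kk01 phi0 v x).
      + move=> x xw; have e : a x = a' x.
          apply: agree; apply: le_trans (enorm_triangle x w v) _.
          by rewrite -natr1 mulrDl mul1r addrA lerD.
        by rewrite /nxt e.
    rewrite EFinM.
    apply: (@le_trans _ _ ((lam * (u w * (1 - kp v w)))%:E * (c%:E * Vg k (nxtp v w u) w))).
      apply: lee_pmul => //.
      * by rewrite lee_fin mulr_ge0.
      * by rewrite lee_fin sqr_ge0.
      * by rewrite lee_fin mulrA ler_wpM2r.
    rewrite /f !muleA -!EFinM le_eqVlt; apply/orP; left; apply/eqP; congr (_%:E * _); ring.
rewrite (ge0_integralZl mu measurableT mf (fun w _ => f0 w) lc0) muleA -EFinM.
rewrite le_eqVlt; apply/orP; left; apply/eqP; congr (_%:E * _).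
by rewrite /c exprS; ring.
Qed.

(** The integrand of [Vg] as a function of the whole path, linking the nested integrals of [Vg] to
    the integral over lists that defines [Vk]. *)
Fixpoint path_weight (u : P -> R) (v : P) (s : lst P) : R :=
  if s is w :: s' then (u w * (1 - kp v w) * path_weight (nxtp v w u) w s')%R else 1%R.

Lemma path_weight_ge0 (u : P -> R) v s : (forall x, 0 <= u x)%R -> (0 <= path_weight u v s)%R.
Proof.
elim: s u v => //= w s ih u v u0; rewrite mulr_ge0//.
  by rewrite mulr_ge0// subr_ge0; case/andP: (kk01 phi0 v w).
by apply: ih => x; exact: nxt_ge0.
Qed.

Lemma measurable_path_weight_param dQ (Q : measurableType dQ) (u : Q -> P -> R) (v : Q -> P) :
  measurable_fun setT (fun q : Q * P => u q.1 q.2) -> measurable_fun setT v ->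
  measurable_fun setT (fun q : Q * lst P => path_weight (u q.1) (v q.1) q.2).
Proof.
move=> mu_ mv; apply: lst_recursion => k.
elim: k dQ Q u v mu_ mv => [|k ih] dQ Q u v mu_ mv; first by apply: lst_rec0; exact: measurable_cst.
apply: lst_recS => /=; apply: measurable_funM.
  have h : measurable_fun setT (fun q : Q * P => u q.1 q.2 * (1 - kp (v q.1) q.2))%R.
    apply: measurable_funM => //; apply: measurable_funB => //.
    exact: (measurable_comp2 mkk (measurableT_comp mv (@measurable_fst _ _ Q P)) (@measurable_snd _ _ Q P)).
  by apply: measurable_funTS; exact: (measurableT_comp h (@measurable_fst _ _ (Q * P)%type (lst P))).
apply: (ih _ (Q * P)%type (fun q => nxtp (v q.1) q.2 (u q.1)) snd).
- apply: (measurable_nxt_param mphi phi0 (Q := (Q * P)%type) (a := fun q => u q.1)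
    (v := fun q => v q.1) (w := snd)) => //.
    apply: (measurable_comp2 mu_ (f := fun q : Q * P * P => q.1.1)); last exact: measurable_snd.
    exact: (measurableT_comp measurable_fst measurable_fst).
  exact: (measurableT_comp mv measurable_fst).
- exact: measurable_snd.
Qed.

Lemma measurable_path_weight (u : P -> R) v : measurable_fun setT u ->
  measurable_fun setT (fun s : lst P => (path_weight u v s)%:E).
Proof.
move=> mu_; apply/measurable_EFinP.
have h := measurable_path_weight_param (Q := unit) (u := fun=> u) (v := fun=> v)
   (measurableT_comp mu_ (@measurable_snd _ _ unit P)) (measurable_cst _).
exact: (measurable_comp2 h (@measurable_cst _ _ (lst P) unit setT tt) (@measurable_id _ (lst P) setT)).
Qed.

Lemma measurable_nxt (u : P -> R) v w : measurable_fun setT u -> measurable_fun setT (nxtp v w u).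
Proof.
move=> mu_.
exact: (measurable_comp2 (measurable_nxt_param mphi phi0 (Q := unit) (a := fun=> u)
          (v := fun=> v) (w := fun=> w) (measurableT_comp mu_ (@measurable_snd _ _ unit P)) (measurable_cst _) (measurable_cst _))
          (@measurable_cst _ _ P unit setT tt) (@measurable_id _ P setT)).
Qed.

Lemma integral_path_weight k (u : P -> R) v : (forall x, 0 <= u x)%R -> measurable_fun setT u ->
  \int[lpow mu k]_s (path_weight u v s)%:E = Vg k u v.
Proof.
elim: k u v => [|k ih] u v u0 mu_.
  by rewrite integral_lpow0//; exact: measurable_path_weight.
have p0 s : 0%R <= (path_weight u v s)%:E by rewrite lee_fin path_weight_ge0.
rewrite [LHS](integral_lpowS mu k p0 (measurable_path_weight v mu_)) /=.
apply: eq_integral => w _.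
have n0 x : (0 <= nxtp v w u x)%R by exact: nxt_ge0.
have c0 : 0%R <= (u w * (1 - kp v w))%:E.
  by rewrite lee_fin mulr_ge0// subr_ge0; case/andP: (kk01 phi0 v w).
have mn := measurable_nxt v w mu_.
have q0 s : 0%R <= (path_weight (nxtp v w u) w s)%:E by rewrite lee_fin path_weight_ge0.
rewrite -(ih _ w n0 mn) -(ge0_integralZl (lpow mu k) measurableT (measurable_path_weight w mn) (fun s _ => q0 s) c0).
by apply: eq_integral => s _; rewrite /= EFinM.
Qed.

Lemma eq_int_conf k (F G : lst P -> \bar R) : (forall s, size s = k -> F s = G s) ->
  int_conf k F = int_conf k G.
Proof.
elim: k F G => [|k ih] F G FG /=; first exact: FG.
by congr int_pt; apply/funext => x; apply: ih => s sk; apply: FG; rewrite /= sk.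
Qed.

Lemma expeRN_sum (I : Type) (l : seq I) (f : I -> \bar R) : (forall i, 0 <= f i) ->
  expeR (- \sum_(i <- l) f i) = \prod_(i <- l) expeR (- f i).
Proof.
move=> f0; elim: l => [|i l ih]; first by rewrite !big_nil oppe0 expeR0.
rewrite !big_cons oppeD ?expeRD ?ih//.
by apply: ge0_adde_def; rewrite inE// sume_ge0.
Qed.

(** The update made at v_i acts on v_j exactly when |v_j - v_i| < |v_i - v_{i+1}|, so the updates at
    v_0, ..., v_{j-2} together multiply the weight at v_j by the exponential factor of V_k. *)
Lemma Vk_Vg k : Vk phi k = Vg k one 0%R.
Proof.
have m1 : measurable_fun setT one by exact: measurable_cst.
rewrite -(integral_path_weight k 0%R (fun=> ler01) m1) -int_confE; last 2 first.
- by move=> s; rewrite lee_fin path_weight_ge0.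
- exact: measurable_path_weight.
apply: eq_int_conf => s sk /=.
pose v (i : nat) : P := nth 0%R (0%R :: s) i.
pose cut (i : nat) (x : P) : R := if (enorm (x - v i)%R < enorm (v i.+1 - v i)%R)%R then kp (v i) x else 1%R.
pose uj (j : nat) (x : P) : R := (\prod_(0 <= i < j) cut i x)%R.
have nxtuj j : nxtp (v j) (v j.+1) (uj j) = uj j.+1.
  apply/funext => x; rewrite /uj big_nat_recr//= /cut /nxt.
  by case: ifP => _; rewrite ?mulr1.
(* The induction on the length l has to start at an arbitrary position m, where the weight is
   already [uj m]. *)
have claim l m : path_weight (uj m) (v m) [seq v (m.+1 + i)%N | i <- iota 0 l] =
    (\prod_(m.+1 <= j < (m + l).+1) (uj j.-1 (v j) * (1 - kp (v j.-1) (v j))))%R.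
  elim: l m => [|l ih] m; first by rewrite addn0 big_geq.
  have -> : (m + l.+1 = m.+1 + l)%N by rewrite addSnnS.
  rewrite [RHS]big_ltn ?ltnS ?leq_addr// -ih /= addn0 nxtuj; congr (_ * _)%R.
  rewrite (iotaDl 1 0) -map_comp; congr path_weight; apply: eq_map => i /=.
  by congr v; rewrite add1n addnS addSn.
have -> : path_weight one 0%R s = path_weight (uj 0%N) (v 0%N) [seq v (1 + i)%N | i <- iota 0 k].
  congr path_weight.
  - by apply/funext => x; rewrite /uj big_geq.
  - by rewrite -{1}(mkseq_nth 0%R s) sk /mkseq; apply: eq_map => i.
rewrite claim add0n -prodEFin; apply: eq_bigr => j _; rewrite EFinM EFinB.
rewrite {1}/kk -ekE// -[in RHS]phiN opprB; congr (_ * _).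
rewrite expeRN_sum; last first.
  by move=> i; rewrite mule_ge0.
rewrite /uj -prodEFin; apply: eq_bigr => i _.
rewrite /cut (enormB (v i.+1)) -[nth _ s i]/(v i.+1) -[nth _ (0%R :: s) j]/(v j).
case: (_ < _)%R; last by rewrite mul0e oppe0 expeR0.
by rewrite mul1e -phiN opprB ekE.
Qed.

End connective_constant.

(** * Exponential decay of influence *)

Section strong_spatial_mixing.
Variables (R : realType) (d : nat) (phi : pt R d -> \bar R) (r lam : R).
Hypothesis d_gt0 : (0 < d)%N.
Hypothesis mphi : borel_efun phi.
Hypothesis phi0 : forall x, 0 <= phi x.
Hypothesis phiN : forall x, phi (- x)%R = phi x.
Hypothesis r0 : (0 <= r)%R.
Hypothesis phir : forall x, (r < enorm x)%R -> phi x = 0.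
Hypothesis lam0 : (0 <= lam)%R.
Hypothesis subcritical : lam%:E * Delta_phi phi < (expR 1)%:E.

Local Notation mu := (lebd R d).

Lemma Vk_ge0 k : 0 <= Vk phi k.
Proof. by rewrite (Vk_Vg mphi phi0 phiN) Vg_ge0. Qed.

(** [Delta_phi] is an infimum, so some k satisfies V_k^(1/k) < e / lam, that is (lam / e)^k V_k < 1.
    [theta] is a square root because k levels contract squared differences by this number. *)
Lemma contraction_rate : exists k (theta : R), [/\ (0 < k)%N, (0 <= theta < 1)%R &
  ((lam * expR (-1)) ^+ k)%:E * Vk phi k <= (theta ^+ 2)%:E].
Proof.
(* The quotient e / lam below requires lam > 0; for lam = 0 the left side is already 0 at k = 1. *)
have [lam00|lamn0] := eqVneq lam 0%R.
  by exists 1%N, 0%R; split => //; rewrite ?lexx ?ltr01// lam00 mul0r expr1 mul0e expr0n.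
have lamp : (0 < lam)%R by rewrite lt_neqAle eq_sym lamn0.
pose c := (expR 1 / lam)%R.
have c0 : (0 < c)%R by rewrite divr_gt0// expR_gt0.
have Dc : Delta_phi phi < c%:E.
  by rewrite /c EFinM muleC lte_pdivlMl// ?invr_gt0//.
have [_ [k /= k0 <-] Vc] := ereal_inf_lt Dc.
have kn0 : (k%:R^-1 != 0 :> R)%R by rewrite invr_neq0// pnatr_eq0 -lt0n.
have Vfin : Vk phi k \is a fin_num.
  rewrite ge0_fin_numE ?Vk_ge0//; apply: (lty_poweRy kn0).
  exact: lt_trans Vc (ltry _).
pose x := fine (Vk phi k); have xE : Vk phi k = x%:E by rewrite fineK.
have x0 : (0 <= x)%R by rewrite -lee_fin -xE Vk_ge0.
have xc : (x < c ^+ k)%R.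
  move: Vc; rewrite xE poweR_EFin lte_fin => h.
  have -> : x = ((powR x (k%:R^-1)) ^+ k)%R.
    by rewrite -powR_mulrn ?powR_ge0// -powRrM mulVf ?powRr1// pnatr_eq0 -lt0n.
  by rewrite ltrXn2r// ?powR_ge0// -lt0n.
pose th2 := ((lam * expR (-1)) ^+ k * x)%R.
have le0 : (0 < lam * expR (-1))%R by rewrite mulr_gt0// expR_gt0.
have th0 : (0 <= th2)%R by rewrite mulr_ge0// exprn_ge0// ltW.
have th1 : (th2 < 1)%R.
  have -> : 1%R = ((lam * expR (-1)) ^+ k * c ^+ k)%R :> R.
    rewrite -exprMn /c [X in (X ^+ _)%R](_ : _ = 1)%R ?expr1n//.
    by rewrite expRN; field; rewrite lamn0 gt_eqF ?expR_gt0.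
  by rewrite ltr_pM2l// exprn_gt0.
exists k, (Num.sqrt th2); split => //.
  rewrite sqrtr_ge0/= -sqrtr1 ltr_sqrt//.
by rewrite sqr_sqrtr// xE -EFinM.
Qed.

(** Each batch of k levels contracts the squared differences of [sq] by theta^2 and uses up a
    distance k r. Passing from [sq] to [ins] costs the factor 2, as |x^2 - y^2| <= 2 |x - y| on
    [0, 1]. *)
Theorem strong_spatial_mixing : exists k (theta : R), [/\ (0 < k)%N, (0 <= theta < 1)%R &
  forall l (a a' : ptT R d -> R) v, act mu a -> act mu a' -> (forall x, a x <= lam)%R ->
  (forall x, enorm (x - v)%R <= l%:R * (k%:R * r) -> a x = a' x)%R ->
  (`|ins phi a v - ins phi a' v| <= 2 * theta ^+ l)%R].
Proof.
have [k [theta [k0 th01 rate]]] := contraction_rate.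
exists k, theta; split => // l a a' v aa aa' alam agree.
have /andP[th0 th1] := th01.
have key : ((sq phi a v - sq phi a' v) ^+ 2 <= (theta ^+ 2) ^+ l)%R.
  elim: l a a' v aa aa' alam agree => [|l ih] a a' v aa aa' alam agree.
    rewrite expr0 -[leRHS](expr1n _ 2) -ler_sqrt ?expr1n ?ltr01// sqrtr_sqr sqrtr1.
    case/andP: (sq01 mphi phi0 phiN v aa) => ? ?; case/andP: (sq01 mphi phi0 phiN v aa') => ? ?.
    by rewrite ler_norml; lra.
  have rad0 : (0 <= l%:R * (k%:R * r))%R by rewrite !mulr_ge0.
  have B0 : (0 <= (theta ^+ 2) ^+ l)%R by rewrite !exprn_ge0.
  have h := @ssm_unroll R d phi r d_gt0 mphi phi0 phiN r0 phir lam _ _ lam0 B0 rad0 ih k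
    (fun=> 1%R) a a' v (fun=> ltac:(by rewrite ler01 lexx)) (measurable_cst _) aa aa'.
  rewrite -lee_fin; apply: le_trans (h _ _) _.
  - by move=> x; rewrite mulr1.
  - by move=> x xv; apply: agree; apply: le_trans xv _; rewrite -natr1 mulrDl mul1r.
  rewrite (Vg_one_translate mphi phi0) -(Vk_Vg mphi phi0 phiN) EFinM -muleA.
  by rewrite [((theta ^+ 2) ^+ l.+1)%R]exprSr [X in _ <= X]EFinM lee_wpmul2l// lee_fin.
have {}key : (`|sq phi a v - sq phi a' v| <= theta ^+ l)%R.
  rewrite -sqrtr_sqr -[leRHS]ger0_norm ?exprn_ge0// -sqrtr_sqr ler_sqrt ?sqr_ge0//.
  by rewrite -exprM mulnC exprM.
rewrite -!(sq2 mphi phi0 phiN)// subr_sqr normrM mulrC ler_pM//.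
case/andP: (sq01 mphi phi0 phiN v aa) => ? ?; case/andP: (sq01 mphi phi0 phiN v aa') => ? ?.
by rewrite ger0_norm; lra.
Qed.

End strong_spatial_mixing.

(** * Conditioning and comparison of local expectations *)

Section local_expectation.
Context dT (T : measurableType dT) (R : realType) (mu : {sfinite_measure set T -> \bar R}).
Variable kp : T -> T -> R.
Hypothesis pk : pairfun kp.
Implicit Types (a : T -> R) (g h : lst T -> \bar R).

Let mk : measurable_fun setT (fun q : T * T => kp q.1 q.2). Proof. by case: pk. Qed.
Let k01 x y : (0 <= kp x y <= 1)%R. Proof. by case: pk. Qed.

Definition EE a g : \bar R :=
  (\int[poisson mu]_s (g s * (bw kp a s)%:E)) * ((Zr mu kp a)^-1)%:E.

Lemma bwe_ge0 a s : act mu a -> 0%R <= (bw kp a s)%:E.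
Proof. by move=> [_ a0 _]; rewrite lee_fin bw_ge0. Qed.

Lemma Zrinv_ge0 a : act mu a -> 0%R <= ((Zr mu kp a)^-1)%:E.
Proof. by move=> aa; rewrite lee_fin invr_ge0 ltW// Zr_gt0. Qed.

Lemma EE_ge0 a g : act mu a -> (forall s, 0 <= g s) -> 0 <= EE a g.
Proof.
move=> aa g0; apply: mule_ge0; last exact: Zrinv_ge0.
by apply: integral_ge0 => s _; rewrite mule_ge0// bwe_ge0.
Qed.

Lemma measurable_gbw a g : act mu a -> measurable_fun setT g ->
  measurable_fun setT (fun s => g s * (bw kp a s)%:E).
Proof. by move=> aa mg; apply: emeasurable_funM => //; exact: (measurable_bwE pk aa). Qed.

Lemma le_EE a g h : act mu a -> (forall s, 0 <= g s) ->
  measurable_fun setT g -> measurable_fun setT h ->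
  (forall s, bw kp a s != 0%R -> g s <= h s) -> EE a g <= EE a h.
Proof.
move=> aa g0 mg mh gh; rewrite /EE lee_wpmul2r ?Zrinv_ge0//.
apply: ge0_le_integral => //.
- by move=> s _; rewrite mule_ge0// bwe_ge0.
- exact: measurable_gbw.
- exact: measurable_gbw.
- move=> s _; have [->|n0] := eqVneq (bw kp a s) 0%R; first by rewrite !mule0.
  by rewrite lee_wpmul2r ?bwe_ge0// gh.
Qed.

Lemma EE_D a g h : act mu a -> (forall s, 0 <= g s) -> (forall s, 0 <= h s) ->
  measurable_fun setT g -> measurable_fun setT h ->
  EE a (fun s => g s + h s) = EE a g + EE a h.
Proof.
move=> aa g0 h0 mg mh; rewrite /EE.
have gb s : 0 <= g s * (bw kp a s)%:E by rewrite mule_ge0// bwe_ge0.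
have hb s : 0 <= h s * (bw kp a s)%:E by rewrite mule_ge0// bwe_ge0.
have i1 : 0 <= \int[poisson mu]_s (g s * (bw kp a s)%:E) by exact: integral_ge0.
have i2 : 0 <= \int[poisson mu]_s (h s * (bw kp a s)%:E) by exact: integral_ge0.
rewrite -(ge0_muleDl _ i1 i2); congr (_ * _).
rewrite -(ge0_integralD (poisson mu) measurableT (fun s _ => gb s) (measurable_gbw aa mg)
  (fun s _ => hb s) (measurable_gbw aa mh)).
by apply: eq_integral => s _; rewrite ge0_muleDl.
Qed.

Lemma EE_cst a (c : R) : act mu a -> (0 <= c)%R -> EE a (fun=> c%:E) = c%:E.
Proof.
move=> aa c0; rewrite /EE.
have c0' : 0%R <= c%:E by rewrite lee_fin.
rewrite (ge0_integralZl (poisson mu) measurableT (measurable_bwE pk aa) (fun s _ => bwe_ge0 s aa) c0').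
rewrite -/(Zp mu kp a) (ZpE pk aa) -!EFinM mulfK// gt_eqF// Zr_gt0//.
Qed.

Lemma EE_le_cst a g (c : R) : act mu a -> (0 <= c)%R -> (forall s, 0 <= g s) ->
  measurable_fun setT g -> (forall s, bw kp a s != 0%R -> g s <= c%:E) -> EE a g <= c%:E.
Proof.
move=> aa c0 g0 mg gc; rewrite -(EE_cst aa c0); apply: le_EE => //.
Qed.

Section conditioning.
Variable W : T -> bool.
Hypothesis mW : measurable_fun setT W.
Let B := predC W.
Let mB : measurable_fun setT B. Proof. exact: measurable_neg. Qed.

(** The activity governing the points outside [W] once the points inside [W] are known to be t. *)
Definition conditioned a (t : lst T) (x : T) : R := (a x * klist kp t x * (~~ W x)%:R)%R.

Lemma act_conditioned a t : act mu a -> act mu (conditioned a t).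
Proof.
move=> aa; have [ma a0 ia] := aa; apply: (act_le aa).
  apply: measurable_funM.
    apply: measurable_funM => //.
    exact: (measurable_comp2 (measurable_klist_param mk) (@measurable_id _ T setT) (@measurable_cst _ _ T (lst T) setT t)).
  by apply: (measurableT_comp (f := fun b : bool => b%:R%R : R)) => //.
move=> x; have k0 := klist_ge0 pk t x; have k1 := klist_le1 pk t x.
rewrite /conditioned !mulr_ge0//= -mulrA ler_piMr//.
by case: (W x); rewrite ?mulr0 ?ler01// mulr1.
Qed.

Lemma bw_conditioned a t s : bw kp (conditioned a t) s =
  (bw kp (fun x => a x * klist kp t x)%R s * (all B s)%:R)%R.
Proof.
suff h (c : T -> R) : bw kp (fun x => c x * (~~ W x)%:R)%R s = (bw kp c s * (all B s)%:R)%R.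
  exact: h.
elim: s c => [|x s ih] c /=; first by rewrite mulr1.
rewrite (_ : bw kp _ s = bw kp (fun y => (c y * kp x y) * (~~ W y)%:R)%R s); last first.
  by apply: eq_bw => y _; rewrite mulrAC.
rewrite ih /B/=; case: (W x) => /=; rewrite ?mulr0 ?mul0r// !mulr1.
by rewrite mulrA.
Qed.

Lemma measurable_Zp_conditioned a : act mu a ->
  measurable_fun setT (fun t : lst T => Zp mu kp (conditioned a t)).
Proof.
move=> aa; have [ma a0 ia] := aa.
apply: (measurable_integral_sfinite (poisson mu) (f := fun q : lst T * lst T => (bw kp (conditioned a q.1) q.2)%:E)).
  by move=> q; rewrite bwe_ge0//; exact: act_conditioned.
apply/measurable_EFinP; apply: (measurable_bw_param (a := conditioned a) mk).
apply: measurable_funM.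
  apply: measurable_funM; first exact: (measurableT_comp ma measurable_snd).
  exact: (measurable_comp2 (measurable_klist_param mk) (@measurable_snd _ _ (lst T) T) (@measurable_fst _ _ (lst T) T)).
have mw' : measurable_fun setT (fun x : T => ((~~ W x)%:R : R)).
  by apply: (measurableT_comp (f := fun b : bool => b%:R%R : R)).
exact: (measurableT_comp mw' measurable_snd).
Qed.

(** As h sees only the points in [W], the others can be integrated out by [integral_poisson_split]
    and leave the partition function of the conditioned activity. This exhibits the density of the
    marginal on [W]. *)
Lemma EE_conditioning a h : act mu a -> (forall s, 0 <= h s) -> measurable_fun setT h ->
  symmetric_fun h -> (forall s, h s = h [seq x <- s | W x]) ->
  EE a h = \int[poisson mu]_t (h t * (bw kp a t * (all W t)%:R *
      (Zr mu kp (conditioned a t) / Zr mu kp a))%:E).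
Proof.
move=> aa h0 mh sh hW; have [ma a0 ia] := aa.
pose F (s : lst T) := h s * (bw kp a s)%:E.
have F0 s : 0 <= F s by rewrite mule_ge0// bwe_ge0.
have mF : measurable_fun setT F by exact: measurable_gbw.
have sF : symmetric_fun F by move=> s t st; rewrite /F (sh _ _ st) (bw_perm pk a st).
pose H (t : lst T) := h t * (bw kp a t * (all W t)%:R * Zr mu kp (conditioned a t))%:E.
have Z0 t : (0 < Zr mu kp (conditioned a t))%R by apply: Zr_gt0 => //; exact: act_conditioned.
have H0 t : 0 <= H t.
  by rewrite mule_ge0// lee_fin !mulr_ge0// ?bw_ge0// ltW.
have mall : measurable_fun setT (fun t : lst T => ((all W t)%:R : R)).
  apply: (measurableT_comp (f := fun b : bool => b%:R%R : R)) => //.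
  exact: measurable_lall1.
have mH : measurable_fun setT H.
  apply: emeasurable_funM => //; apply/measurable_EFinP; apply: measurable_funM.
    by apply: measurable_funM => //; exact: measurable_bw.
  exact: (measurableT_comp (@fine_measurable R setT measurableT) (measurable_Zp_conditioned aa)).
have E : \int[poisson mu]_s F s = \int[poisson mu]_t H t.
  rewrite (integral_poisson_split mu mB F0 mF sF); apply: eq_integral => t _.
  have act_t := act_conditioned t aa.
  have c0 : 0 <= h t * (bw kp a t * (all W t)%:R)%:E.
    by rewrite mule_ge0// lee_fin mulr_ge0// bw_ge0.
  transitivity (\int[poisson mu]_s ((h t * (bw kp a t * (all W t)%:R)%:E) * (bw kp (conditioned a t) s)%:E)).
    apply: eq_integral => s _; rewrite bw_conditioned /splitw /F.
    have -> : all (predC B) t = all W t by apply: eq_all => x; rewrite /B/= negbK.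
    have [sB|sB] := boolP (all B s); last by rewrite mulr0 !mule0.
    have [tW|tW] := boolP (all W t); last by rewrite mulr0 !mule0 mul0e.
    rewrite /= !mulr1 mule1.
    have pst : perm_eq (s ++ t) (t ++ s) by rewrite perm_catC.
    rewrite (bw_perm pk a pst) bw_cat (hW (s ++ t)) filter_cat.
    have -> : [seq x <- s | W x] = [::].
      by apply/eqP; rewrite -(negbK (_ == _)) -has_filter -all_predC.
    by rewrite cat0s (all_filterP tW) EFinM muleA.
  rewrite (ge0_integralZl (poisson mu) measurableT (measurable_bwE pk act_t) (fun s _ => bwe_ge0 s act_t) c0).
  by rewrite -/(Zp mu kp _) (ZpE pk act_t) /H -muleA -EFinM.
have zi := Zrinv_ge0 aa.
rewrite /EE E muleC -(ge0_integralZl (poisson mu) measurableT mH (fun t _ => H0 t) zi).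
apply: eq_integral => t _; rewrite /H muleCA -EFinM; congr (_ * _%:E).
by rewrite [RHS]mulrA mulrC.
Qed.

Lemma measurable_EE_conditioning a h : act mu a -> measurable_fun setT h ->
  measurable_fun setT (fun t => h t * (bw kp a t * (all W t)%:R *
      (Zr mu kp (conditioned a t) / Zr mu kp a))%:E).
Proof.
move=> aa mh; have [ma a0 ia] := aa; apply: emeasurable_funM => //; apply/measurable_EFinP.
apply: measurable_funM.
  apply: measurable_funM; first exact: measurable_bw.
  apply: (measurableT_comp (f := fun b : bool => b%:R%R : R)) => //.
  exact: measurable_lall1.
apply: measurable_funM => //.
exact: (measurableT_comp (@fine_measurable R setT measurableT) (measurable_Zp_conditioned aa)).
Qed.

End conditioning.

(** By [EE_conditioning] the last hypothesis bounds the ratio of the two marginal densities on [W]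
    by D; the bound M on the second expectation then turns the factor D into the error M (D - 1). *)
Lemma EE_le_ratio a a' (W : T -> bool) h (D M : R) : measurable_fun setT W ->
  act mu a -> act mu a' -> (forall s, 0 <= h s) -> measurable_fun setT h -> symmetric_fun h ->
  (forall s, h s = h [seq x <- s | W x]) -> (forall s, h s <= M%:E) -> (0 <= M)%R -> (1 <= D)%R ->
  (forall x, W x -> a x = a' x) ->
  (forall t, all W t -> (Zr mu kp (conditioned W a t) * Zr mu kp a' <=
      D * (Zr mu kp (conditioned W a' t) * Zr mu kp a))%R) ->
  EE a h <= EE a' h + (M * (D - 1))%:E.
Proof.
move=> mW aa aa' h0 mh sh hW hM M0 D1 agree ratio.
have D0 : (0 <= D)%R by exact: le_trans D1.
have [ma a0 ia] := aa; have [ma' a0' ia'] := aa'.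
have Za := Zr_gt0 pk aa; have Za' := Zr_gt0 pk aa'.
have EE'0 := EE_ge0 aa' h0.
have EE'M : EE a' h <= M%:E by apply: EE_le_cst => //.
have EE'fin : EE a' h \is a fin_num by rewrite ge0_fin_numE//; exact: le_lt_trans EE'M (ltry _).
apply: (@le_trans _ _ (D%:E * EE a' h)).
  rewrite (EE_conditioning mW aa)// (EE_conditioning mW aa')//.
  have c0 b t : act mu b -> 0 <= h t * (bw kp b t * (all W t)%:R *
      (Zr mu kp (conditioned W b t) / Zr mu kp b))%:E.
    move=> ab; have [_ b0 _] := ab; have cb := Zr_gt0 pk (act_conditioned mW t ab).
    have Zb := Zr_gt0 pk ab.
    by rewrite mule_ge0// lee_fin !mulr_ge0// ?bw_ge0// ?invr_ge0 ltW.
  have D0' : 0%R <= D%:E by rewrite lee_fin.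
  rewrite -(ge0_integralZl (poisson mu) measurableT (measurable_EE_conditioning mW aa' mh) (fun t _ => c0 a' t aa') D0').
  apply: ge0_le_integral => //.
  - by move=> t _; exact: c0.
  - exact: measurable_EE_conditioning.
  - by apply: measurable_funeM; exact: measurable_EE_conditioning.
  move=> t _; rewrite muleCA lee_wpmul2l// -EFinM lee_fin.
  have [tW|_] := boolP (all W t); last by rewrite !mulr0 !mul0r mulr0.
  rewrite !mulr1 (_ : bw kp a t = bw kp a' t); last first.
    by apply: eq_bw => x xt; apply: agree; exact: (allP tW).
  rewrite [leRHS]mulrCA ler_wpM2l ?bw_ge0// ler_pdivrMr//.
  have -> x : (D * (x / Zr mu kp a') * Zr mu kp a = D * (x * Zr mu kp a) / Zr mu kp a')%R by ring.
  by rewrite ler_pdivlMr//; exact: ratio.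
rewrite -(fineK EE'fin) -EFinM -EFinD lee_fin.
have : (fine (EE a' h) <= M)%R by rewrite -lee_fin fineK.
have : (0 <= D - 1)%R by rewrite subr_ge0.
by nra.
Qed.

End local_expectation.

Lemma mulr_expR_le (R : realType) (z1 z2 x1 x2 y1 y2 f : R) : (0 <= z1 -> 0 <= z2 ->
  x1 <= y2 + f -> x2 <= y1 + f ->
  z1 * expR x1 * (z2 * expR x2) <= expR (f + f) * (z1 * expR y1 * (z2 * expR y2)))%R.
Proof.
move=> z10 z20 xy yx; rewrite mulrACA [X in (_ <= _ * X)%R]mulrACA [leRHS]mulrCA.
rewrite ler_wpM2l ?mulr_ge0// -!expRD ler_expR; lra.
Qed.

(** * Effect of a local change of activity far away *)

Section far_comparison.
Variables (R : realType) (d : nat) (phi : pt R d -> \bar R) (r lam : R).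
Hypothesis d_gt0 : (0 < d)%N.
Hypothesis mphi : borel_efun phi.
Hypothesis phi0 : forall x, 0 <= phi x.
Hypothesis phiN : forall x, phi (- x)%R = phi x.
Hypothesis r0 : (0 <= r)%R.
Hypothesis phir : forall x, (r < enorm x)%R -> phi x = 0.
Hypothesis lam0 : (0 <= lam)%R.

Local Notation P := (ptT R d).
Local Notation mu := (lebd R d).
Local Notation kp := (kk phi).

Variables (k : nat) (theta : R).
Hypothesis theta0 : (0 <= theta)%R.
Hypothesis mixing : forall l (a a' : P -> R) v, act mu a -> act mu a' ->
  (forall x, a x <= lam)%R ->
  (forall x, enorm (x - v)%R <= l%:R * (k%:R * r) -> a x = a' x)%R ->
  (`|ins phi a v - ins phi a' v| <= 2 * theta ^+ l)%R.

Variables (q : pt R d) (rho0 : R) (l : nat).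
Hypothesis rho00 : (0 < rho0)%R.

Let dist (x : P) : R := enorm (x - q)%R.
Let mdist : measurable_fun setT dist. Proof. exact: measurable_dist1. Qed.
Let pk : pairfun kp. Proof. exact: pairfun_kk. Qed.

Definition erase (a : P -> R) (x : P) : R := (a x * (rho0 < enorm (x - q)%R)%R%:R)%R.

Let erase_ge0 a : act mu a -> forall x, (0 <= erase a x)%R.
Proof. by move=> [_ a0 _] x; rewrite mulr_ge0. Qed.

Let erase_le a : act mu a -> forall x, (erase a x <= a x)%R.
Proof. by move=> [_ a0 _] x; rewrite ler_piMr//; case: (_ < _)%R. Qed.

Lemma act_erase a : act mu a -> act mu (erase a).
Proof.
move=> aa; have [ma a0 ia] := aa; apply: (act_le aa); last first.
  by move=> x; rewrite erase_ge0// erase_le.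
apply: measurable_funM => //; apply: (measurableT_comp (f := fun b : bool => b%:R%R : R)) => //.
exact: measurable_fun_ltr.
Qed.

(** The logarithm of Z(a) / Z(erase a). Its integrand is supported in the ball of radius [rho0]
    about q, since a and [erase a] agree outside. *)
Let J a : R := fine (\int[mu]_w (interp_density mu dist kp a (erase a) w)%:E).

Let ZrE a : act mu a -> Zr mu kp a = (Zr mu kp (erase a) * expR (J a))%R.
Proof.
move=> aa; rewrite (Zr_interpolation mdist (dist_null d_gt0 q) (dist_ge0 q) pk aa (act_erase aa)) //.
exact: erase_le.
Qed.

(** At each w with |w - q| <= rho0 the integrands differ by a one-point ratio, hence by at most lam
    times 2 theta^l, the activities agreeing up to distance l k r from w. The volume (2 rho0)^d is
    that of a cube around the ball. *)
Let J_le a a' : act mu a -> act mu a' -> (forall x, a x <= lam)%R -> (forall x, a' x <= lam)%R ->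
  (forall x, dist x <= rho0 + l%:R * (k%:R * r) -> a x = a' x)%R ->
  (J a <= J a' + 2 * lam * (2 * rho0) ^+ d * theta ^+ l)%R.
Proof.
move=> aa aa' al al' agree; have [ma a0 ia] := aa; have [ma' a0' ia'] := aa'.
have kr0 : (0 <= l%:R * (k%:R * r))%R by rewrite !mulr_ge0.
pose f c w := interp_density mu dist kp c (erase c) w.
have fact c : act mu c -> act mu (f c).
  by move=> ac; apply: (act_interp_density mdist pk ac (act_erase ac)); exact: erase_le.
have [mf f0 fi] := fact _ aa; have [mf' f0' fi'] := fact _ aa'.
pose l0 := (q - \row_(i < d) rho0 : 'rV_d)%R.
pose C := cube l0 (2 * rho0).
have mC : measurable C by exact: measurable_cube.
pose e := (2 * lam * theta ^+ l)%R.
have e0 : (0 <= e)%R by rewrite !mulr_ge0// exprn_ge0.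
have key w : (f a w <= f a' w + e * \1_C w)%R.
  have [wq|wq] := ltP rho0 (dist w).
    rewrite {1}/f /interp_density /erase wq mulr1 subrr mul0r.
    by rewrite addr_ge0// mulr_ge0.
  have -> : (\1_C w = 1 :> R)%R.
    rewrite indicE mem_set// /C /cube/= => i; rewrite !mxE.
    have := le_trans (le_coord_enorm (w - q)%R i) wq; rewrite !mxE ler_norml.
    by move=> /andP[? ?]; apply/andP; split; lra.
  have aw : a w = a' w by apply: agree; lra.
  rewrite /f /interp_density /erase ltNge wq/= !mulr0 !subr0 mulr1 aw -lerBlDl -mulrBr.
  set u := insp _ _ _ _; set u' := insp _ _ _ _.
  have uu : (u - u' <= 2 * theta ^+ l)%R.
    apply: le_trans (ler_norm _) _; apply: mixing.
    - apply: (act_lamt mdist aa (act_erase aa)); exact: erase_le.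
    - apply: (act_lamt mdist aa' (act_erase aa')); exact: erase_le.
    - move=> x; apply: le_trans (al x); apply: lamt_le; exact: erase_le.
    move=> x xw; rewrite /lamt /erase.
    have -> // : a x = a' x.
    apply: agree.
    by have := enorm_triangle x w q; move: wq; rewrite /dist => wq; lra.
  have th0 : (0 <= theta ^+ l)%R by rewrite exprn_ge0.
  have [a0w alw] := (a0' w, al' w); apply: (@le_trans _ _ (a' w * (2 * theta ^+ l)))%R.
    by rewrite ler_wpM2l.
  by rewrite /e; nra.
have mC1 : measurable_fun setT (fun w : P => (e * \1_C w)%R%:E).
  by apply/measurable_EFinP; apply: measurable_funM => //; exact: measurable_indic.
have fin0 g : (forall w : P, 0 <= g w)%R -> \int[mu]_w (g w)%:E < +oo ->
    \int[mu]_w (g w)%:E = (fine (\int[mu]_w (g w)%:E))%:E.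
  by move=> g0 gi; rewrite fineK// ge0_fin_numE// integral_ge0// => w _; rewrite lee_fin.
rewrite -lee_fin EFinD /J -(fin0 _ f0 fi) -(fin0 _ f0' fi').
have -> : (2 * lam * (2 * rho0) ^+ d * theta ^+ l)%:E = \int[mu]_w (e * \1_C w)%R%:E.
  under eq_integral do rewrite EFinM.
  have m1 : measurable_fun setT (fun w : P => (\1_C w : R)%:E).
    by apply/measurable_EFinP; exact: measurable_indic.
  have e0' : 0%R <= e%:E by rewrite lee_fin.
  have c0 w : setT w -> 0%R <= (\1_C w : R)%:E by rewrite lee_fin.
  rewrite [RHS](ge0_integralZl mu measurableT m1 c0 e0').
  have -> : \int[mu]_w (\1_C w : R)%:E = ((2 * rho0) ^+ d)%:E.
    transitivity (mu C); first by rewrite -[in RHS](setIT C); exact: integral_indic.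
    by apply: lebd_cube; rewrite mulr_gt0.
  rewrite -EFinM /e.
  by congr EFin; ring.
have f0e w : setT w -> 0%R <= (f a' w)%:E by rewrite lee_fin.
have g0e w : setT w -> 0%R <= (e * \1_C w)%R%:E by rewrite lee_fin mulr_ge0.
have mf'E : measurable_fun setT (fun w => (f a' w)%:E) by exact/measurable_EFinP.
rewrite -(ge0_integralD mu measurableT f0e mf'E g0e mC1).
apply: ge0_le_integral => //.
- by move=> w _; rewrite lee_fin.
- exact/measurable_EFinP.
- exact: emeasurable_funD.
- by move=> w _; rewrite -EFinD lee_fin key.
Qed.

(** The extra r beyond the radius required by [J_le] keeps the points of this region from
    interacting with the ball in which conditioning must leave the activity unchanged. *)
Definition far_part (x : P) : bool := (rho0 + r + l%:R * (k%:R * r) < enorm (x - q))%R.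

Lemma measurable_far_part : measurable_fun setT far_part.
Proof. exact: measurable_fun_ltr. Qed.

Let conditionedE a t x : all far_part t -> (dist x <= rho0 + l%:R * (k%:R * r))%R ->
  conditioned kp far_part a t x = a x.
Proof.
move=> tW xq; rewrite /conditioned.
have -> : klist kp t x = 1%R.
  rewrite /klist big_seq big1// => z zt; apply: kk_far phir _ _ _.
  have := allP tW z zt; rewrite /far_part.
  have := enorm_triangle z x q.
  by move: xq; rewrite /dist; lra.
have -> : ~~ far_part x by rewrite /far_part -leNgt; move: xq; rewrite /dist; have := r0; lra.
by rewrite !mulr1.
Qed.

(* The normalising constants factor as Z(a) = Z(erase a) exp(J a); erasing removes the
   difference between a and a', and J only sees the configuration through its values near q. *)
Lemma far_comparison a a' (h : lst P -> \bar R) (M : R) :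
  act mu a -> act mu a' -> (forall x, a x <= lam)%R -> (forall x, a' x <= lam)%R ->
  (forall x, rho0 < enorm (x - q)%R -> a x = a' x)%R ->
  (forall s, 0 <= h s) -> measurable_fun setT h -> symmetric_fun h ->
  (forall s, h s = h [seq x <- s | far_part x]) -> (forall s, h s <= M%:E) -> (0 <= M)%R ->
  EE mu kp a h <= EE mu kp a' h +
    (M * (expR (4 * lam * (2 * rho0) ^+ d * theta ^+ l) - 1))%:E.
Proof.
move=> aa aa' al al' agree h0 mh sh hW hM M0.
have mW := measurable_far_part.
pose e := (2 * lam * (2 * rho0) ^+ d * theta ^+ l)%R.
(* One error [e] for [J1] and one for [J2]: each activity is compared with its own conditioned
   version. *)
have -> : (4 * lam * (2 * rho0) ^+ d * theta ^+ l = e + e)%R by rewrite /e; ring.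
have e0 : (0 <= e)%R by rewrite /e !mulr_ge0 ?exprn_ge0// mulr_ge0// ltW.
apply: (EE_le_ratio pk mW) => //.
- by rewrite -expR0 ler_expR addr_ge0.
- by move=> x xW; apply: agree; move: xW; rewrite /far_part; have := r0;
    have : (0 <= l%:R * (k%:R * r))%R by [rewrite !mulr_ge0]; lra.
move=> t tW.
have cl b : act mu b -> (forall x, b x <= lam)%R -> forall x, (conditioned kp far_part b t x <= lam)%R.
  move=> [_ b0 _] bl x; apply: le_trans (bl x); rewrite /conditioned -mulrA ler_piMr//.
  have [k0 k1] := (klist_ge0 pk t x, klist_le1 pk t x).
  by case: (far_part x); rewrite ?mulr0 ?mulr1 ?ler01.
have ac := act_conditioned pk mW t aa; have ac' := act_conditioned pk mW t aa'.
have J1 : (J (conditioned kp far_part a t) <= J a + e)%R.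
  by apply: J_le => //; [exact: cl|move=> x xq; exact: conditionedE].
have J2 : (J a' <= J (conditioned kp far_part a' t) + e)%R.
  by apply: J_le => //; [exact: cl|move=> x xq; rewrite conditionedE].
rewrite (ZrE ac) (ZrE ac') (ZrE aa) (ZrE aa').
have eZ b b' : (forall x, rho0 < enorm (x - q)%R -> b x = b' x)%R ->
    Zr mu kp (erase b) = Zr mu kp (erase b').
  move=> bb; congr fine; apply: eq_Zp => x; rewrite /erase.
  by case: ltP => [/bb ->//|_]; rewrite !mulr0.
rewrite (eZ a' a); last by move=> x xq; rewrite agree.
rewrite (eZ (conditioned kp far_part a t) (conditioned kp far_part a' t)); last first.
  by move=> x xq; rewrite /conditioned agree.
have Z1 := Zr_gt0 pk (act_erase aa); have Z2 := Zr_gt0 pk (act_erase ac').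
exact: mulr_expR_le (ltW Z2) (ltW Z1) J1 J2.
Qed.

End far_comparison.

(** * Real-valued expectations of bounded functions *)

Section real_expectation.
Context dT (T : measurableType dT) (R : realType) (mu : {sfinite_measure set T -> \bar R}).
Variable kp : T -> T -> R.
Hypothesis pk : pairfun kp.
Implicit Types (a : T -> R) (g h : lst T -> R) (M : R).

Definition bounded_by M g := measurable_fun setT g /\ forall s, (0 <= g s <= M)%R.

Lemma bounded_by_ge0 M g : bounded_by M g -> (0 <= M)%R.
Proof. by move=> [_ /(_ [::])/andP[]]; exact: le_trans. Qed.

Definition ER a g : R := fine (EE mu kp a (fun s => (g s)%:E)).

Lemma EE_ER M a g : act mu a -> bounded_by M g -> EE mu kp a (fun s => (g s)%:E) = (ER a g)%:E.
Proof.
move=> aa gM; have M0 := bounded_by_ge0 gM; have [mg g01] := gM.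
have g0 s : 0 <= (g s)%:E by rewrite lee_fin; case/andP: (g01 s).
have mgE : measurable_fun setT (fun s => (g s)%:E) by exact/measurable_EFinP.
rewrite /ER fineK// ge0_fin_numE ?(EE_ge0 pk aa)//.
apply: (@le_lt_trans _ _ M%:E); last exact: ltry.
by apply: (EE_le_cst pk aa M0 g0 mgE) => s _; rewrite lee_fin; case/andP: (g01 s).
Qed.

Lemma bounded_by_cst c : (0 <= c)%R -> bounded_by c (fun=> c).
Proof. by move=> c0; split => // s; rewrite c0 lexx. Qed.

Lemma bounded_byD M M' g h : bounded_by M g -> bounded_by M' h ->
  bounded_by (M + M') (fun s => g s + h s)%R.
Proof.
move=> [mg g01] [mh h01]; split; first exact: measurable_funD.
by move=> s; have /andP[? ?] := g01 s; have /andP[? ?] := h01 s; rewrite addr_ge0 ?lerD.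
Qed.

Lemma ER_D M M' a g h : act mu a -> bounded_by M g -> bounded_by M' h ->
  ER a (fun s => g s + h s)%R = (ER a g + ER a h)%R.
Proof.
move=> aa gM hM; apply/EFin_inj; rewrite -(EE_ER aa (bounded_byD gM hM)) EFinD.
rewrite -(EE_ER aa gM) -(EE_ER aa hM); have [[mg g0] [mh h0]] := (gM, hM).
apply: (EE_D (g := fun s => (g s)%:E) (h := fun s => (h s)%:E) pk aa).
- by move=> s; rewrite lee_fin; case/andP: (g0 s).
- by move=> s; rewrite lee_fin; case/andP: (h0 s).
- exact/measurable_EFinP.
- exact/measurable_EFinP.
Qed.

Lemma ER_cst a c : act mu a -> (0 <= c)%R -> ER a (fun=> c) = c.
Proof. by move=> aa c0; apply/EFin_inj; rewrite -(EE_ER aa (bounded_by_cst c0)) (EE_cst pk aa c0). Qed.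

Lemma ER_ge0 M a g : act mu a -> bounded_by M g -> (0 <= ER a g)%R.
Proof.
move=> aa gM; rewrite -lee_fin -(EE_ER aa gM) (EE_ge0 pk aa)// => s.
by rewrite lee_fin; case/andP: (gM.2 s).
Qed.

Lemma le_ER M M' a g h : act mu a -> bounded_by M g -> bounded_by M' h ->
  (forall s, bw kp a s != 0%R -> g s <= h s)%R -> (ER a g <= ER a h)%R.
Proof.
move=> aa gM hM gh; rewrite -lee_fin -(EE_ER aa gM) -(EE_ER aa hM).
apply: (le_EE pk aa).
- by move=> s; rewrite lee_fin; case/andP: (gM.2 s).
- by apply/measurable_EFinP; case: gM.
- by apply/measurable_EFinP; case: hM.
- by move=> s s0; rewrite lee_fin gh.
Qed.

Lemma le_ER_shift M M' a g h c : act mu a -> bounded_by M g -> bounded_by M' h -> (0 <= c)%R ->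
  (forall s, bw kp a s != 0%R -> g s <= h s + c)%R -> (ER a g <= ER a h + c)%R.
Proof.
move=> aa gM hM c0 gh; rewrite -[in leRHS](ER_cst aa c0).
rewrite -(ER_D aa hM (bounded_by_cst c0)).
by apply: (le_ER aa gM (bounded_byD hM (bounded_by_cst c0))).
Qed.

Lemma ER_le_cst M a g : act mu a -> bounded_by M g -> (ER a g <= M)%R.
Proof.
move=> aa gM; have M0 := bounded_by_ge0 gM; rewrite -(ER_cst aa M0).
by apply: (le_ER aa gM (bounded_by_cst M0)) => s _; case/andP: (gM.2 s).
Qed.

End real_expectation.

(** * Oscillation over unit cubes *)

Local Close Scope ereal_scope.

Section oscillation.
Variables (R : realType) (d n : nat).
Local Notation V := (pt R d).
Implicit Types (X : seq V) (F : seq V -> R).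

Definition in_Lam X := forall x, x \in X -> Lam n x.

Definition far_from (q x : V) : bool := d%:R < enorm (x - q).

(* The radius d of [far_from] bounds the diameter of a unit cube, so F moves by at most D
   when a configuration is modified inside one unit cube. *)
Definition osc_le F D := forall q X X', Lam n q -> in_Lam X -> in_Lam X' ->
  [seq x <- X | far_from q x] = [seq x <- X' | far_from q x] -> F X <= F X' + D.

Lemma in_Lam_cat X X' : in_Lam X -> in_Lam X' -> in_Lam (X ++ X').
Proof. by move=> h h' x; rewrite mem_cat => /orP[/h|/h']. Qed.

Lemma in_Lam_filter (p : pred V) X : in_Lam X -> in_Lam [seq x <- X | p x].
Proof. by move=> h x; rewrite mem_filter => /andP[_ /h]. Qed.

Section cells.
Variables (I : eqType) (cell : V -> I) (reg : pred V).
Hypothesis cell_diam : forall x x', reg x -> reg x' -> cell x = cell x' -> enorm (x - x') <= d%:R.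

Let moved (es : seq I) (x : V) := reg x && (cell x \in es).

Let hybrid X X' es : seq V :=
  [seq x <- X | ~~ moved es x] ++ [seq x <- X' | moved es x].

(** [X] is exchanged for [X'] one cell at a time, and each exchange moves [F] by at most D. *)
Lemma cover_telescope F D X X' es : osc_le F D -> 0 <= D -> in_Lam X -> in_Lam X' ->
  F X <= F (hybrid X X' es) + (size es)%:R * D.
Proof.
move=> oF D0 iX iX'; elim: es => [|c es ih].
  rewrite mul0r addr0 /hybrid (eq_filter (a2 := predT)); last by move=> x; rewrite /moved in_nil andbF.
  by rewrite filter_predT (eq_filter (a2 := pred0)) ?filter_pred0 ?cats0// => x; rewrite /moved in_nil andbF.
suff : F (hybrid X X' es) <= F (hybrid X X' (c :: es)) + D.
  by move: ih; rewrite /= -natr1 mulrDl mul1r; lra.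
have iH es' : in_Lam (hybrid X X' es') by apply: in_Lam_cat; exact: in_Lam_filter.
(* A point of either configuration in the cell c serves as the centre q, which ensures q in Lambda_n
   even if the cell sticks out. If there is none, the exchange changes nothing. *)
have [/hasP[q]|none] := boolP (has (fun x => reg x && (cell x == c)) (X ++ X')).
  move=> qX /andP[rq /eqP cq]; apply: (oF q) => //; first exact: (in_Lam_cat iX iX').
  have fm x : far_from q x -> moved es x = moved (c :: es) x.
    rewrite /moved in_cons; case rx : (reg x) => //=; case: eqP => //= cx.
    by rewrite /far_from ltNge cell_diam// cx.
  rewrite /hybrid !filter_cat -!filter_predI.
  by congr (_ ++ _); apply: eq_filter => x /=; case: (boolP (far_from q x)) => //= /fm ->.
have e : hybrid X X' es = hybrid X X' (c :: es).
  have fm x : x \in X ++ X' -> moved es x = moved (c :: es) x.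
    move=> xX; rewrite /moved in_cons; case rx : (reg x) => //=; case: eqP => //= cx.
    by move/hasPn: none => /(_ x xX); rewrite rx cx eqxx.
  by congr (_ ++ _); apply: eq_in_filter => x xX; rewrite fm// mem_cat xX ?orbT.
by rewrite e lerDl.
Qed.

End cells.

(** [minn m] puts the closing faces of the closed cube into the last cells. *)
Definition cube_cell m (l : V) (x : V) : {ffun 'I_d -> 'I_m.+1} :=
  [ffun i => inord (minn m (Num.truncn (x ord0 i - l ord0 i)))].

Lemma truncn_cell m (z : R) : 0 <= z <= m.+1%:R ->
  (minn m (Num.truncn z))%:R <= z <= (minn m (Num.truncn z))%:R + 1.
Proof.
move=> /andP[z0 zm]; have /andP[t1 t2] := truncn_itv z0.
rewrite natr1; have [tm|tm] := leqP (Num.truncn z) m.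
  by rewrite t1 ltW.
rewrite zm andbT; apply: le_trans t1.
by rewrite ler_nat ltnW.
Qed.

Lemma cube_cell_diam m l x x' : cube l m.+1%:R x -> cube l m.+1%:R x' ->
  cube_cell m l x = cube_cell m l x' -> enorm (x - x') <= d%:R.
Proof.
move=> cx cx' /ffunP e; rewrite -[leRHS]mulr1; apply: enorm_le_sup => // i.
have := e i; rewrite !ffunE => /(congr1 val)/=; rewrite !inordK ?ltnS ?geq_minl// => ei.
have h y : cube l m.+1%:R y -> 0 <= y ord0 i - l ord0 i <= m.+1%:R.
  by move=> /(_ i)/andP[? ?]; apply/andP; split; lra.
have /andP[] := truncn_cell (h _ cx); have /andP[] := truncn_cell (h _ cx').
by rewrite ei !mxE ler_norml => *; apply/andP; split; lra.
Qed.

Lemma osc_cube F D m l X X' : osc_le F D -> 0 <= D -> symmetric_fun (F : lst (ptT R d) -> R) ->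
  in_Lam X -> in_Lam X' ->
  [seq x <- X | x \notin cube l m.+1%:R] = [seq x <- X' | x \notin cube l m.+1%:R] ->
  F X <= F X' + (m.+1 ^ d)%:R * D.
Proof.
move=> oF D0 sF iX iX' e.
pose reg (x : V) := x \in cube l m.+1%:R.
have cd x x' : reg x -> reg x' -> cube_cell m l x = cube_cell m l x' -> enorm (x - x') <= d%:R.
  by rewrite /reg !inE; exact: cube_cell_diam.
have := cover_telescope cd (enum {ffun 'I_d -> 'I_m.+1}) oF D0 iX iX'.
(* After all cells are exchanged, the hybrid is [X'] up to the order of its points, whence the
   symmetry of [F]. *)
rewrite -cardT card_ffun !card_ord; congr (_ <= _ + _); apply: sF.
set p := fun x => _ && _; have pE x : p x = reg x by rewrite /p mem_enum andbT.
rewrite (eq_filter (a1 := p) (a2 := reg))// (eq_filter (a2 := predC reg)); last by move=> x; rewrite /= mem_enum andbT.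
by rewrite [X in X ++ _]e perm_catC perm_filterC.
Qed.

End oscillation.

(** * Summability over shells *)

Section shell_sums.
Variable R : realType.
Implicit Types (s theta c x : R).

Lemma bernoulli_le x n : 0 <= x <= 1 -> 1 - n%:R * x <= (1 - x) ^+ n.
Proof.
move=> /andP[x0 x1]; elim: n => [|n ih]; first by rewrite mul0r subr0 expr0.
have h : 0 <= 1 - x by rewrite subr_ge0.
have n0 : 0 <= n%:R :> R by [].
by rewrite exprS; apply: le_trans (ler_wpM2l h ih); rewrite -natr1; nra.
Qed.

Lemma geometric_sum_le s n : 0 <= s < 1 -> \sum_(t < n) s ^+ t <= (1 - s)^-1.
Proof.
move=> /andP[s0 s1]; have h : 0 < 1 - s by rewrite subr_gt0.
rewrite -[leRHS]mul1r ler_pdivlMr// mulrC -opprB mulNr -subrX1 opprB gerBl.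
exact: exprn_ge0.
Qed.

(** Each of the first t + 1 terms of the geometric series is at least s^t. *)
Lemma linear_geometric_le s t : 0 <= s < 1 -> t.+1%:R * s ^+ t <= (1 - s)^-1.
Proof.
move=> s01; have /andP[s0 s1] := s01; apply: le_trans (geometric_sum_le t.+1 s01).
rewrite mulr_natl -[X in _ *+ X]card_ord -sumr_const; apply: ler_sum => i _.
have it : (i <= t)%N by rewrite -ltnS.
move: it; generalize (nat_of_ord i) => j jt; rewrite -(subnKC jt) exprD.
by apply: ler_piMr; [exact: exprn_ge0|apply: exprn_ile1 => //; exact: ltW].
Qed.

(** With theta <= s^(d+1) for some s < 1, d of the factors s^t absorb (t+1)^d by
    [linear_geometric_le], and the last one leaves a geometric series. *)
Lemma poly_geometric_sum_bounded d theta : 0 <= theta < 1 ->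
  exists2 S : R, 0 <= S & forall n, \sum_(t < n) t.+1%:R ^+ d * theta ^+ t <= S.
Proof.
move=> /andP[t0 t1].
have d0 : 0 < d.+1%:R :> R by [].
(* Chosen so that Bernoulli's inequality reads theta = 1 - (d + 1) x <= (1 - x)^(d+1). *)
pose x := (1 - theta) / d.+1%:R.
have x0 : 0 < x by rewrite divr_gt0// subr_gt0.
have x1 : x <= 1.
  rewrite ler_pdivrMr// mul1r; have : 1 <= d.+1%:R :> R by rewrite ler1n.
  by move: t0; lra.
have s01 : 0 <= 1 - x < 1 by rewrite subr_ge0 x1/= ltrBlDr ltrDl.
have ts : theta <= (1 - x) ^+ d.+1.
  apply: le_trans (bernoulli_le d.+1 _); last by rewrite ltW.
  by rewrite /x mulrCA divff ?mulr1 ?gt_eqF//; lra.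
have B0 : 0 <= x^-1 by rewrite invr_ge0 ltW.
exists (x^-1 ^+ d * x^-1); first by rewrite mulr_ge0// exprn_ge0.
move=> n; apply: le_trans (_ : \sum_(t < n) x^-1 ^+ d * (1 - x) ^+ t <= _).
  apply: ler_sum => t _; have /andP[s0 s1] := s01.
  apply: (@le_trans _ _ (t.+1%:R ^+ d * ((1 - x) ^+ d.+1) ^+ t)).
    by rewrite ler_wpM2l ?exprn_ge0// lerXn2r ?nnegrE ?exprn_ge0.
  rewrite -exprM mulSn exprD (mulnC d) exprM mulrCA -exprMn mulrC ler_wpM2r ?exprn_ge0//.
  rewrite lerXn2r ?nnegrE ?mulr_ge0 ?exprn_ge0//.
  by have := linear_geometric_le t s01; rewrite subKr.
rewrite -mulr_sumr ler_wpM2l ?exprn_ge0//.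
by have := geometric_sum_le n s01; rewrite subKr.
Qed.

Lemma expR_sub1_le x : expR x - 1 <= x * expR x.
Proof.
have := expR_ge1Dx (- x); rewrite expRN => h.
have e0 := expR_gt0 x; have : (1 - x) * expR x <= 1 by rewrite -ler_pdivlMr// mul1r.
lra.
Qed.

(** The number of unit cells in a cube around a ball of radius rho; its side 2 (floor rho + 1) + 1
    has the form m + 1 used in [osc_cube]. *)
Definition ball_cells (d : nat) (rho : R) : nat := ((2 * (Num.truncn rho).+1).+1 ^ d)%N.

Lemma ball_cells_le d rho : 0 <= rho -> (ball_cells d rho)%:R <= (2 * rho + 3) ^+ d.
Proof.
move=> rho0; rewrite /ball_cells natrX; have /andP[h _] := truncn_itv rho0.
apply: lerXn2r; [by rewrite nnegrE|by rewrite nnegrE; lra|].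
by rewrite -natr1 natrM -natr1; lra.
Qed.

(** The number of cells grows polynomially in t, while exp(c theta^t) - 1 <= c exp(c) theta^t decays
    geometrically. Uniformity in the number n of shells matters: that number will grow with L,
    whereas K has to be fixed before L. *)
Lemma shell_sum_bounded (d : nat) (rho step c theta : R) : 0 <= rho -> 0 <= step -> 0 <= c ->
  0 <= theta < 1 -> exists2 K : R, 0 <= K & forall n,
  2 * (ball_cells d rho)%:R +
  \sum_(t < n) 2 * (ball_cells d (rho + t.+1%:R * step))%:R * (expR (c * theta ^+ t) - 1) <= K.
Proof.
move=> rho0 step0 c0 th01; have /andP[th0 th1] := th01.
have [S S0 hS] := poly_geometric_sum_bounded d th01.
pose B := 2 * rho + 2 * step + 3.
have B0 : 0 <= B by rewrite !addr_ge0// mulr_ge0.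
have A0 : 0 <= 2 * B ^+ d * (c * expR c) by rewrite !mulr_ge0 ?exprn_ge0// expR_ge0.
exists (2 * (ball_cells d rho)%:R + 2 * B ^+ d * (c * expR c) * S).
  by rewrite addr_ge0// mulr_ge0.
move=> n; rewrite lerD2l.
apply: le_trans (_ : \sum_(t < n) 2 * B ^+ d * (c * expR c) * (t.+1%:R ^+ d * theta ^+ t) <= _).
  apply: ler_sum => t _.
  have tt0 : 0 <= theta ^+ t by rewrite exprn_ge0.
  have tt1 : theta ^+ t <= 1 by rewrite exprn_ile1// ltW.
  have ct0 : 0 <= c * theta ^+ t by rewrite mulr_ge0.
  have e1 : expR (c * theta ^+ t) - 1 <= c * expR c * theta ^+ t.
    apply: le_trans (expR_sub1_le _) _; rewrite [leRHS]mulrAC ler_wpM2l//.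
    by rewrite ler_expR ler_piMr.
  have e0 : 0 <= expR (c * theta ^+ t) - 1 by rewrite subr_ge0 -expR0 ler_expR.
  have st0 : 0 <= t.+1%:R * step by rewrite mulr_ge0.
  have n1 : (ball_cells d (rho + t.+1%:R * step))%:R <= B ^+ d * t.+1%:R ^+ d.
    apply: le_trans (ball_cells_le _ (addr_ge0 rho0 st0)) _.
    have t1 : 1 <= t.+1%:R :> R by rewrite ler1n.
    rewrite -exprMn; apply: lerXn2r; rewrite ?nnegrE.
    - by rewrite addr_ge0// mulr_ge0// addr_ge0.
    - by rewrite mulr_ge0.
    by rewrite /B; move: rho0 step0; nra.
  have n0 : 0 <= (ball_cells d (rho + t.+1%:R * step))%:R :> R by [].
  have gen (b u v w : R) : 2 * b * w * (u * v) = 2 * (b * u) * (w * v) by ring.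
  rewrite [leRHS]gen.
  by apply: ler_pM => //; rewrite ler_wpM2l.
by rewrite -mulr_sumr ler_wpM2l.
Qed.

End shell_sums.

Lemma osc_ball (R : realType) (d n : nat) (F : seq (pt R d) -> R) (D rho : R) q X X' :
  osc_le n F D -> 0 <= D -> symmetric_fun (F : lst (ptT R d) -> R) -> 0 <= rho ->
  in_Lam n X -> in_Lam n X' ->
  [seq x <- X | rho < enorm (x - q)] = [seq x <- X' | rho < enorm (x - q)] ->
  F X <= F X' + (ball_cells d rho)%:R * D.
Proof.
move=> oF D0 sF rho0 iX iX' e.
pose l : pt R d := q - \row_(i < d) (Num.truncn rho).+1%:R.
apply: (osc_cube (l := l) oF) => //.
have h (x : pt R d) : x \notin cube l (2 * (Num.truncn rho).+1).+1%:R -> rho < enorm (x - q).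
  apply: contraR; rewrite -leNgt => xq; rewrite inE => i.
  have := le_trans (le_coord_enorm (x - q) i) xq; rewrite /l !mxE ler_norml.
  have /andP[_ ] := truncn_itv rho0; rewrite -[(2 * _).+1%:R]natr1 natrM.
  by move=> ? /andP[? ?]; apply/andP; split; lra.
have fE Y : [seq x <- Y | x \notin cube l (2 * (Num.truncn rho).+1).+1%:R] =
    [seq x <- [seq x <- Y | rho < enorm (x - q)] | x \notin cube l (2 * (Num.truncn rho).+1).+1%:R].
  rewrite -filter_predI; apply: eq_filter => x /=.
  by case: (boolP (x \notin _)) => //= /h ->.
by rewrite fE e -fE.
Qed.

Lemma bw_neq0 dT (T : measurableType dT) (R : realType) (kp : T -> T -> R) (a : T -> R) (s : lst T) :
  bw kp a s != 0 -> {in s, forall x, a x != 0}.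
Proof.
elim: s a => //= x s ih a; rewrite mulf_eq0 negb_or => /andP[ax /ih h] y.
rewrite inE => /predU1P[->//|/h]; rewrite mulf_eq0 negb_or.
by case/andP.
Qed.

Lemma Lam_cube (R : realType) (d n : nat) :
  @Lam R d n = cube (- \row_(i < d) n%:R : pt R d) (2 * n)%:R.
Proof.
by apply/seteqP; split=> x h i; have := h i; rewrite !mxE natrM ler_norml => /andP[? ?];
  apply/andP; split; lra.
Qed.

Lemma measurable_Lam (R : realType) (d n : nat) : measurable (@Lam R d n : set (ptT R d)).
Proof. by rewrite Lam_cube; exact: measurable_cube. Qed.

Lemma measurable_in_Lam (R : realType) (d n : nat) :
  measurable_fun setT (fun x : ptT R d => x \in @Lam R d n).
Proof.
apply: (measurable_fun_bool true); rewrite setTI.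
rewrite (_ : _ @^-1` _ = @Lam R d n); first exact: measurable_Lam.
by apply/seteqP; split=> x; [move=> /set_mem|move=> /mem_set].
Qed.

(** * Comparison of two local laws, shell by shell *)

Section shells.
Variables (R : realType) (d : nat) (phi : pt R d -> \bar R) (r lam : R).
Hypothesis d_gt0 : (0 < d)%N.
Hypothesis mphi : borel_efun phi.
Hypothesis phi0 : forall x, (0 <= phi x)%E.
Hypothesis phiN : forall x, phi (- x) = phi x.
Hypothesis r0 : 0 <= r.
Hypothesis phir : forall x, r < enorm x -> phi x = 0%E.
Hypothesis lam0 : 0 <= lam.

Local Notation P := (ptT R d).
Local Notation mu := (lebd R d).
Local Notation kp := (kk phi).

Variables (k : nat) (theta : R).
Hypothesis theta0 : 0 <= theta.
Hypothesis mixing : forall l (a a' : P -> R) v, act mu a -> act mu a' ->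
  (forall x, a x <= lam) ->
  (forall x, enorm (x - v) <= l%:R * (k%:R * r) -> a x = a' x) ->
  `|ins phi a v - ins phi a' v| <= 2 * theta ^+ l.

Variables (q : pt R d) (rho0 : R).
Hypothesis rho00 : 0 < rho0.

Variables (n : nat) (F : lst P -> R) (D : R).
Hypothesis bF : bounded_by 1 F.
Hypothesis sF : symmetric_fun F.
Hypothesis oF : osc_le n F D.
Hypothesis D0 : 0 <= D.

Variable out : seq (pt R d).
Hypothesis outL : in_Lam n out.

Let pk : pairfun kp. Proof. exact: pairfun_kk. Qed.

Let rad t : R := rho0 + r + t%:R * (k%:R * r).
Let rad0 t : 0 <= rad t. Proof. by rewrite /rad !addr_ge0 ?mulr_ge0 ?(ltW rho00). Qed.

Let keep t (x : pt R d) : bool := (x \in Lam n) && (rad t < enorm (x - q)).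
Let trunc t (s : lst P) : lst P := [seq x <- s | keep t x].
(** [F] after deleting the resampled points within [rad t] of q, so that raising t removes one more
    shell. Points outside Lambda_n are deleted too, so that [osc_le] applies to every list. *)
Let g t (s : lst P) : R := F (out ++ trunc t s).

Let mkeep t : measurable_fun setT (keep t : P -> bool).
Proof.
apply: measurable_and; first exact: measurable_in_Lam.
by apply: measurable_fun_ltr => //; exact: measurable_dist1.
Qed.

Let mtrunc t : measurable_fun setT (trunc t).
Proof.
have h := measurable_lfilter (b := fun (_ : unit) (x : P) => keep t x) (measurableT_comp (mkeep t) measurable_snd).
exact: (measurable_comp2 h (@measurable_cst _ _ (lst P) unit setT tt) (@measurable_id _ (lst P) setT)).
Qed.

Let bg t : bounded_by 1 (g t).
Proof.
have [mF F01] := bF; split; last by move=> s; exact: F01.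
by apply: (measurableT_comp mF); apply: measurable_lcat.
Qed.

Let bFo : bounded_by 1 (fun s : lst P => F (out ++ s)).
Proof.
have [mF F01] := bF; split; last by move=> s; exact: F01.
by apply: (measurableT_comp mF); apply: measurable_lcat.
Qed.

Let truncL t s : in_Lam n (out ++ trunc t s).
Proof.
apply: in_Lam_cat => // x; rewrite mem_filter => /andP[/andP[+ _] _].
by rewrite inE.
Qed.

Let N t : R := (ball_cells d (rad t))%:R * D.
Let N0 t : 0 <= N t. Proof. by rewrite mulr_ge0. Qed.

Let rad_le t : rad t <= rad t.+1.
Proof. by rewrite /rad -natr1 mulrDl mul1r lerD2l lerDl mulr_ge0. Qed.

Let trunc_next t s : [seq x <- out ++ trunc t s | rad t.+1 < enorm (x - q)] =
  [seq x <- out ++ trunc t.+1 s | rad t.+1 < enorm (x - q)].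
Proof.
rewrite !filter_cat; congr (_ ++ _); rewrite -!filter_predI; apply: eq_filter => x /=.
case: ltP => //= h; rewrite /keep; congr (_ && _).
by rewrite h (le_lt_trans (rad_le t)).
Qed.

Variables a a' : P -> R.
Hypothesis aa : act mu a.
Hypothesis aa' : act mu a'.
Hypothesis al : forall x, a x <= lam.
Hypothesis al' : forall x, a' x <= lam.
Hypothesis aL : forall x, a x != 0 -> Lam n x.
Hypothesis aL' : forall x, a' x != 0 -> Lam n x.
Hypothesis agree : forall x, rho0 < enorm (x - q) -> a x = a' x.

Let c : R := 4 * lam * (2 * rho0) ^+ d.

(** [g t - g t.+1] depends only on points beyond [rad t], where [far_comparison] applies with l = t.
    It is at most [N t.+1] in absolute value, because the two truncations differ only within
    [rad t.+1]. Adding [N t.+1] makes it nonnegative, hence the range [2 * N t.+1]. *)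
Let shell_step t : ER mu kp a (g t) - ER mu kp a' (g t) <=
  ER mu kp a (g t.+1) - ER mu kp a' (g t.+1) + 2 * N t.+1 * (expR (c * theta ^+ t) - 1).
Proof.
pose h s := (N t.+1 + g t s - g t.+1 s).
have h01 s : 0 <= h s <= 2 * N t.+1.
  have := osc_ball oF D0 sF (rad0 t.+1) (truncL (t:=t) (s:=s)) (truncL (t:=t.+1) (s:=s)) (trunc_next t s).
  have := osc_ball oF D0 sF (rad0 t.+1) (truncL (t:=t.+1) (s:=s)) (truncL (t:=t) (s:=s)) (esym (trunc_next t s)).
  by rewrite /h /g -/(N t.+1) => ? ?; apply/andP; split; lra.
have mh : measurable_fun setT h.
  apply: measurable_funB; last by case: (bg t.+1).
  by apply: measurable_funD => //; case: (bg t).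
have bh : bounded_by (2 * N t.+1) h by split.
have M0 : 0 <= 2 * N t.+1 by rewrite mulr_ge0.
have hE b : act mu b -> ER mu kp b h = N t.+1 + ER mu kp b (g t) - ER mu kp b (g t.+1).
  move=> ab; apply/eqP; rewrite eq_sym subr_eq eq_sym; apply/eqP.
  rewrite -(ER_D pk ab bh (bg t.+1)) -[in RHS](ER_cst pk ab (N0 t.+1)).
  rewrite -(ER_D pk ab (bounded_by_cst _ (N0 t.+1)) (bg t)).
  by congr (ER mu kp b _); apply/funext => s; rewrite /h subrK.
suff : ER mu kp a h <= ER mu kp a' h + 2 * N t.+1 * (expR (c * theta ^+ t) - 1).
  by rewrite !hE//; lra.
rewrite -lee_fin EFinD -(EE_ER pk aa bh) -(EE_ER pk aa' bh).
apply: (far_comparison d_gt0 mphi phi0 phiN r0 phir lam0 theta0 mixing rho00 (q := q)) => //.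
- by move=> s; rewrite lee_fin; case/andP: (h01 s).
- exact/measurable_EFinP.
- move=> s s' ss'; congr EFin; rewrite /h /g; congr (_ + _ - _); apply: sF; rewrite perm_cat2l perm_filter//.
- move=> s; congr EFin; rewrite /h /g /trunc -!filter_predI; congr (_ + F (_ ++ _) - F (_ ++ _)); apply: eq_filter => x /=.
    by rewrite /keep /far_part -/(rad t); case: (rad t < _); rewrite ?andbF ?andbT.
  rewrite /keep /far_part -/(rad t); case: (ltP (rad t.+1)) => //=; rewrite ?andbF//.
  by move=> h'; rewrite (le_lt_trans (rad_le t) h') !andbT.
- by move=> s; rewrite lee_fin; case/andP: (h01 s).
Qed.

Let shell_iter T : ER mu kp a (g 0) - ER mu kp a' (g 0) <=
  ER mu kp a (g T) - ER mu kp a' (g T) +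
  \sum_(t < T) 2 * N t.+1 * (expR (c * theta ^+ t) - 1).
Proof.
elim: T => [|T ih]; first by rewrite big_ord0 addr0.
by rewrite big_ord_recr/=; have := shell_step T; move: ih; lra.
Qed.

Let g_last b T : act mu b -> (forall x, b x != 0 -> enorm (x - q) <= rad T) ->
  ER mu kp b (g T) = F out.
Proof.
move=> ab bT; have F0 : 0 <= F out by case/andP: (bF.2 out).
have gE s : bw kp b s != 0 -> g T s = F out.
  move=> /bw_neq0 bs; rewrite /g (_ : trunc T s = [::]) ?cats0//.
  apply/eqP; rewrite -(negbK (_ == _)) -has_filter -all_predC; apply/allP => x xs /=.
  by rewrite /keep negb_and -leNgt bT ?bs ?orbT.
have bc : bounded_by (F out) (fun _ : lst P => F out) := bounded_by_cst _ F0.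
apply/le_anti/andP; split.
  by rewrite -[leRHS](ER_cst pk ab F0); apply: (le_ER pk ab (bg T) bc) => s /gE ->.
by rewrite -[leLHS](ER_cst pk ab F0); apply: (le_ER pk ab bc (bg T)) => s /gE ->.
Qed.

Let g_first b s : (forall x, b x != 0 -> Lam n x) -> bw kp b s != 0 ->
  F (out ++ s) <= g 0 s + N 0 /\ g 0 s <= F (out ++ s) + N 0.
Proof.
move=> bL /bw_neq0 bs; have sL : in_Lam n (out ++ s) by apply: in_Lam_cat => // x /bs /bL.
have e : [seq x <- out ++ s | rad 0 < enorm (x - q)] = [seq x <- out ++ trunc 0 s | rad 0 < enorm (x - q)].
  rewrite !filter_cat; congr (_ ++ _); rewrite -filter_predI; apply: eq_in_filter => x xs /=.
  by rewrite /keep; case: ltP => //= _; rewrite mem_set//; apply: bL; exact: bs.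
split; [exact: (osc_ball oF D0 sF (rad0 0) sL (@truncL 0%N s) e)|].
exact: (osc_ball oF D0 sF (rad0 0) (@truncL 0%N s) sL (esym e)).
Qed.

(** Replacing [F] by [g 0] costs [N 0] under each of the two laws, hence the factor 2. The shells
    are then removed one at a time; after T of them no resampled point is left and both expectations
    equal [F out]. *)
Lemma shell_comparison T : (forall x, a x != 0 -> enorm (x - q) <= rho0 + r + T%:R * (k%:R * r)) ->
  (forall x, a' x != 0 -> enorm (x - q) <= rho0 + r + T%:R * (k%:R * r)) ->
  ER mu kp a (fun s => F (out ++ s)) <= ER mu kp a' (fun s => F (out ++ s)) +
   (2 * (ball_cells d (rho0 + r))%:R + \sum_(t < T) 2 * (ball_cells d (rho0 + r + t.+1%:R * (k%:R * r)))%:R *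
    (expR (4 * lam * (2 * rho0) ^+ d * theta ^+ t) - 1)) * D.
Proof.
move=> aT aT'; have := shell_iter T; rewrite (g_last aa aT) (g_last aa' aT') subrr add0r.
have := le_ER_shift pk aa bFo (bg 0) (N0 0) (fun s s0 => (g_first aL s0).1).
have := le_ER_shift pk aa' (bg 0) bFo (N0 0) (fun s s0 => (g_first aL' s0).2).
have -> : (2 * (ball_cells d (rho0 + r))%:R + \sum_(t < T) 2 * (ball_cells d (rho0 + r + t.+1%:R * (k%:R * r)))%:R *
    (expR (4 * lam * (2 * rho0) ^+ d * theta ^+ t) - 1)) * D =
    2 * N 0 + \sum_(t < T) 2 * N t.+1 * (expR (c * theta ^+ t) - 1).
  rewrite mulrDl mulr_suml /N /rad mul0r addr0 mulrA; congr (_ + _); apply: eq_bigr => t _.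
  by rewrite mulrAC -[2 * _ * D]mulrA.
lra.
Qed.

End shells.

(** * Block dynamics *)

Local Open Scope ereal_scope.

Section gibbs_weights.
Variables (R : realType) (d : nat) (phi : pt R d -> \bar R).
Hypothesis phi0 : forall x, 0 <= phi x.
Local Notation P := (ptT R d).

Lemma pair_energy_cons (x : pt R d) (s : conf R d) :
  pair_energy phi (x :: s) = \sum_(z <- s) phi (x - z)%R + pair_energy phi s.
Proof.
rewrite /pair_energy /= big_ord_recl; congr (_ + _).
  rewrite big_mkcond big_ord_recl/= add0e (big_nth 0%R) big_mkord.
  by apply: eq_bigr => j _; rewrite /= ?add0n.
by apply: eq_bigr => i _; rewrite big_mkcond big_ord_recl/= add0e [RHS]big_mkcond.
Qed.

Lemma pair_energy_ge0 (s : conf R d) : 0 <= pair_energy phi s.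
Proof. by apply: sume_ge0 => i _; apply: sume_ge0. Qed.

Lemma expeRND (x y : \bar R) : 0 <= x -> 0 <= y -> expeR (- (x + y)) = expeR (- x) * expeR (- y).
Proof. by move=> x0 y0; rewrite oppeD ?expeRD//; apply: ge0_adde_def; rewrite inE. Qed.

Lemma expeRN_klist (t : conf R d) (x : P) : (forall x, phi (- x)%R = phi x) ->
  expeR (- \sum_(z <- t) phi (x - z)%R) = (klist (kk phi) t x)%:E.
Proof.
move=> phiN; rewrite expeRN_sum// /klist -prodEFin; apply: eq_bigr => z _.
by rewrite /kk -ekE// -phiN opprB.
Qed.

Lemma bwE (a : P -> R) (s : conf R d) : (forall x, phi (- x)%R = phi x) ->
  (\prod_(x <- s) (a x)%:E) * expeR (- pair_energy phi s) = (bw (kk phi) a s)%:E.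
Proof.
move=> phiN; elim: s a => [|x s ih] a.
  by rewrite /pair_energy /= big_nil big_ord0 oppe0 expeR0 mule1.
rewrite pair_energy_cons big_cons expeRND ?pair_energy_ge0//; last by apply: sume_ge0.
rewrite /= EFinM -ih -!muleA; congr (_ * _); rewrite muleA; congr (_ * _).
under [in RHS]eq_bigr do rewrite EFinM.
rewrite big_split/= expeRN_sum//; congr (_ * _).
by apply: eq_bigr => z _; rewrite /kk ekE.
Qed.

End gibbs_weights.

(** * The one-step operator on test functions *)

Section block_operator.
Variables (R : realType) (d : nat) (phi : pt R d -> \bar R) (r lam : R).
Hypothesis d_gt0 : (0 < d)%N.
Hypothesis mphi : borel_efun phi.
Hypothesis phi0 : forall x, (0 <= phi x)%E.
Hypothesis phiN : forall x, phi (- x)%R = phi x.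
Hypothesis r0 : (0 <= r)%R.
Hypothesis phir : forall x, (r < enorm x)%R -> phi x = 0%E.
Hypothesis lam0 : (0 <= lam)%R.

Local Notation P := (ptT R d).
Local Notation mu := (lebd R d).
Local Notation kp := (kk phi).

Variables (n : nat) (lamf : P -> R) (L : R).
Implicit Types (F : lst P -> R).
Hypothesis n_gt0 : (0 < n)%N.
Hypothesis mlamf : measurable_fun setT lamf.
Hypothesis lamf01 : forall x, (0 <= lamf x <= lam)%R.
Hypothesis lamf_supp : forall x, ~ Lam n x -> lamf x = 0%R.

Let pk : pairfun kp. Proof. exact: pairfun_kk. Qed.

Lemma lebd_Lam : mu (@Lam R d n) = (volume R d n)%:E.
Proof. by rewrite Lam_cube lebd_cube// ltr0n muln_gt0. Qed.

Lemma volume_gt0 : (0 < volume R d n)%R.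
Proof. by rewrite exprn_gt0// ltr0n muln_gt0. Qed.

Lemma act_lamf : act mu lamf.
Proof.
split=> //; first by move=> x; case/andP: (lamf01 x).
have m1 : measurable_fun setT (fun w : P => (\1_(Lam n) w : R)%:E).
  by apply/measurable_EFinP; apply: measurable_indic; exact: measurable_Lam.
have lam0' : 0%R <= lam%:E by rewrite lee_fin.
have i0 (w : P) : setT w -> 0%R <= (\1_(Lam n) w : R)%:E by rewrite lee_fin.
apply: (@le_lt_trans _ _ (\int[mu]_x (lam%:E * (\1_(Lam n) x : R)%:E))).
  apply: ge0_le_integral => //.
  - by move=> x _; rewrite lee_fin; case/andP: (lamf01 x).
  - exact/measurable_EFinP.
  - exact: measurable_funeM.
  move=> x _; rewrite -EFinM lee_fin indicE; case: (boolP (x \in Lam n)) => xL.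
    by rewrite mulr1; case/andP: (lamf01 x).
  by rewrite lamf_supp ?mulr0//; move=> /mem_set; apply/negP.
rewrite (ge0_integralZl mu measurableT m1 i0 lam0').
have -> : \int[mu]_w (\1_(Lam n) w : R)%:E = (volume R d n)%:E.
  rewrite -lebd_Lam; transitivity (mu (Lam n `&` setT)); last by rewrite setIT.
  by apply: integral_indic => //; exact: measurable_Lam.
by rewrite -EFinM ltry.
Qed.

(** The boundary condition enters a block update only as a factor of the activity, so the update law
    is a Gibbs law of this activity without boundary. *)
Definition local_act (y : P) (X : lst P) (x : P) : R :=
  (lamf x * (enorm (x - y)%R < L)%R%:R * klist kp (outside L y X) x)%R.

Lemma in_ball_L (y x : P) : (x \in ball_L L y) = (enorm (x - y)%R < L)%R.
Proof. by apply/idP/idP; rewrite inE. Qed.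

Lemma outsideE (y : P) (X : lst P) : outside L y X = [seq x <- X | ~~ (enorm (x - y)%R < L)%R].
Proof. by apply: eq_filter => x; rewrite in_ball_L. Qed.

Lemma measurable_inball : measurable_fun setT (fun q : P * P => (enorm (q.2 - q.1)%R < L)%R).
Proof. by apply: measurable_fun_ltr => //; apply: measurable_dist. Qed.

Lemma measurable_outside : measurable_fun setT (fun q : P * lst P => outside L q.1 q.2 : lst P).
Proof.
rewrite (_ : (fun _ => _) = fun q : P * lst P => [seq x <- q.2 | ~~ (enorm (x - q.1)%R < L)%R]).
  apply: (measurable_lfilter (b := fun y x : P => ~~ (enorm (x - y)%R < L)%R)).
  exact: measurable_neg measurable_inball.
by apply/funext => q; exact: outsideE.
Qed.

Lemma measurable_local_act :
  measurable_fun setT (fun q : (P * lst P) * P => local_act q.1.1 q.1.2 q.2).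
Proof.
apply: measurable_funM; last first.
  apply: (measurable_comp2 (measurable_klist_param (measurable_kk mphi phi0))); first exact: measurable_snd.
  exact: (measurableT_comp measurable_outside measurable_fst).
apply: measurable_funM; first exact: (measurableT_comp mlamf measurable_snd).
apply: (measurableT_comp (f := fun b : bool => b%:R%R : R)) => //.
apply: (measurable_comp2 measurable_inball); last exact: measurable_snd.
exact: (measurableT_comp measurable_fst measurable_fst).
Qed.

Lemma act_local y X : act mu (local_act y X).
Proof.
apply: (act_le act_lamf).
  exact: (measurable_comp2 measurable_local_act (@measurable_cst _ _ P (P * lst P)%type setT (y, X)) (@measurable_id _ P setT)).
move=> x; have /andP[l0 _] := lamf01 x.
have [h0 h1] := (klist_ge0 pk (outside L y X) x, klist_le1 pk (outside L y X) x).
rewrite /local_act !mulr_ge0//= -mulrA ler_piMr//.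
by case: (_ < _)%R; rewrite ?mul1r ?mul0r ?ler01.
Qed.

Lemma local_act_le y X x : (local_act y X x <= lam)%R.
Proof.
have /andP[l0 l1] := lamf01 x; apply: le_trans l1.
have [h0 h1] := (klist_ge0 pk (outside L y X) x, klist_le1 pk (outside L y X) x).
rewrite /local_act -mulrA ler_piMr//.
by case: (_ < _)%R; rewrite ?mul1r ?mul0r ?ler01.
Qed.

Lemma local_act_neq0 y X x : local_act y X x != 0%R -> Lam n x /\ (enorm (x - y) < L)%R.
Proof.
rewrite /local_act !mulf_eq0 !negb_or => /andP[/andP[lx bx] _]; split.
  by apply: contrapT => /lamf_supp h; rewrite h eqxx in lx.
by move: bx; case: (_ < _)%R; rewrite ?eqxx.
Qed.

Lemma local_weightE y X s : local_weight phi lamf L y X s = (bw kp (local_act y X) s)%:E.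
Proof.
rewrite /local_weight /local_energy expeRND ?pair_energy_ge0//; last first.
  by apply: sume_ge0 => i _; apply: sume_ge0.
rewrite muleCA muleC -[RHS](bwE phi0)//; congr (_ * _).
  rewrite expeRN_sum; last by move=> x; apply: sume_ge0.
  rewrite -big_split/=; apply: eq_bigr => x _.
  by rewrite expeRN_klist// -EFinM /local_act indicE in_ball_L mulrC.
Qed.

(** A class of test functions that the chain preserves and that contains the indicators of events;
    symmetry reflects that counting events ignore the order of the points. *)
Definition good (F : lst P -> R) := bounded_by 1 F /\ symmetric_fun F.

Definition resample (F : lst P -> R) (y : P) (X : lst P) : R :=
  ER mu kp (local_act y X) (fun s => F (outside L y X ++ s)).

Definition average (F : lst P -> R) (X : lst P) : R :=
  ((volume R d n)^-1 * fine (\int[mu]_y (\1_(Lam n) y * resample F y X)%:E))%R.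

Lemma bounded_outside F y X : bounded_by 1 F ->
  bounded_by 1 (fun s : lst P => F (outside L y X ++ s)).
Proof.
move=> [mF F01]; split=> // ; apply: (measurableT_comp mF); exact: measurable_lcat.
Qed.

Lemma measurable_resample F : bounded_by 1 F ->
  measurable_fun setT (fun q : P * lst P => resample F q.1 q.2).
Proof.
move=> [mF F01]; have mk := measurable_kk mphi phi0.
rewrite (_ : (fun _ => _) = fun q : P * lst P => fine (
   (\int[poisson mu]_s (F (outside L q.1 q.2 ++ s) * bw kp (local_act q.1 q.2) s)%:E) *
   (powR (fine (\int[poisson mu]_s (bw kp (local_act q.1 q.2) s)%:E)) (-1))%:E)); last first.
  apply/funext => q; rewrite powR_inv1//; last by rewrite ltW// (Zr_gt0 pk (act_local q.1 q.2)).
have mb : measurable_fun setT (fun q : (P * lst P) * lst P => bw kp (local_act q.1.1 q.1.2) q.2).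
  exact: (measurable_bw_param (a := fun q : P * lst P => local_act q.1 q.2) mk measurable_local_act).
have b0 (q : (P * lst P) * lst P) : (0 <= bw kp (local_act q.1.1 q.1.2) q.2)%R.
  by apply: (bw_ge0 pk); case: (act_local q.1.1 q.1.2).
apply: (measurableT_comp (@fine_measurable R setT measurableT)); apply: emeasurable_funM.
  apply: (measurable_integral_sfinite (poisson mu)
    (f := fun q : (P * lst P) * lst P => (F (outside L q.1.1 q.1.2 ++ q.2) * bw kp (local_act q.1.1 q.1.2) q.2)%:E)).
    by move=> q; rewrite lee_fin mulr_ge0//; case/andP: (F01 (outside L q.1.1 q.1.2 ++ q.2)).
  apply/measurable_EFinP; apply: measurable_funM => //.
  apply: (measurableT_comp mF); apply: measurable_lcat; last exact: measurable_snd.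
  exact: (measurableT_comp measurable_outside measurable_fst).
apply/measurable_EFinP; apply: (measurableT_comp (@measurable_powR R (-1)%R)).
apply: (measurableT_comp (@fine_measurable R setT measurableT)).
apply: (measurable_integral_sfinite (poisson mu)
    (f := fun q : (P * lst P) * lst P => (bw kp (local_act q.1.1 q.1.2) q.2)%:E)).
  by move=> q; rewrite lee_fin.
exact/measurable_EFinP.
Qed.

Lemma resample01 F y X : bounded_by 1 F -> (0 <= resample F y X <= 1)%R.
Proof.
move=> bF; have bo := bounded_outside y X bF; have al := act_local y X.
by rewrite (ER_ge0 pk al bo) (ER_le_cst pk al bo).
Qed.

Lemma perm_outside y (X X' : lst P) : perm_eq X X' -> perm_eq (outside L y X) (outside L y X').
Proof. exact: perm_filter. Qed.

Lemma resample_sym F y : good F -> symmetric_fun (resample F y).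
Proof.
move=> [_ sF] X X' XX'; have h := perm_outside y XX'; rewrite /resample.
rewrite (_ : local_act y X = local_act y X').
  congr ER; apply/funext => s; apply: sF; exact: perm_cat.
apply/funext => x; rewrite /local_act; congr (_ * _)%R; exact: perm_big.
Qed.

Lemma measurable_Lam_resample F (X : lst P) : bounded_by 1 F ->
  measurable_fun setT (fun y : P => (\1_(Lam n) y * resample F y X)%:E).
Proof.
move=> bF; apply/measurable_EFinP; apply: measurable_funM.
  by apply: measurable_indic; exact: measurable_Lam.
exact: (measurable_comp2 (measurable_resample bF) (@measurable_id _ P setT) (@measurable_cst _ _ P (lst P) setT X)).
Qed.

Lemma integral_Lam : \int[mu]_y (\1_(Lam n) y : R)%:E = (volume R d n)%:E.
Proof.
rewrite -lebd_Lam; transitivity (mu (Lam n `&` setT)); last by rewrite setIT.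
by apply: integral_indic => //; exact: measurable_Lam.
Qed.

Lemma integral_resample_le F (X : lst P) : bounded_by 1 F ->
  0 <= \int[mu]_y (\1_(Lam n) y * resample F y X)%:E <= (volume R d n)%:E.
Proof.
move=> bF; have p0 y : 0%R <= (\1_(Lam n) y * resample F y X)%:E.
  by rewrite lee_fin mulr_ge0//; case/andP: (resample01 y X bF).
apply/andP; split; first by apply: integral_ge0.
rewrite -integral_Lam; apply: ge0_le_integral => //.
- exact: measurable_Lam_resample.
- by apply/measurable_EFinP; apply: measurable_indic; exact: measurable_Lam.
by move=> y _; rewrite lee_fin ler_piMr//; case/andP: (resample01 y X bF).
Qed.

Lemma averageE F X : bounded_by 1 F ->
  (average F X)%:E = ((volume R d n)^-1)%:E * \int[mu]_y (\1_(Lam n) y * resample F y X)%:E.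
Proof.
move=> bF; have /andP[h0 h1] := integral_resample_le X bF.
by rewrite EFinM fineK// ge0_fin_numE//; exact: le_lt_trans h1 (ltry _).
Qed.

Lemma good_average F : good F -> good (average F).
Proof.
move=> gF; have [bF sF] := gF; have N0 := volume_gt0; split; last first.
  move=> X X' XX'; rewrite /average.
  suff -> : (fun y : P => (\1_(Lam n) y * resample F y X)%:E) =
      (fun y : P => (\1_(Lam n) y * resample F y X')%:E) by [].
  by apply/funext => y; rewrite (resample_sym y gF XX').
split; last first.
  move=> X; have /andP[h0 h1] := integral_resample_le X bF.
  rewrite -!lee_fin averageE//; apply/andP; split.
    by rewrite mule_ge0// lee_fin invr_ge0 ltW.
  by rewrite -(mulVf (lt0r_neq0 N0)) EFinM lee_wpmul2l// lee_fin invr_ge0 ltW.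
apply: measurable_funM => //; apply: (measurableT_comp (@fine_measurable R setT measurableT)).
apply: (measurable_integral_sfinite mu (f := fun q : lst P * P => (\1_(Lam n) q.2 * resample F q.2 q.1)%:E)).
  by move=> q; rewrite lee_fin mulr_ge0//; case/andP: (resample01 q.2 q.1 bF).
apply/measurable_EFinP; apply: measurable_funM.
  by apply: (measurableT_comp _ measurable_snd); apply: measurable_indic; exact: measurable_Lam.
exact: (measurable_comp2 (measurable_resample bF) measurable_snd measurable_fst).
Qed.

Lemma block_stepE F X : good F ->
  block_step phi lamf n L (fun Y => (F Y)%:E) X = (average F X)%:E.
Proof.
move=> [bF sF]; have [mF F01] := bF; rewrite averageE// /block_step.
have wE y : (\1_(Lam n) y)%:E *
    (poisson_sum (fun s => (F (outside L y X ++ s))%:E * local_weight phi lamf L y X s) *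
     ((fine (poisson_sum (local_weight phi lamf L y X)))^-1)%:E) =
    (\1_(Lam n) y * resample F y X)%:E.
  have al := act_local y X; have [mb mo] := (measurable_bwE pk al, bounded_outside y X bF).
  rewrite EFinM; congr (_ * _); rewrite /resample -(EE_ER pk al mo) /EE.
  have -> : local_weight phi lamf L y X = fun s : lst P => (bw kp (local_act y X) s)%:E.
    by apply/funext => s; exact: local_weightE.
  have b0 s : 0%R <= (bw kp (local_act y X) s)%:E by exact: (bwe_ge0 pk _ al).
  rewrite (poisson_sumE b0 mb) (poisson_sumE (F := fun s => (F (outside L y X ++ s))%:E * (bw kp (local_act y X) s)%:E))//.
    by move=> s; rewrite mule_ge0// lee_fin; case/andP: (F01 (outside L y X ++ s)).
  by apply: emeasurable_funM => //; apply/measurable_EFinP; case: mo.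
rewrite (_ : (fun y => _) = fun y : P => (\1_(Lam n) y * resample F y X)%:E); last first.
  by apply/funext => y; exact: wE.
rewrite int_ptE//; last exact: measurable_Lam_resample.
by move=> y; rewrite lee_fin mulr_ge0//; case/andP: (resample01 y X bF).
Qed.

End block_operator.

(** * Volumes of balls cut by the box *)

Section ball_volume.
Variables (R : realType) (d n : nat) (q : pt R d).
Hypothesis n_gt0 : (0 < n)%N.
Hypothesis qL : Lam n q.
Local Notation P := (ptT R d).
Local Notation mu := (lebd R d).

Definition ball_ind (rho : R) (y : P) : R := (\1_(Lam n) y * (enorm (y - q)%R < rho)%R%:R)%R.

Definition ball_vol (rho : R) : R := fine (\int[mu]_y (ball_ind rho y)%:E).

Lemma ball_ind01 rho y : (0 <= ball_ind rho y <= \1_(Lam n) y)%R.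
Proof. by rewrite /ball_ind mulr_ge0//= ler_piMr//; case: (_ < _)%R. Qed.

Lemma measurable_ball_ind rho : measurable_fun setT (fun y : P => (ball_ind rho y)%:E).
Proof.
apply/measurable_EFinP; apply: measurable_funM.
  by apply: measurable_indic; exact: measurable_Lam.
apply: (measurableT_comp (f := fun b : bool => b%:R%R : R)) => //.
by apply: measurable_fun_ltr => //; exact: measurable_dist1.
Qed.

Lemma ball_volE rho : \int[mu]_y (ball_ind rho y)%:E = (ball_vol rho)%:E.
Proof.
rewrite /ball_vol fineK// ge0_fin_numE; last first.
  by apply: integral_ge0 => y _; rewrite lee_fin; case/andP: (ball_ind01 rho y).
apply: (@le_lt_trans _ _ (volume R d n)%:E); last exact: ltry.
rewrite -integral_Lam//; apply: ge0_le_integral => //.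
- by move=> y _; rewrite lee_fin; case/andP: (ball_ind01 rho y).
- exact: measurable_ball_ind.
- by apply/measurable_EFinP; apply: measurable_indic; exact: measurable_Lam.
by move=> y _; rewrite lee_fin; case/andP: (ball_ind01 rho y).
Qed.

Lemma ball_vol_ge1 rho : (d%:R < rho)%R -> (1 <= ball_vol rho)%R.
Proof.
(* A unit cube with vertex q, directed in each coordinate towards the origin: it stays in Lambda_n
   because n >= 1, and its points are within d of q. *)
move=> drho; pose l : pt R d := \row_(i < d) (if (q ord0 i <= 0)%R then q ord0 i else q ord0 i - 1)%R.
have n1 : (1 <= n%:R :> R)%R by rewrite ler1n.
have lL x : cube l 1 x -> Lam n x /\ (enorm (x - q)%R < rho)%R.
  move=> xl; have h i : (`|x ord0 i| <= n%:R /\ `|x ord0 i - q ord0 i| <= 1)%R.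
    have := xl i; have := qL i; rewrite mxE !ler_norml.
    by case: ifP => [|/negbT]; rewrite -?ltNge => h1 /andP[? ?] /andP[? ?]; split; apply/andP; split; lra.
  split; first by move=> i; case: (h i).
  apply: le_lt_trans drho; rewrite -[leRHS]mulr1; apply: enorm_le_sup => // i.
  by rewrite !mxE; case: (h i).
rewrite -lee_fin -ball_volE -(expr1n R d) -(lebd_cube l ltr01).
have -> : mu (cube l 1) = \int[mu]_y (\1_(cube l 1) y : R)%:E.
  transitivity (mu (cube l 1 `&` setT)); first by rewrite setIT.
  by apply/esym/integral_indic => //; exact: measurable_cube.
apply: ge0_le_integral => //.
- by apply/measurable_EFinP; apply: measurable_indic; exact: measurable_cube.
- exact: measurable_ball_ind.
move=> y _; rewrite lee_fin indicE; case: (boolP (y \in cube l 1)) => yl.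
  have [yL yq] := lL _ (set_mem yl); rewrite /ball_ind yq indicE.
  by rewrite mem_set// mulr1.
by case/andP: (ball_ind01 rho y).
Qed.

(* Lam n is star-shaped about q, so contracting about q by the factor rho / rho' maps the
   larger set into the smaller one. *)
Lemma ball_vol_scale rho rho' : (0 < rho <= rho')%R ->
  (ball_vol rho' <= (rho' / rho) ^+ d * ball_vol rho)%R.
Proof.
move=> /andP[rho0 rr]; pose c := (rho' / rho)%R.
have c1 : (1 <= c)%R by rewrite ler_pdivlMr// mul1r.
have c0 : (0 < c)%R by exact: lt_le_trans c1.
rewrite -lee_fin EFinM -!ball_volE.
have b0 rho1 y : 0%R <= (ball_ind rho1 y)%:E by rewrite lee_fin; case/andP: (ball_ind01 rho1 y).
rewrite (lebd_affine (q - c *: q)%R c0 (b0 rho') (measurable_ball_ind rho')).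
apply: lee_wpmul2l; first by rewrite lee_fin exprn_ge0// ltW.
apply: ge0_le_integral => //.
- exact: (measurableT_comp (measurable_ball_ind rho') (measurable_pt_affine (q - c *: q)%R c)).
- exact: measurable_ball_ind.
move=> x _; rewrite lee_fin /ball_ind.
have e : (q - c *: q + c *: x - q = c *: (x - q))%R.
  by rewrite scalerBr addrAC [(q - _)%R]addrC addrK addrC.
rewrite e enormZ ger0_norm ?(ltW c0)//.
have -> : (c * enorm (x - q)%R < rho')%R = (enorm (x - q)%R < rho)%R.
  by rewrite mulrC -ltr_pdivlMr// /c invf_div mulrCA mulfV ?mulr1// gt_eqF// (lt_le_trans rho0).
rewrite ler_wpM2r// !indicE; case: (boolP (_ \in _)) => // /set_mem yL.
suff -> : x \in Lam n by [].
apply/mem_set => i; have := yL i; have := qL i; rewrite !mxE !ler_norml.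
move=> /andP[? ?] /andP[? ?].
have e2 : (c * x ord0 i = (q ord0 i - c * q ord0 i + c * x ord0 i) + (c - 1) * q ord0 i)%R by ring.
apply/andP; split; rewrite -(ler_pM2l c0) e2; nra.
Qed.

End ball_volume.

Local Close Scope ereal_scope.

(** Here v and v' are the volumes of the inner and the outer ball, cut by Lambda_n. The loss K (v' -
    v) on the annulus is at most v / 2 against the gain v in the inner ball, and v >= 1 leaves at
    least 1/2: this is the 1/2 in the rate 1 - 1/(2N). *)
Lemma thin_gain (R : realType) (K D v v' c I I' N : R) : 0 <= K -> 0 <= D -> 1 <= v ->
  v' <= c * v -> K * (c - 1) <= 2^-1 ->
  I + (1 + K) * D * v <= I' + (D * N + K * D * v') -> I <= I' + (D * N - D / 2).
Proof.
move=> K0 D0 v1 vs thin key.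
have h1 : K * v' - K * v <= v / 2.
  have h : K * v' <= K * (c * v) by rewrite ler_wpM2l.
  have h' : K * (c - 1) * v <= 2^-1 * v by rewrite ler_wpM2r// (le_trans _ v1).
  lra.
have h2 : 0 <= D * ((v / 2) - (K * v' - K * v)) by rewrite mulr_ge0// subr_ge0.
have h3 : 0 <= D * (v - 1) by rewrite mulr_ge0// subr_ge0.
lra.
Qed.

(** * One-step contraction of the oscillation *)

Section one_step_contraction.
Variables (R : realType) (d : nat) (phi : pt R d -> \bar R) (r lam : R).
Hypothesis d_gt0 : (0 < d)%N.
Hypothesis mphi : borel_efun phi.
Hypothesis phi0 : forall x, (0 <= phi x)%E.
Hypothesis phiN : forall x, phi (- x) = phi x.
Hypothesis r0 : 0 < r.
Hypothesis phir : forall x, r < enorm x -> phi x = 0%E.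
Hypothesis lam0 : 0 <= lam.

Local Notation P := (ptT R d).
Local Notation mu := (lebd R d).
Local Notation kp := (kk phi).

Variables (k : nat) (theta : R).
Hypothesis k_gt0 : (0 < k)%N.
Hypothesis theta0 : 0 <= theta.
Hypothesis mixing : forall l (a a' : P -> R) v, act mu a -> act mu a' ->
  (forall x, a x <= lam) ->
  (forall x, enorm (x - v) <= l%:R * (k%:R * r) -> a x = a' x) ->
  `|ins phi a v - ins phi a' v| <= 2 * theta ^+ l.

Variables (K L : R).
Hypothesis K0 : 0 <= K.
Let rho0 : R := d%:R + r.
Hypothesis shell_sum : forall T, 2 * (ball_cells d (rho0 + r))%:R +
  \sum_(t < T) 2 * (ball_cells d (rho0 + r + t.+1%:R * (k%:R * r)))%:R *
    (expR (4 * lam * (2 * rho0) ^+ d * theta ^+ t) - 1) <= K.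
(** For |y - q| < [rin] the block contains every point within d of q; for |y - q| >= [rout] none of
    these interacts with the block. Likewise [rho0] is the distance from q beyond which the two
    local activities agree. *)
Let rin : R := L - d%:R.
Let rout : R := L + d%:R + r.
Hypothesis rin_gt : d%:R < rin.
Hypothesis thin : K * ((rout / rin) ^+ d - 1) <= 2^-1.

Variables (n : nat) (lamf : P -> R).
Hypothesis n_gt0 : (0 < n)%N.
Hypothesis mlamf : measurable_fun setT lamf.
Hypothesis lamf01 : forall x, 0 <= lamf x <= lam.
Hypothesis lamf_supp : forall x, ~ Lam n x -> lamf x = 0.

Variables (F : lst P -> R) (D : R).
Hypothesis bF : bounded_by 1 F.
Hypothesis sF : symmetric_fun F.
Hypothesis oF : osc_le n F D.
Hypothesis D0 : 0 <= D.

Variables (q : pt R d) (X X' : lst P).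
Hypothesis qL : Lam n q.
Hypothesis XL : in_Lam n X.
Hypothesis XL' : in_Lam n X'.
Hypothesis agree : [seq x <- X | far_from q x] = [seq x <- X' | far_from q x].

Let pk : pairfun kp. Proof. exact: pairfun_kk. Qed.
Let rge0 : 0 <= r. Proof. exact: ltW. Qed.
Let dge0 : 0 <= d%:R :> R. Proof. by []. Qed.
Let rin_le_rout : rin <= rout.
Proof. by rewrite /rin /rout; move: rge0 dge0; lra. Qed.
Let d0r : 0 < rho0. Proof. by rewrite /rho0 ltr_wpDl. Qed.

Local Notation la := (local_act phi lamf L).
Local Notation res := (resample phi lamf L F).

Let acts y Y : act mu (la y Y).
Proof. exact: (act_local mphi phi0 phiN lam0 L n_gt0 mlamf lamf01 lamf_supp). Qed.

Let outside_agree y : [seq x <- outside L y X | far_from q x] = [seq x <- outside L y X' | far_from q x].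
Proof.
have h Y : [seq x <- outside L y Y | far_from q x] =
    [seq x <- [seq x <- Y | far_from q x] | x \notin ball_L L y].
  by rewrite /outside -!filter_predI; apply: eq_filter => x /=; rewrite andbC.
by rewrite !h agree.
Qed.

Let outL y (Y : seq (pt R d)) : in_Lam n Y -> in_Lam n (outside L y Y : seq (pt R d)).
Proof. exact: in_Lam_filter. Qed.

Let klist_agree y x : (forall z, enorm (z - q) <= d%:R -> kp z x = 1) ->
  klist kp (outside L y X) x = klist kp (outside L y X') x.
Proof.
move=> h; have e Y : klist kp Y x = klist kp [seq z <- Y | far_from q z] x.
  rewrite /klist big_filter [RHS]big_mkcond; apply: eq_bigr => z _.
  by case: (boolP (far_from q z)) => //; rewrite /far_from -leNgt => /h.
by rewrite e outside_agree -e.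
Qed.

Let resample_inner y : enorm (y - q) < rin -> res y X = res y X'.
Proof.
move=> yq; have e : outside L y X = outside L y X'.
  have h Y : outside L y Y = [seq x <- [seq x <- Y | far_from q x] | x \notin ball_L L y].
    rewrite /outside -filter_predI; apply: eq_filter => x /=.
    case: (boolP (far_from q x)); rewrite ?andbT ?andbF// /far_from -leNgt => xq.
    apply/negbTE; rewrite negbK in_ball_L.
    have := enorm_triangle x q y; rewrite (enormB q); move: yq; rewrite /rin; lra.
  by rewrite h agree -h.
by rewrite /resample /local_act e.
Qed.

Let F_outside y (Y : seq (pt R d)) (s : lst P) (b : P -> R) : act mu b -> (forall x, b x != 0 -> Lam n x) -> in_Lam n Y -> bw kp b s != 0 ->
  in_Lam n (outside L y Y ++ s : seq (pt R d)).
Proof. by move=> _ bL YL /bw_neq0 bs; apply: in_Lam_cat; [exact: outL|move=> x /bs /bL]. Qed.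

Let la_Lam y Y x : la y Y x != 0 -> Lam n x.
Proof. by case/(local_act_neq0 lamf_supp). Qed.

Let bo y Y : bounded_by 1 (fun s : lst P => F (outside L y Y ++ s)).
Proof. exact: bounded_outside. Qed.

Let change_outside y b : act mu b -> (forall x, b x != 0 -> Lam n x) ->
  ER mu kp b (fun s => F (outside L y X ++ s)) <= ER mu kp b (fun s => F (outside L y X' ++ s)) + D.
Proof.
move=> ab bL; apply: (le_ER_shift pk ab (bo y X) (bo y X') D0) => s s0.
apply: (oF qL); [exact: (F_outside ab bL XL s0)|exact: (F_outside ab bL XL' s0)|].
by rewrite !filter_cat outside_agree.
Qed.

Let resample_outer y : rout <= enorm (y - q) -> res y X <= res y X' + D.
Proof.
move=> yq; rewrite /resample (_ : la y X = la y X'); first exact: (change_outside y (acts y X') (@la_Lam y X')).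
apply/funext => x; rewrite /local_act; case: (ltP (enorm (x - y)) L) => xy; last by rewrite !mulr0 !mul0r.
congr (_ * _); apply: klist_agree => z zq; apply: (kk_far phir).
have := enorm_triangle y x q; have := enorm_triangle x z q.
rewrite (enormB y x) (enormB x z); move: yq zq xy; rewrite /rout; lra.
Qed.

(** Two changes in turn: the local activity, at cost K D by [shell_comparison], then the retained
    exterior configuration, at cost D. *)
Let resample_annulus y : enorm (y - q) < rout -> res y X <= res y X' + (1 + K) * D.
Proof.
move=> yq.
have kr : r <= k%:R * r by rewrite ler_peMl// ler1n.
have L0 : 0 <= L by move: rin_gt dge0; rewrite /rin; lra.
have ro0 : 0 <= (L + rout) / r by rewrite divr_ge0// /rout; move: rge0 dge0 L0; lra.
(* Enough shells to cover the block, which lies within L + rout of q. [shell_sum] holds for every T,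
   so this dependence on L does not affect K. *)
pose T := (Num.truncn ((L + rout) / r)).+1.
have TL : L + rout <= T%:R * (k%:R * r).
  have /andP[_ h] := truncn_itv ro0; apply: (@le_trans _ _ (T%:R * r)); last by rewrite ler_wpM2l.
  by rewrite -ler_pdivrMr// ltW.
have radius Y x : la y Y x != 0 -> enorm (x - q) <= rho0 + r + T%:R * (k%:R * r).
  move=> /(local_act_neq0 lamf_supp)[_ xy]; have := enorm_triangle x y q.
  by move: yq xy TL (ltW d0r) rge0; lra.
have la_agree x : rho0 < enorm (x - q) -> la y X x = la y X' x.
  move=> xq; rewrite /local_act; congr (_ * _); apply: klist_agree => z zq; apply: (kk_far phir).
  have := enorm_triangle x z q; rewrite (enormB x z); move: xq zq; rewrite /rho0; lra.
have la_le Y x : la y Y x <= lam by exact: (local_act_le mphi phi0 phiN L lamf01).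
have h := shell_comparison d_gt0 mphi phi0 phiN rge0 phir lam0 theta0 mixing d0r bF sF oF D0 (@outL y X XL)
  (acts y X) (acts y X') (la_le X) (la_le X') (@la_Lam y X) (@la_Lam y X') la_agree (radius X) (radius X').
have h2 := change_outside y (acts y X') (@la_Lam y X').
apply: (le_trans h); rewrite [(1 + K) * D]mulrDl mul1r addrA; apply: lerD; first exact: h2.
by rewrite ler_wpM2r.
Qed.

(** The inner, annular and outer regions in one inequality with indicators, ready for integration
    over y. *)
Let resample_le y : res y X + (1 + K) * D * (enorm (y - q) < rin)%R%:R <=
  res y X' + (D + K * D * (enorm (y - q) < rout)%R%:R).
Proof.
have KD : 0 <= K * D by rewrite mulr_ge0.
have [yin|yin] := ltP (enorm (y - q)) rin.
  have yout : enorm (y - q) < rout by exact: lt_le_trans yin rin_le_rout.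
  by rewrite yout !mulr1 resample_inner// mulrDl mul1r.
rewrite mulr0 addr0; have [yout|yout] := ltP (enorm (y - q)) rout.
  by rewrite mulr1; have := resample_annulus yout; rewrite mulrDl mul1r.
by rewrite mulr0 addr0; exact: resample_outer.
Qed.

Lemma average_contracts :
  average phi n lamf L F X <= average phi n lamf L F X' + D * (1 - (2 * volume R d n)^-1).
Proof.
have N0 := volume_gt0 R d n_gt0; have KD : 0 <= K * D by rewrite mulr_ge0.
have KD1 : 0 <= (1 + K) * D by rewrite mulr_ge0// addr_ge0.
pose I Y : R := fine (\int[mu]_y (\1_(Lam n) y * res y Y)%:E).
have res01 y Y : 0 <= res y Y <= 1.
  exact: (resample01 mphi phi0 phiN lam0 L n_gt0 mlamf lamf01 lamf_supp).
have mres Y : measurable_fun setT (fun y : P => (\1_(Lam n) y * res y Y)%:E).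
  exact: (measurable_Lam_resample mphi phi0 phiN lam0 L n_gt0 mlamf lamf01 lamf_supp).
have p0 Y y : setT y -> (0%R <= (\1_(Lam n) y * res y Y)%:E)%E.
  by rewrite lee_fin mulr_ge0//; case/andP: (res01 y Y).
have IE Y : (\int[mu]_y (\1_(Lam n) y * res y Y)%:E = (I Y)%:E)%E.
  have /andP[h0 h1] := integral_resample_le mphi phi0 phiN lam0 L n_gt0 mlamf lamf01 lamf_supp Y bF.
  by rewrite /I fineK// ge0_fin_numE//; exact: le_lt_trans h1 (ltry _).
pose vol := ball_vol n q.
have mball rho : measurable_fun setT (fun y : P => (ball_ind n q rho y)%:E).
  exact: measurable_ball_ind.
have b0 rho (y : P) : setT y -> (0%R <= (ball_ind n q rho y)%:E)%E.
  by rewrite lee_fin; case/andP: (ball_ind01 n q rho y).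
have scaled (c : R) rho : 0 <= c ->
    (\int[mu]_y (c%:E * (ball_ind n q rho y)%:E) = (c * vol rho)%:E)%E.
  move=> c0; have c0' : (0%R <= c%:E)%E by rewrite lee_fin.
  by rewrite (ge0_integralZl mu measurableT (mball rho) (b0 rho) c0') ball_volE.
have mLam : measurable_fun setT (fun y : P => (\1_(Lam n) y : R)%:E).
  by apply/measurable_EFinP; apply: measurable_indic; exact: measurable_Lam.
have Lam0 (y : P) : setT y -> (0%R <= (\1_(Lam n) y : R)%:E)%E by rewrite lee_fin.
have D0' : (0%R <= D%:E)%E by rewrite lee_fin.
have s0 c rho (y : P) : (0 <= c)%R -> setT y -> (0%R <= c%:E * (ball_ind n q rho y)%:E)%E.
  by move=> c0 yT; rewrite mule_ge0 ?b0.
have ms c rho : measurable_fun setT (fun y : P => c%:E * (ball_ind n q rho y)%:E)%E.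
  exact: measurable_funeM.
have D1 (y : P) : setT y -> (0%R <= D%:E * (\1_(Lam n) y : R)%:E)%E.
  by move=> yT; rewrite mule_ge0// Lam0.
have mD : measurable_fun setT (fun y : P => D%:E * (\1_(Lam n) y : R)%:E)%E.
  exact: measurable_funeM.
pose lhs (y : P) := ((\1_(Lam n) y * res y X)%:E + ((1 + K) * D)%:E * (ball_ind n q rin y)%:E)%E.
pose rhs0 (y : P) := (D%:E * (\1_(Lam n) y : R)%:E + (K * D)%:E * (ball_ind n q rout y)%:E)%E.
pose rhs (y : P) := ((\1_(Lam n) y * res y X')%:E + rhs0 y)%E.
have lhsE : (\int[mu]_y lhs y = (I X + (1 + K) * D * vol rin)%:E)%E.
  rewrite [LHS](ge0_integralD mu measurableT (p0 X) (mres X) (fun y => s0 _ rin y KD1) (ms _ rin)).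
  by rewrite IE (scaled _ _ KD1) -EFinD.
have rhs0E : (\int[mu]_y rhs0 y = (D * volume R d n + K * D * vol rout)%:E)%E.
  rewrite [LHS](ge0_integralD mu measurableT D1 mD (fun y => s0 _ rout y KD) (ms _ rout)).
  by rewrite (scaled _ _ KD) (ge0_integralZl mu measurableT mLam Lam0 D0') integral_Lam// -EFinM -EFinD.
have mrhs0 : measurable_fun setT rhs0 by exact: emeasurable_funD.
have rhs00 (y : P) : setT y -> (0%R <= rhs0 y)%E.
  by move=> yT; apply: adde_ge0; [exact: D1|exact: s0].
have rhsE : (\int[mu]_y rhs y = (I X' + (D * volume R d n + K * D * vol rout))%:E)%E.
  rewrite [LHS](ge0_integralD mu measurableT (p0 X') (mres X') rhs00 mrhs0).
  by rewrite IE rhs0E -EFinD.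
have key : I X + (1 + K) * D * vol rin <= I X' + (D * volume R d n + K * D * vol rout).
  rewrite -lee_fin -lhsE -rhsE; apply: ge0_le_integral => //.
  - by move=> y yT; apply: adde_ge0; [exact: p0|exact: s0].
  - exact: emeasurable_funD.
  - exact: emeasurable_funD.
  move=> y _; rewrite /lhs /rhs /rhs0 -!EFinM -!EFinD lee_fin /ball_ind.
  have i0 : 0 <= (\1_(Lam n) y : R) by [].
  move: (ler_wpM2l i0 (resample_le y)); rewrite !mulrDr; congr (_ <= _); congr (_ + _).
    by rewrite mulrCA.
  by congr (_ + _); [rewrite mulrC|rewrite mulrCA].
have v1 : 1 <= vol rin by exact: ball_vol_ge1.
have rin0 : 0 < rin by exact: le_lt_trans rin_gt.
have vs : vol rout <= (rout / rin) ^+ d * vol rin.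
  by apply: ball_vol_scale => //; rewrite rin0 rin_le_rout.
have e : D * (1 - (2 * volume R d n)^-1) = (volume R d n)^-1 * (D * volume R d n - D / 2).
  by field; rewrite gt_eqF.
rewrite e /average -mulrDr; apply: ler_wpM2l; first by rewrite invr_ge0 ltW.
exact: thin_gain K0 D0 v1 vs thin key.
Qed.

End one_step_contraction.

(** * Stationarity of the Gibbs law *)

Local Open Scope ereal_scope.

Section stationarity.
Variables (R : realType) (d : nat) (phi : pt R d -> \bar R) (lam : R).
Hypothesis mphi : borel_efun phi.
Hypothesis phi0 : forall x, 0 <= phi x.
Hypothesis phiN : forall x, phi (- x)%R = phi x.
Hypothesis lam0 : (0 <= lam)%R.

Local Notation P := (ptT R d).
Local Notation mu := (lebd R d).
Local Notation kp := (kk phi).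

Variables (n : nat) (lamf : P -> R) (L : R).
Hypothesis n_gt0 : (0 < n)%N.
Hypothesis mlamf : measurable_fun setT lamf.
Hypothesis lamf01 : forall x, (0 <= lamf x <= lam)%R.
Hypothesis lamf_supp : forall x, ~ Lam n x -> lamf x = 0%R.

Variable F : lst P -> R.
Hypothesis gF : good F.

Let bF : bounded_by 1 F. Proof. by case: gF. Qed.
Let sF : symmetric_fun F. Proof. by case: gF. Qed.
Let mF : measurable_fun setT F. Proof. by case: bF. Qed.
Let F0 s : (0 <= F s)%R. Proof. by case/andP: (bF.2 s). Qed.

Let pk : pairfun kp. Proof. exact: pairfun_kk. Qed.
Let al : act mu lamf. Proof. exact: (act_lamf lam0 n_gt0 mlamf lamf01 lamf_supp). Qed.
Local Notation la := (local_act phi lamf L).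
Let acts y X : act mu (la y X).
Proof. exact: (act_local mphi phi0 phiN lam0 L n_gt0 mlamf lamf01 lamf_supp). Qed.
Local Notation res := (resample phi lamf L F).

Let res01 y X : (0 <= res y X <= 1)%R.
Proof. exact: (resample01 mphi phi0 phiN lam0 L n_gt0 mlamf lamf01 lamf_supp). Qed.
Let mres : measurable_fun setT (fun q : P * lst P => res q.1 q.2).
Proof. exact: (measurable_resample mphi phi0 phiN lam0 L n_gt0 mlamf lamf01 lamf_supp). Qed.
Let mbw : measurable_fun setT (bw kp lamf : lst P -> R).
Proof. by apply/measurable_EFinP; exact: (measurable_bwE pk al). Qed.
Let bw0 s : (0 <= bw kp lamf s)%R. Proof. by apply: (bw_ge0 pk); case: al. Qed.

Section fixed_center.
Variable y : P.

Let inB (x : P) : bool := (enorm (x - y)%R < L)%R.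
Let minB : measurable_fun setT inB.
Proof. by apply: measurable_fun_ltr => //; exact: measurable_dist1. Qed.

Let outside_id t : all (predC inB) t -> outside L y t = t.
Proof. by rewrite outsideE => /all_filterP. Qed.

Let outside_cat s t : all inB s -> all (predC inB) t -> outside L y (s ++ t) = t.
Proof.
move=> sB tB; rewrite outsideE filter_cat (eq_in_filter (a2 := pred0)); last first.
  by move=> x /(allP sB) xB; rewrite -/(inB x) xB.
by rewrite filter_pred0/= -outsideE outside_id.
Qed.

Let c t : R := (bw kp lamf t * (all (predC inB) t)%:R)%R.
Let c0 t : (0 <= c t)%R. Proof. by rewrite mulr_ge0. Qed.

(** The spatial Markov property of the Gibbs weight: given the points t outside the block, the
    points s inside are weighted by the local activity. [splitw] restricts to such pairs. *)
Let bw_split s t : (bw kp lamf (s ++ t) * splitw R inB s t = c t * bw kp (la y t) s)%R.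
Proof.
rewrite /c /splitw andbC; case: (boolP (all (predC inB) t)) => [tB|_]; last by rewrite !mulr0 mul0r.
rewrite mulr1/= (bw_perm pk lamf (s := s ++ t) (t := t ++ s)); last by rewrite perm_catC.
rewrite bw_cat -mulrA; congr (_ * _)%R; have := bw_conditioned kp (predC inB) lamf t s.
rewrite (eq_all (a2 := inB)); last by move=> x /=; rewrite negbK.
move=> <-; apply: eq_bw => x _; rewrite /conditioned /local_act outside_id//= negbK.
by rewrite mulrAC.
Qed.

Let Z t : R := Zr mu kp (la y t).

Let local_integral t : \int[poisson mu]_s ((F (outside L y t ++ s))%:E * (bw kp (la y t) s)%:E) =
  (res y t * Z t)%:E.
Proof.
have Zp := Zr_gt0 pk (acts y t).
have := EE_ER pk (acts y t) (bounded_outside L y t bF).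
rewrite -/(resample phi lamf L F y t) /EE EFinM => <-.
by rewrite -muleA -EFinM mulVf ?mule1// gt_eqF.
Qed.

(** The DLR equation for one ball. Splitting the configuration into s inside and t outside, [res]
    depends on t alone, and integrating either side over s gives [c t] times [res y t * Z t]. *)
Lemma resample_stationary : \int[poisson mu]_t (res y t * bw kp lamf t)%:E =
  \int[poisson mu]_t (F t * bw kp lamf t)%:E.
Proof.
have mresy : measurable_fun setT (fun t : lst P => res y t).
  exact: (measurable_comp2 mres (@measurable_cst _ _ (lst P) P setT y) (@measurable_id _ (lst P) setT)).
have sres := resample_sym phi lamf L y gF.
have p1 (t : lst P) : 0%R <= (res y t * bw kp lamf t)%:E.
  by rewrite lee_fin mulr_ge0//; case/andP: (res01 y t).
have p2 (t : lst P) : 0%R <= (F t * bw kp lamf t)%:E by rewrite lee_fin mulr_ge0.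
have m1 : measurable_fun setT (fun t : lst P => (res y t * bw kp lamf t)%:E).
  by apply/measurable_EFinP; apply: measurable_funM.
have m2 : measurable_fun setT (fun t : lst P => (F t * bw kp lamf t)%:E).
  by apply/measurable_EFinP; apply: measurable_funM.
have s1 : symmetric_fun (fun t : lst P => (res y t * bw kp lamf t)%:E).
  by move=> s t st; congr (_ * _)%:E; [exact: sres|exact: (bw_perm pk)].
have s2 : symmetric_fun (fun t : lst P => (F t * bw kp lamf t)%:E).
  by move=> s t st; congr (_ * _)%:E; [exact: sF|exact: (bw_perm pk)].
rewrite [LHS](integral_poisson_split mu minB p1 m1 s1) [RHS](integral_poisson_split mu minB p2 m2 s2).
apply: eq_integral => t _.
have mbl := measurable_bwE pk (acts y t).
have bl0 s : setT s -> 0%R <= (bw kp (la y t) s)%:E by move=> _; exact: (bwe_ge0 pk _ (acts y t)).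
have mfl : measurable_fun setT (fun s : lst P => (F (outside L y t ++ s))%:E * (bw kp (la y t) s)%:E).
  by apply: emeasurable_funM => //; apply/measurable_EFinP; case: (bounded_outside L y t bF).
have fl0 s : setT s -> 0%R <= (F (outside L y t ++ s))%:E * (bw kp (la y t) s)%:E.
  by move=> sT; rewrite mule_ge0 ?bl0// lee_fin.
have point (u v : R) s : (all inB s -> all (predC inB) t -> u = v) ->
    (u * bw kp lamf (s ++ t) * splitw R inB s t = c t * (v * bw kp (la y t) s))%R.
  move=> uv; rewrite -mulrA [RHS]mulrCA -bw_split /splitw.
  by case: (boolP (all inB s && _)) => [/andP[sB tB]|_]; rewrite ?mulr0// uv.
transitivity ((c t)%:E * (res y t * Z t)%:E).
  have k0 : 0%R <= (c t * res y t)%:E by rewrite lee_fin mulr_ge0//; case/andP: (res01 y t).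
  rewrite -EFinM mulrA EFinM -(ZpE pk (acts y t)) -[RHS](ge0_integralZl (poisson mu) measurableT mbl bl0 k0).
  apply: eq_integral => s _; rewrite -!EFinM; congr EFin; rewrite -[RHS]mulrA; apply: point => sB tB.
  by rewrite /resample /local_act outside_cat// outside_id.
have k0 : 0%R <= (c t)%:E by rewrite lee_fin.
rewrite -local_integral -[LHS](ge0_integralZl (poisson mu) measurableT mfl fl0 k0).
apply: eq_integral => s _; rewrite -!EFinM (point _ (F (outside L y t ++ s)))// => sB tB.
by rewrite outside_id//; apply: sF; rewrite perm_catC.
Qed.

End fixed_center.

(** Tonelli brings the integral over configurations inside, where [resample_stationary] applies for
    each fixed y. *)
Lemma average_stationary : ER mu kp lamf (average phi n lamf L F) = ER mu kp lamf F.
Proof.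
have N0 := volume_gt0 R d n_gt0.
have [bA _] := good_average mphi phi0 phiN lam0 L n_gt0 mlamf lamf01 lamf_supp gF.
apply/EFin_inj; rewrite -(EE_ER pk al bA) -(EE_ER pk al bF) /EE; congr (_ * _).
have M_fin : \int[poisson mu]_s ((F s)%:E * (bw kp lamf s)%:E) = (ER mu kp lamf F * Zr mu kp lamf)%:E.
  have Zp := Zr_gt0 pk al.
  rewrite EFinM -(EE_ER pk al bF) /EE -muleA -EFinM mulVf ?mule1//.
  by rewrite gt_eqF.
pose f (q : P * lst P) : \bar R := ((\1_(Lam n) q.1 * res q.1 q.2)%:E * (bw kp lamf q.2)%:E).
have f0 q : 0%R <= f q.
  by rewrite /f -EFinM lee_fin !mulr_ge0//; case/andP: (res01 q.1 q.2).
have mf : measurable_fun setT f.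
  apply: emeasurable_funM; apply/measurable_EFinP; last exact: (measurableT_comp mbw measurable_snd).
  apply: measurable_funM => //; apply: (measurableT_comp _ measurable_fst).
  by apply: measurable_indic; exact: measurable_Lam.
have m1 (X : lst P) : measurable_fun setT (fun y : P => (\1_(Lam n) y * res y X)%:E).
  exact: (measurable_Lam_resample mphi phi0 phiN lam0 L n_gt0 mlamf lamf01 lamf_supp).
have p1 (X : lst P) (y : P) : setT y -> 0%R <= (\1_(Lam n) y * res y X)%:E.
  by move=> _; rewrite lee_fin mulr_ge0//; case/andP: (res01 y X).
have V0 : 0%R <= ((volume R d n)^-1)%:E by rewrite lee_fin invr_ge0 ltW.
transitivity (\int[poisson mu]_X (((volume R d n)^-1)%:E * \int[mu]_y f (y, X))).
  apply: eq_integral => X _.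
  rewrite (averageE mphi phi0 phiN lam0 L n_gt0 mlamf lamf01 lamf_supp)// -muleA; congr (_ * _).
  rewrite muleC -(ge0_integralZl mu measurableT (m1 X) (p1 X)); last by rewrite lee_fin.
  by apply: eq_integral => y _; rewrite muleC.
have mi : measurable_fun setT (fun X => \int[mu]_y f (y, X)).
  apply: (measurable_integral_sfinite mu (f := fun q : lst P * P => f (q.2, q.1))) => //.
  exact: (measurable_comp2 mf measurable_snd measurable_fst).
have i0 X : setT X -> 0%R <= \int[mu]_y f (y, X) by move=> _; exact: integral_ge0.
rewrite [LHS](ge0_integralZl (poisson mu) measurableT mi i0 V0).
have -> : \int[poisson mu]_X \int[mu]_y f (y, X) = \int[mu]_y \int[poisson mu]_X f (y, X).
  by apply/esym; exact: (sfinite_Fubini mu (poisson mu) f).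
pose M := (ER mu kp lamf F * Zr mu kp lamf)%R.
have M0 : 0%R <= M%:E by rewrite -M_fin; apply: integral_ge0 => s _; rewrite mule_ge0// lee_fin.
have -> : \int[mu]_y \int[poisson mu]_X f (y, X) = \int[mu]_y (M%:E * (\1_(Lam n) y : R)%:E).
  apply: eq_integral => y _; rewrite -M_fin.
  have q0 X : setT X -> 0%R <= (res y X * bw kp lamf X)%:E.
    by move=> _; rewrite lee_fin mulr_ge0//; case/andP: (res01 y X).
  have mq : measurable_fun setT (fun X => (res y X * bw kp lamf X)%:E).
    apply/measurable_EFinP; apply: measurable_funM => //.
    exact: (measurable_comp2 mres (@measurable_cst _ _ (lst P) P setT y) (@measurable_id _ (lst P) setT)).
  have l0 : 0%R <= (\1_(Lam n) y : R)%:E by rewrite lee_fin.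
  rewrite (_ : \int[poisson mu]_s ((F s)%:E * (bw kp lamf s)%:E) = \int[poisson mu]_s (res y s * bw kp lamf s)%:E).
    rewrite muleC -[RHS](ge0_integralZl (poisson mu) measurableT mq q0 l0).
    by apply: eq_integral => X _; rewrite /f -!EFinM -mulrA.
  by rewrite resample_stationary; apply: eq_integral => s _; rewrite EFinM.
have mLam : measurable_fun setT (fun y : P => (\1_(Lam n) y : R)%:E).
  by apply/measurable_EFinP; apply: measurable_indic; exact: measurable_Lam.
have Lam0 (y : P) : setT y -> 0%R <= (\1_(Lam n) y : R)%:E by rewrite lee_fin.
rewrite (ge0_integralZl mu measurableT mLam Lam0 M0) integral_Lam// M_fin.
by rewrite -!EFinM mulrCA (mulVf (lt0r_neq0 N0)) mulr1.
Qed.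

End stationarity.

(** * Mixing time *)

Local Close Scope ereal_scope.

Section counting_events.
Variables (R : realType) (d : nat).
Local Notation P := (ptT R d).

(** Bridges the counting sigma-algebra of events and the order-sensitive one of [lst], where the
    test functions live: the sets with both properties form a sigma-algebra containing the counting
    events. *)
Lemma event_measurable (A : set (confT R d)) : measurable A ->
  measurable (A : set (lst P)) /\ forall s t : seq (pt R d), perm_eq s t -> A s -> A t.
Proof.
pose good_event (B : set (confT R d)) := measurable (B : set (lst P)) /\
  forall s t : seq (pt R d), perm_eq s t -> B s -> B t.
suff : <<s @count_events R d >> `<=` good_event by apply.
apply: smallest_sub.
  split.
  - by split => //; exact: measurable0.
  - move=> B [mB pB]; split.
      by rewrite setTD; exact: measurableC.
    move=> s t st [_ Bs]; split => // Bt; apply: Bs; apply: pB Bt.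
    by rewrite perm_sym.
  - move=> B gB; split; first by apply: bigcup_measurable => i _; case: (gB i).
    by move=> s t st [i _ Bs]; exists i => //; exact: (gB i).2 Bs.
move=> _ [B [k [mB ->]]]; split; last first.
  by move=> s t st /= <-; rewrite /count_in; apply/esym/permP.
have mb : measurable_fun setT (fun x : P => x \in B).
  apply: (measurable_fun_bool true); rewrite setTI (_ : _ @^-1` _ = B) //.
  by apply/seteqP; split=> x; [move=> /set_mem|move=> /mem_set].
have mc := measurable_lcount (b := fun (_ : unit) (x : P) => x \in B) (measurableT_comp mb measurable_snd).
have mc1 := measurable_comp2 mc (@measurable_cst _ _ (lst P) unit setT tt) (@measurable_id _ (lst P) setT).
by have := mc1 measurableT [set k] I; rewrite setTI.
Qed.

Lemma good_indicator (A : set (confT R d)) : measurable A ->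
  good (fun s : lst P => \1_A (s : confT R d) : R).
Proof.
move=> /event_measurable[mA pA]; split; last first.
  move=> s t st; rewrite !indicE; congr (_%:R : R); congr nat_of_bool.
  by apply/idP/idP => /set_mem h; apply/mem_set; apply: pA h; rewrite // perm_sym.
split; first by apply: measurable_indic.
by move=> s; rewrite indicE; case: (_ \in _); rewrite /= ?lexx ?ler01.
Qed.

End counting_events.

(* Holds without measurability because the integral of a nonnegative function is defined as a
   supremum over the simple functions below it. *)
Lemma ge0_le_integral_nonmeasurable dT (T : measurableType dT) (R : realType)
    (mu : {measure set T -> \bar R}) (f g : T -> \bar R) :
  (forall x, 0 <= f x)%E -> (forall x, f x <= g x)%E ->
  (\int[mu]_x f x <= \int[mu]_x g x)%E.
Proof.
move=> f0 fg; rewrite !ge0_integralTE//; last by move=> x; exact: le_trans (f0 x) (fg x).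
apply: le_ereal_sup => _ [h /= hf <-].
by exists h => // x; exact: le_trans (hf x) (fg x).
Qed.

(** [f] is not assumed measurable: in the application it is measurable on [lst], while mu lives on
    the coarser [confT]. The comparison functions (g - c) 1_S, for g >= c, and (g + c) 1_S + 1 on
    the complement of S are measurable, and monotonicity does the rest. *)
Lemma integral_close dT (T : measurableType dT) (R : realType) (mu : probability T R)
    (S : set T) (f : T -> R) (g c : R) : measurable S -> mu S = 1%E ->
  (forall x, 0 <= f x <= 1) -> 0 <= g -> (forall x, S x -> `|f x - g| <= c) ->
  (`| \int[mu]_x (f x)%:E - g%:E | <= c%:E)%E.
Proof.
move=> mS S1 f01 g0 fg.
have [x0 Sx0] : S !=set0.
  by apply/set0P/eqP => S0; move: S1; rewrite S0 measure0 => /eqP; rewrite eqe eq_sym oner_eq0.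
have c0 : 0 <= c by exact: le_trans (fg _ Sx0).
have f0 x : (0 <= (f x)%:E)%E by rewrite lee_fin; case/andP: (f01 x).
have indI (A : set T) : measurable A -> (\int[mu]_x (\1_A x : R)%:E = mu A)%E.
  by move=> mA; rewrite -[in RHS](setIT A); exact: integral_indic.
have indS (e : R) : 0 <= e -> (\int[mu]_x (e * \1_S x)%:E = e%:E)%E.
  move=> e0; have m1 : measurable_fun setT (fun w : T => (\1_S w : R)%:E).
    by apply/measurable_EFinP; exact: measurable_indic.
  have p1 w : setT w -> (0 <= (\1_S w : R)%:E)%E by rewrite lee_fin.
  transitivity (\int[mu]_x (e%:E * (\1_S x : R)%:E))%E; first by apply: eq_integral => x _; rewrite EFinM.
  rewrite (ge0_integralZl mu measurableT m1 p1); last by rewrite lee_fin.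
  by rewrite indI// S1 mule1.
have upper : (\int[mu]_x (f x)%:E <= (g + c)%:E)%E.
  have gc0 : 0 <= g + c by rewrite addr_ge0.
  rewrite -[leRHS]adde0 -[X in (_ + X)%E](_ : \int[mu]_x (\1_(~` S) x : R)%:E = 0)%E; last first.
    by rewrite indI ?probability_setC// ?S1 ?subee//; exact: measurableC.
  rewrite -(indS _ gc0).
  have m1 : measurable_fun setT (fun x => (\1_(~` S) x : R)%:E).
    by apply/measurable_EFinP; apply: measurable_indic; exact: measurableC.
  have m2 : measurable_fun setT (fun x => ((g + c) * \1_S x)%:E).
    by apply/measurable_EFinP; apply: measurable_funM => //; exact: measurable_indic.
  have p1 x : setT x -> (0 <= (\1_(~` S) x : R)%:E)%E by rewrite lee_fin.
  have p2 x : setT x -> (0 <= ((g + c) * \1_S x)%:E)%E by rewrite lee_fin mulr_ge0.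
  rewrite -(ge0_integralD mu measurableT p2 m2 p1 m1); apply: ge0_le_integral_nonmeasurable => // x.
  rewrite -EFinD lee_fin !indicE in_setC; have [xS|xS] := boolP (x \in S).
    by rewrite mulr1 addr0; have := fg _ (set_mem xS); rewrite ler_norml => /andP[_]; lra.
  by rewrite mulr0 add0r; case/andP: (f01 x).
have lower : ((g - c)%:E <= \int[mu]_x (f x)%:E)%E.
  have [gc|gc] := leP 0 (g - c); last first.
    by apply: (@le_trans _ _ 0%E); [rewrite lee_fin ltW|exact: integral_ge0].
  rewrite -(indS _ gc); apply: ge0_le_integral_nonmeasurable => x.
    by rewrite lee_fin mulr_ge0.
  rewrite lee_fin indicE; have [xS|xS] := boolP (x \in S).
    by rewrite mulr1; have := fg _ (set_mem xS); rewrite ler_norml => /andP[+ _]; lra.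
  by rewrite mulr0; case/andP: (f01 x).
have fin : (\int[mu]_x (f x)%:E)%E \is a fin_num.
  by rewrite ge0_fin_numE ?integral_ge0//; exact: le_lt_trans upper (ltry _).
move: upper lower; rewrite -(fineK fin) -EFinB abse_EFin !lee_fin ler_norml => u l.
by apply/andP; split; lra.
Qed.

(** * Number of steps *)

Section time_bound.
Variable R : realType.

Lemma ln2_ge : 2^-1 <= ln 2 :> R.
Proof.
have := expR_ge1Dx (- ln 2 : R); rewrite expRN lnK ?posrE//; lra.
Qed.

(** Since (1 - 1/(2N))^j <= exp(-j/(2N)), the integer part of 2 N ln(N/eps) plus 1 is enough. The
    added 1 is absorbed by N ln(N/eps) >= 1, which follows from N >= 2 and ln 2 >= 1/2. *)
Lemma mixing_time (N eps : R) : 2 <= N -> 0 < eps < 1 ->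
  exists j : nat, j%:R <= 5 * N * ln (N / eps) /\ N * (1 - (2 * N)^-1) ^+ j < eps.
Proof.
move=> N2 /andP[e0 e1]; have N0 : 0 < N by exact: lt_le_trans N2.
have Ne0 : 0 < N / eps by exact: divr_gt0.
have Ne2 : 2 <= N / eps by rewrite ler_pdivlMr//; nra.
pose l := ln (N / eps).
have l2 : ln 2 <= l by rewrite ler_ln ?posrE.
have l0 : 0 <= l by apply: le_trans l2; apply: le_trans ln2_ge.
have x0 : 0 <= 2 * N * l by rewrite !mulr_ge0// ltW.
exists (Num.truncn (2 * N * l)).+1; have /andP[t1 t2] := truncn_itv x0; split.
  rewrite -natr1; have : 1 <= N * l by have := ln2_ge; rewrite -/l; nra.
  by rewrite -/l; nra.
set j := (Num.truncn _).+1 in t2 *.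
have k0 : 0 <= 1 - (2 * N)^-1.
  by rewrite subr_ge0 invf_le1 ?mulr_gt0//; lra.
apply: (@le_lt_trans _ _ (N * expR (- (j%:R / (2 * N))))).
  rewrite -mulrN expRM_natl ler_wpM2l ?(ltW N0)//.
  by apply: lerXn2r; rewrite ?nnegrE ?expR_ge0// expR_ge1Dx.
apply: (@lt_le_trans _ _ (N * expR (- l))).
  rewrite ltr_pM2l// ltr_expR ltrN2 ltr_pdivlMr ?mulr_gt0//.
  by rewrite mulrC.
by rewrite expRN lnK ?posrE// invf_div mulrCA divff ?mulr1// gt_eqF.
Qed.

End time_bound.

(** * Convergence in total variation *)

Section convergence.
Variables (R : realType) (d : nat) (phi : pt R d -> \bar R) (r lam : R).
Hypothesis d_gt0 : (0 < d)%N.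
Hypothesis mphi : borel_efun phi.
Hypothesis phi0 : forall x, (0 <= phi x)%E.
Hypothesis phiN : forall x, phi (- x) = phi x.
Hypothesis r0 : 0 < r.
Hypothesis phir : forall x, r < enorm x -> phi x = 0%E.
Hypothesis lam0 : 0 <= lam.

Local Notation P := (ptT R d).
Local Notation mu := (lebd R d).
Local Notation kp := (kk phi).

Variables (k : nat) (theta : R).
Hypothesis k_gt0 : (0 < k)%N.
Hypothesis theta0 : 0 <= theta.
Hypothesis mixing : forall l (a a' : P -> R) v, act mu a -> act mu a' ->
  (forall x, a x <= lam) ->
  (forall x, enorm (x - v) <= l%:R * (k%:R * r) -> a x = a' x) ->
  `|ins phi a v - ins phi a' v| <= 2 * theta ^+ l.

Variables (K L : R).
Hypothesis K0 : 0 <= K.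
Hypothesis shell_sum : forall T, 2 * (ball_cells d (d%:R + r + r))%:R +
  \sum_(t < T) 2 * (ball_cells d (d%:R + r + r + t.+1%:R * (k%:R * r)))%:R *
    (expR (4 * lam * (2 * (d%:R + r)) ^+ d * theta ^+ t) - 1) <= K.
Hypothesis rin_gt : d%:R < L - d%:R.
Hypothesis thin : K * (((L + d%:R + r) / (L - d%:R)) ^+ d - 1) <= 2^-1.

Variables (n : nat) (lamf : P -> R).
Hypothesis n_gt0 : (0 < n)%N.
Hypothesis mlamf : measurable_fun setT lamf.
Hypothesis lamf01 : forall x, 0 <= lamf x <= lam.
Hypothesis lamf_supp : forall x, ~ Lam n x -> lamf x = 0.

Local Notation avg := (average phi n lamf L).
Local Notation N := (volume R d n).

Let pk : pairfun kp. Proof. exact: pairfun_kk. Qed.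
Let al : act mu lamf. Proof. exact: (act_lamf lam0 n_gt0 mlamf lamf01 lamf_supp). Qed.

Lemma volume_ge2 : 2 <= N.
Proof.
rewrite /volume -natrX ler_nat; apply: (@leq_trans (2 ^ d)).
  by case: d d_gt0 => // m _; rewrite expnS leq_pmulr// expn_gt0.
by rewrite leq_exp2r// leq_pmulr.
Qed.

Let rate : R := 1 - (2 * N)^-1.
Let rate0 : 0 <= rate.
Proof.
have N2 := volume_ge2.
by rewrite subr_ge0 invf_le1 ?mulr_gt0//; lra.
Qed.

Lemma iter_average F j : good F ->
  [/\ good (iter j avg F), osc_le n (iter j avg F) (rate ^+ j) &
    ER mu kp lamf (iter j avg F) = ER mu kp lamf F].
Proof.
move=> gF; elim: j => [|j [gj oj ej]] /=.
  split=> // q X X' _ _ _ _; rewrite expr0.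
  by have [[_ F01] _] := gF; have /andP[_ h] := F01 X; have /andP[h' _] := F01 X'; lra.
split.
- exact: (good_average mphi phi0 phiN lam0 L n_gt0 mlamf lamf01 lamf_supp).
- move=> q X X' qL XL XL' agree; rewrite exprSr; have [bj sj] := gj.
  exact: (average_contracts d_gt0 mphi phi0 phiN r0 phir lam0 k_gt0 theta0 mixing K0 shell_sum
    rin_gt thin n_gt0 mlamf lamf01 lamf_supp bj sj oj (exprn_ge0 _ rate0) qL XL XL' agree).
- by rewrite (average_stationary mphi phi0 phiN lam0 L n_gt0 mlamf lamf01 lamf_supp).
Qed.

(** Lambda_n is a cube of exactly N unit cells, so the iterate takes values within N rate^j of each
    other on its configurations; the Gibbs expectation, preserved by the iteration, averages over
    such configurations. *)
Lemma iter_average_close F j X : good F -> in_Lam n X ->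
  `|iter j avg F X - ER mu kp lamf F| <= N * rate ^+ j.
Proof.
move=> gF XL; have [[bj sj] oj ej] := iter_average j gF; rewrite -ej.
set G := iter j avg F in bj sj oj *.
have c0 : 0 <= N * rate ^+ j by rewrite mulr_ge0 ?exprn_ge0// ltW// volume_gt0.
have pairwise Y Y' : in_Lam n Y -> in_Lam n Y' -> G Y <= G Y' + N * rate ^+ j.
  move=> YL YL'; pose l : pt R d := - \row_(i < d) n%:R.
  have side : (2 * n).-1.+1 = (2 * n)%N by rewrite prednK// muln_gt0.
  have in_cube Z : in_Lam n Z -> [seq x <- Z | x \notin cube l (2 * n).-1.+1%:R] = [::].
    move=> ZL; rewrite (eq_in_filter (a2 := pred0)) ?filter_pred0// => x /ZL xL.
    by rewrite side -Lam_cube mem_set.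
  have := osc_cube (m := (2 * n).-1) (l := l) oj (exprn_ge0 _ rate0) sj YL YL'.
  by rewrite !in_cube// side natrX; apply.
have supp s : bw kp lamf s != 0 -> in_Lam n s.
  move=> /bw_neq0 h x /h; apply: contraNP => /lamf_supp ->; exact/eqP.
have GX0 : 0 <= G X by case/andP: (bj.2 X).
have bX : bounded_by (G X) (fun _ : lst P => G X) := bounded_by_cst _ GX0.
have := le_ER_shift pk al bX bj c0 (fun s s0 => pairwise X s XL (supp s s0)).
have := le_ER_shift pk al bj bX c0 (fun s s0 => pairwise s X (supp s s0) XL).
by rewrite (ER_cst pk al GX0) ler_norml => ? ?; apply/andP; split; lra.
Qed.

Lemma gibbsE (A : set (confT R d)) : measurable A ->
  gibbs phi lamf A = (ER mu kp lamf (fun s : lst P => \1_A (s : confT R d)))%:E.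
Proof.
move=> mA; have [bA _] := good_indicator mA; have [mI I01] := bA.
have b0 s : (0 <= (bw kp lamf s)%:E)%E by exact: (bwe_ge0 pk _ al).
have mb := measurable_bwE pk al.
have wE : gibbs_weight phi lamf = fun s : lst P => (bw kp lamf s)%:E.
  by apply/funext => s; exact: bwE.
rewrite /gibbs wE (poisson_sumE b0 mb) -(EE_ER pk al bA) /EE; congr (_ * _)%E.
apply: (poisson_sumE (F := fun s : lst P => ((\1_A (s : confT R d))%:E * (bw kp lamf s)%:E)%E)).
  by move=> s; rewrite mule_ge0// lee_fin; case/andP: (I01 s).
by apply: emeasurable_funM => //; exact/measurable_EFinP.
Qed.

Lemma law_afterE (mu0 : probability (confT R d) R) j (A : set (confT R d)) : measurable A ->
  law_after phi lamf n L mu0 j A =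
  (\int[mu0]_X (iter j avg (fun s : lst P => \1_A (s : confT R d)) X)%:E)%E.
Proof.
move=> mA; have gA := good_indicator mA; rewrite /law_after; apply: eq_integral => X _.
elim: j X => //= j ih X.
rewrite (_ : iter j _ _ = fun Y : conf R d => (iter j avg (fun s : lst P => \1_A (s : confT R d)) Y)%:E).
  by have [gj _ _] := iter_average j gA;
    exact: (block_stepE mphi phi0 phiN lam0 L n_gt0 mlamf lamf01 lamf_supp).
by apply/funext => Y; exact: ih.
Qed.

Lemma tv_dist_le (mu0 : probability (confT R d) R) (S : set (confT R d)) j : measurable S ->
  mu0 S = 1%E -> (forall X, S X -> in_Lam n X) ->
  (tv_dist (law_after phi lamf n L mu0 j) (gibbs phi lamf) <= (N * rate ^+ j)%:E)%E.
Proof.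
move=> mS S1 SL; apply: ub_ereal_sup => _ [A /= mA <-].
have gA := good_indicator mA; have [[[_ g01] _] _ _] := iter_average j gA.
have [bA _] := gA.
rewrite law_afterE// gibbsE//; apply: (integral_close mS S1) => //.
  exact: (ER_ge0 pk al bA).
by move=> X /SL XL; exact: iter_average_close.
Qed.

End convergence.

(** With u = w/s <= 1 one has (1 + u)^d <= 1 + u 3^d, because (1 + u)(1 + u c) <= 1 + 3 u c for c >=
    1. The lower bound on s reads u (1 + 2 K 3^d) <= 1, hence K u 3^d <= 1/2. *)
Lemma thin_annulus (R : realType) (d : nat) (K w s : R) : 0 <= K -> 0 < w -> w * (1 + 2 * K * 3 ^+ d) <= s ->
  K * (((s + w) / s) ^+ d - 1) <= 2^-1.
Proof.
move=> K0 w0 ws; have t0 : 0 <= 2 * K * 3 ^+ d by rewrite !mulr_ge0// exprn_ge0.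
have s0 : 0 < s by apply: lt_le_trans ws; rewrite mulr_gt0// ltr_pwDl.
pose u := w / s.
have u0 : 0 <= u by rewrite divr_ge0// ltW.
have u1 : u * (1 + 2 * K * 3 ^+ d) <= 1 by rewrite mulrAC ler_pdivrMr// mul1r.
have u1' : u <= 1 by apply: le_trans u1; rewrite ler_peMr// lerDl.
have -> : (s + w) / s = 1 + u by rewrite mulrDl divff ?gt_eqF.
have pow m : (1 + u) ^+ m <= 1 + u * 3 ^+ m.
  elim: m => [|m ih]; first by rewrite !expr0 lerDl mulr1.
  have t1 : 1 <= 3 ^+ m :> R by rewrite exprn_ege1// ler1n.
  rewrite !exprS; apply: (@le_trans _ _ ((1 + u) * (1 + u * 3 ^+ m))).
    by rewrite ler_wpM2l// addr_ge0.
  move: (3 ^+ m) t1 => c t1.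
  have h1 : u <= u * c by rewrite ler_peMr.
  have h2 : u * (u * c) <= u * c by rewrite ler_piMl// mulr_ge0// (le_trans _ t1).
  lra.
apply: (@le_trans _ _ (K * (u * 3 ^+ d))).
  by rewrite ler_wpM2l// lerBlDl.
move: (3 ^+ d) t0 u1 => c t0 u1; nra.
Qed.

(** The mixing time is bounded through witnesses: the supremum over initial laws of the first j at
    distance below eps is at most a given number iff each initial law has such a j below that
    number. *)
Theorem theorem6 (R : realType) (d : nat) (phi : pt R d -> \bar R) (lam : R) :
  (0 < d)%N ->
  borel_efun phi ->
  (forall x, (0 <= phi x)%E) ->
  (forall x, phi (- x) = phi x) ->
  (exists r : R, forall x, r < enorm x -> phi x = 0%E) ->
  (lam%:E * Delta_phi phi < (expR 1)%:E)%E ->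
  exists L0 : R, 0 < L0 /\
  forall L : R, L0 <= L ->
  exists C : R, 0 < C /\
  forall (n : nat) (lamf : pt R d -> R),
    (0 < n)%N ->
    borel_fun lamf ->
    (forall x, 0 <= lamf x <= lam) ->
    (forall x, ~ Lam n x -> lamf x = 0) ->
    forall eps : R, 0 < eps < 1 ->
    forall mu0 : probability (confT R d) R,
      (exists S : set (confT R d), measurable S /\
         S `<=` [set X | uniq X /\ forall x, x \in X -> Lam n x] /\
         mu0 S = 1%E) ->
      exists j : nat,
        j%:R <= C * volume R d n * ln (volume R d n / eps) /\
        (tv_dist (law_after phi lamf n L mu0 j) (gibbs phi lamf) < eps%:E)%E.
Proof.
move=> d_gt0 mphi phi0 phiN [r' phir'] subcritical.
(* For lam < 0 no function satisfies 0 <= lamf x <= lam, and any L0 and C do. *)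
have [lam0|lam0] := leP 0 lam; last first.
  exists 1; split => // L _; exists 1; split => // n lamf _ _ lamf01.
  by have /andP[h h'] := lamf01 0; have := le_trans h h'; rewrite leNgt lam0.
(* The number of shells is obtained by dividing by r, so the range is enlarged to a positive one. *)
pose r := Num.max r' 1.
have r0 : 0 < r by rewrite lt_max ltr01 orbT.
have phir x : r < enorm x -> phi x = 0%E.
  by move=> rx; apply: phir'; apply: le_lt_trans rx; rewrite le_max lexx.
have [k [theta [k_gt0 theta01 mixing]]] :=
  strong_spatial_mixing d_gt0 mphi phi0 phiN (ltW r0) phir lam0 subcritical.
have /andP[theta0 _] := theta01.
have rho0 : 0 <= d%:R + r + r by rewrite !addr_ge0// ltW.
have step0 : 0 <= k%:R * r by rewrite mulr_ge0// ltW.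
have c0 : 0 <= 4 * lam * (2 * (d%:R + r)) ^+ d.
  by rewrite !mulr_ge0// exprn_ge0// mulr_ge0// addr_ge0// ltW.
have [K K0 shell_sum] := shell_sum_bounded d rho0 step0 c0 theta01.
pose w : R := 2 * d%:R + r.
have d0 : 0 <= d%:R :> R by [].
have w0 : 0 < w by rewrite ltr_wpDl// mulr_ge0.
(* From [thin_annulus] with s = L - d and w = 2 d + r, the width of the annulus between L - d and L
   + d + r. *)
pose L0 : R := d%:R + w * (1 + 2 * K * 3 ^+ d).
have wL0 : w <= w * (1 + 2 * K * 3 ^+ d).
  by rewrite ler_peMr ?(ltW w0)// lerDl !mulr_ge0// exprn_ge0.
exists L0; split; first by rewrite ltr_wpDl// (lt_le_trans w0).
move=> L L0L.
have rin_gt : d%:R < L - d%:R by move: L0L wL0 r0 d0; rewrite /L0 /w; move: (3 ^+ d) => c; lra.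
have thin : K * (((L + d%:R + r) / (L - d%:R)) ^+ d - 1) <= 2^-1.
  rewrite (_ : L + d%:R + r = (L - d%:R) + w); last by rewrite /w; lra.
  by apply: thin_annulus => //; move: L0L; rewrite /L0 lerBrDl.
exists 5; split => // n lamf n_gt0 blamf lamf01 lamf_supp eps eps01 mu0 [S [mS [SL S1]]].
have mlamf : measurable_fun setT (lamf : ptT R d -> R) by move=> _ B mB; rewrite setTI; exact: blamf.
have [j [jle jlt]] := mixing_time (volume_ge2 R d_gt0 n_gt0) eps01.
exists j; split => //; apply: (@le_lt_trans _ _ (volume R d n * (1 - (2 * volume R d n)^-1) ^+ j)%:E); last by rewrite lte_fin.
apply: (tv_dist_le d_gt0 mphi phi0 phiN r0 phir lam0 k_gt0 theta0 mixing K0 shell_sum rin_gt thin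
  n_gt0 mlamf lamf01 lamf_supp j mS S1).
by move=> X /SL[].
Qed.
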